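(* Let $d\ge1$, $s\in(0,1)$, let $\mathcal L\subset\mathbb N=\{0,1,2,\dots\}$ be finite, and let $R_1>0$. Let $\phi:\mathbb R^d\to\mathbb R$ be a bounded Lipschitz function and let $c_l:B(0,R_1)\to\mathbb R$, $l\in\mathcal L$, be bounded continuous functions. Then there exists $R_0\in(0,R_1]$ such that for every $R\in(0,R_0]$ the nonlinear problem $$\Delta_s u(x)+\sum_{l\in\mathcal L}c_l(x)u^l(x)=u(x),\quad x\in B(0,R),\qquad u(x)=\phi(x),\quad x\in\mathbb R^d\setminus B(0,R),$$ admits a continuous viscosity solution.
   Context: $B(x,r)$ denotes the open ball of radius $r$ centered at $x\in\mathbb R^d$. Fractional Laplacian: $\Delta_s u(x)=-(-\Delta)^s u(x)=\frac{4^s\Gamma(s+d/2)}{\pi^{d/2}|\Gamma(-s)|}\lim_{r\to0^+}\int_{\mathbb R^d\setminus B(0,r)}\frac{u(x+z)-u(x)}{|z|^{d+2s}}\,dz$. Write $f(x,y)=\sum_{l\in\mathcal L}c_l(x)y^l$, with $y^0=1$. Continuous viscosity solution: a function $u:\mathbb R^d\to\mathbb R$, continuous on $\overline B(0,R)$, with $u=\phi$ on $\mathbb R^d\setminus B(0,R)$, which is both a viscosity subsolution and supersolution. Subsolution: for every $x_0\in B(0,R)$, every open neighborhood $U$ of $x_0$ with $\overline U\subset B(0,R)$ and every $\xi\in\mathcal C^2(\overline U)$ with $\xi(x_0)=u(x_0)$ and $\xi\ge u$ on $U$, the function $w$ equal to $\xi$ on $U$ and to $u$ on $\mathbb R^d\setminus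 U$ satisfies $\Delta_s w(x_0)+f(x_0,u(x_0))-u(x_0)\ge0$. Supersolution: the same with $\xi\le u$ on $U$ and the reverse inequality $\le 0$. *)

(* Defs.v *)
From HB Require Import structures.
From mathcomp Require Import all_boot all_order all_algebra.
From mathcomp Require Import finmap.
From mathcomp Require Import all_classical all_reals all_analysis.

Set Implicit Arguments.
Unset Strict Implicit.
Unset Printing Implicit Defensive.

Import Order.TTheory GRing.Theory Num.Theory.
Import numFieldNormedType.Exports.

Local Open Scope classical_set_scope.
Local Open Scope ring_scope.

(* Points of R^d are row vectors.  The library norm `|x| on 'rV[R]_d is the sup
   norm, hence the separate Euclidean norm; both induce the same topology. *)

Definition enorm {R : realType} {d : nat} (x : 'rV[R]_d) : R :=
  Num.sqrt (\sum_(i < d) x 0 i ^+ 2).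

Definition eball {R : realType} {d : nat} (x : 'rV[R]_d) (r : R) :
  set 'rV[R]_d := [set y | enorm (y - x) < r].

(* Lebesgue measure on R^d, obtained by iterating the binary product measure.
   It lives on tuples, which carry the product sigma-algebra in the library. *)

(* The library's sigma-finite instance of a product measure is shadowed by its
   later subprobability instance, hence this lemma. *)
Lemma sigma_finite_product d1 d2 (T1 : measurableType d1)
    (T2 : measurableType d2) (R : realType)
    (m1 : {sigma_finite_measure set T1 -> \bar R})
    (m2 : {sigma_finite_measure set T2 -> \bar R}) :
  sigma_finite setT (product_measure1 m1 m2).
Proof.
have /sigma_finiteP[F [TF ndF Foo]] := sigma_finiteT m1.
have /sigma_finiteP[G [TG ndG Goo]] := sigma_finiteT m2.
exists (fun n => F n `*` G n).
  rewrite -setXTT TF TG predeqE => -[x y]; split.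
    move=> [/= [n _ Fnx] [k _ Gky]]; exists (maxn n k) => //; split.
    - by move: x Fnx; exact/subsetPset/ndF/leq_maxl.
    - by move: y Gky; exact/subsetPset/ndG/leq_maxr.
  by move=> [n _ []/= ? ?]; split; exists n.
move=> k; have [? ?] := Foo k; have [? ?] := Goo k.
split; first exact: measurableX.
by rewrite product_measure1E// lte_mul_pinfty// ge0_fin_numE.
Qed.

Section cons_measure.
Local Open Scope ereal_scope.
Context d (T : measurableType d) {R : realType} {n : nat}.
Variable l : {sigma_finite_measure set T -> \bar R}.
Variable m : {sigma_finite_measure set (n.-tuple T) -> \bar R}.

Definition cons_pair (p : T * n.-tuple T) : n.+1.-tuple T :=
  [the n.+1.-tuple T of p.1 :: p.2].

Lemma measurable_cons_pair : measurable_fun setT cons_pair.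
Proof. by apply: measurable_cons; [exact: measurable_fst|exact: measurable_snd]. Qed.

Definition cons_measure : set (n.+1.-tuple T) -> \bar R :=
  pushforward (l \x m) cons_pair.

Let cons_measure0 : cons_measure set0 = 0.
Proof. by rewrite /cons_measure /pushforward preimage_set0 measure0. Qed.

Let cons_measure_ge0 A : 0 <= cons_measure A.
Proof. by rewrite /cons_measure /pushforward; exact: measure_ge0. Qed.

Let cons_measure_sigma_additive : semi_sigma_additive cons_measure.
Proof.
move=> F mF tF mUF; rewrite /cons_measure /pushforward preimage_bigcup.
have mc k : measurable (cons_pair @^-1` F k).
  by rewrite -[X in measurable X]setTI; exact: measurable_cons_pair.
apply: measure_semi_sigma_additive => //.
- apply/trivIsetP => /= i j _ _ ij; rewrite -preimage_setI.
  by move/trivIsetP : tF => /(_ _ _ _ _ ij) ->//; rewrite preimage_set0.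
- exact: bigcup_measurable.
Qed.

HB.instance Definition _ := isMeasure.Build _ _ _ cons_measure
  cons_measure0 cons_measure_ge0 cons_measure_sigma_additive.

Let cons_measure_sigma_finite : sigma_finite setT cons_measure.
Proof.
have [F TF mF] : sigma_finite setT (l \x m) by exact: sigma_finite_product.
pose g (t : n.+1.-tuple T) : T * n.-tuple T :=
  (thead t, [tuple of behead t]).
have mg : measurable_fun setT g.
  apply/measurable_fun_pairP; split; first exact: measurable_tnth.
  exact: measurable_behead.
have gK p : g (cons_pair p) = p.
  by case: p => x t; congr pair; exact: val_inj.
exists (fun k => g @^-1` F k); first by rewrite -preimage_bigcup -TF.
move=> k; have [mFk Foo] := mF k; split.
  by rewrite -[X in measurable X]setTI; exact: mg.
rewrite /cons_measure /pushforward -comp_preimage.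
by rewrite (_ : g \o cons_pair = id) ?preimage_id//; exact/funext.
Qed.

HB.instance Definition _ := Measure_isSigmaFinite.Build _ _ _ cons_measure
  cons_measure_sigma_finite.

End cons_measure.

Fixpoint lebesgue_tuple (R : realType) (n : nat) :
    {sigma_finite_measure set (n.-tuple (measurableTypeR R)) -> \bar R} :=
  match n with
  | 0%N => \d_ (@nil_tuple (measurableTypeR R))
  | k.+1 => cons_measure (@lebesgue_measure R) (lebesgue_tuple R k)
  end.

Lemma measurable_tuple_box d (T : measurableType d) (n : nat)
    (A : 'I_n -> set T) : (forall i, measurable (A i)) ->
  measurable [set t : n.-tuple T | forall i, A i (tnth t i)].
Proof.
move=> mA.
rewrite (_ : mkset _ = \bigcap_(i in [set: 'I_n]) ((@tnth n T ^~ i) @^-1` A i)).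
  apply: fin_bigcap_measurable => // i _.
  by rewrite -[X in measurable X]setTI; exact: measurable_tnth.
by apply/seteqP; split => [t At i _|t At i]; exact: At.
Qed.

(* Fixes the normalisation and orientation of the construction. *)
Lemma lebesgue_tuple_box (R : realType) (n : nat) (A : 'I_n -> set R) :
    (forall i, measurable (A i : set (measurableTypeR R))) ->
  (lebesgue_tuple R n [set t | forall i, A i (tnth t i)] =
   \prod_(i < n) lebesgue_measure (A i))%E.
Proof.
elim: n A => [|n IH] A mA.
  by rewrite big_ord0 /= diracE mem_set//= => -[].
rewrite big_ord_recl /= /cons_measure /pushforward.
rewrite (_ : _ @^-1` _ = A ord0 `*`
    [set t | forall i, A (lift ord0 i) (tnth t i)]); last first.
  apply/seteqP; split => -[x t] /=.
    move=> At; split; first exact: (At ord0).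
    by move=> i; have := At (lift ord0 i); rewrite tnthS.
  by move=> [Ax At] i; case: (unliftP ord0 i) => [j|] ->; rewrite ?tnthS.
rewrite product_measure1E//; first by congr (_ * _)%E; exact: IH.
apply: (@measurable_tuple_box _ (measurableTypeR R) n (fun i => A (lift ord0 i))).
by move=> i; exact: mA.
Qed.

Definition rowt {R : realType} {d : nat} (t : d.-tuple (measurableTypeR R)) :
  'rV[R]_d := \row_i tnth t i.

(* Euler's integral for x > 0, extended to negative non-integers by
   Gamma (x + n) = x (x + 1) ... (x + n - 1) Gamma x, with n the least natural
   number such that 0 < x + n.  The value at the poles is 0. *)

Definition euler_integral {R : realType} (x : R) : R :=
  \int[lebesgue_measure]_(t in `]0, +oo[) (t `^ (x - 1) * expR (- t)).

Definition Gamma {R : realType} (x : R) : R :=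
  let n := if 0 < x then 0%N else (Num.truncn (- x)).+1 in
  euler_integral (x + n%:R) / \prod_(k < n) (x + k%:R).

Definition frac_integrand {R : realType} {d : nat} (s : R) (u : 'rV[R]_d -> R)
    (x : 'rV[R]_d) (t : d.-tuple (measurableTypeR R)) : R :=
  (u (x + rowt t) - u x) / enorm (rowt t) `^ (d%:R + 2 * s).

Definition out_eball {R : realType} {d : nat} (r : R) :
  set (d.-tuple (measurableTypeR R)) := [set t | ~ eball 0 r (rowt t)].

Definition frac_truncated {R : realType} {d : nat} (s : R)
    (u : 'rV[R]_d -> R) (x : 'rV[R]_d) (r : R) : R :=
  \int[lebesgue_tuple R d]_(t in out_eball r) frac_integrand s u x t.

Definition frac_laplacian_const {R : realType} (d : nat) (s : R) : R :=
  4 `^ s * Gamma (s + d%:R / 2) / (pi `^ (d%:R / 2) * `|Gamma (- s)|).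

Definition frac_laplacian {R : realType} {d : nat} (s : R)
    (u : 'rV[R]_d -> R) (x : 'rV[R]_d) : R :=
  frac_laplacian_const d s * lim (frac_truncated s u x r @[r --> 0^'+]).

(* [frac_laplacian] is a total function; this says that its value is the
   actual one, i.e. that the integrals and the limit exist. *)
Definition frac_laplacian_exists {R : realType} {d : nat} (s : R)
    (u : 'rV[R]_d -> R) (x : 'rV[R]_d) : Prop :=
  (forall r, 0 < r -> (lebesgue_tuple R d).-integrable (out_eball r)
     (fun t => (frac_integrand s u x t)%:E)) /\
  cvg (frac_truncated s u x r @[r --> 0^'+]).

(* C^2 on the closure of an open set U: the partial derivatives of order at
   most 2 exist in U and extend continuously to the closure of U. *)
Definition C2_closure {R : realType} {d : nat} (U : set 'rV[R]_d)
    (xi : 'rV[R]_d -> R) : Prop :=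
  {within closure U, continuous xi} /\
  exists (D1 : 'I_d -> 'rV[R]_d -> R) (D2 : 'I_d -> 'I_d -> 'rV[R]_d -> R),
  forall i,
    [/\ {within closure U, continuous (D1 i)},
        forall x, U x -> is_derive x (delta_mx 0 i : 'rV[R]_d) xi (D1 i x) &
        forall j, {within closure U, continuous (D2 i j)} /\
          forall x, U x ->
            is_derive x (delta_mx 0 j : 'rV[R]_d) (D1 i) (D2 i j x)].

Section viscosity.
Context {R : realType} {d : nat}.
Implicit Types (s r : R) (f : 'rV[R]_d -> R -> R) (u xi phi : 'rV[R]_d -> R).

Definition test_neighborhood r (x0 : 'rV[R]_d) (U : set 'rV[R]_d) : Prop :=
  [/\ open U, U x0 & closure U `<=` eball 0 r].

(* [patch u U xi] is xi on U and u outside U. *)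

Definition viscosity_subsolution s f r u : Prop :=
  forall x0 U xi, eball 0 r x0 -> test_neighborhood r x0 U ->
    C2_closure U xi -> xi x0 = u x0 -> (forall x, U x -> u x <= xi x) ->
    let w := patch u U xi in
    frac_laplacian_exists s w x0 /\
    0 <= frac_laplacian s w x0 + f x0 (u x0) - u x0.

Definition viscosity_supersolution s f r u : Prop :=
  forall x0 U xi, eball 0 r x0 -> test_neighborhood r x0 U ->
    C2_closure U xi -> xi x0 = u x0 -> (forall x, U x -> xi x <= u x) ->
    let w := patch u U xi in
    frac_laplacian_exists s w x0 /\
    frac_laplacian s w x0 + f x0 (u x0) - u x0 <= 0.

(* Continuous viscosity solution of Delta_s u + f(x, u) = u in B(0, r) with
   u = phi on the complement. *)
Definition continuous_viscosity_solution s f phi r u : Prop :=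
  [/\ {within closure (eball 0 r), continuous u},
      forall x, ~ eball 0 r x -> u x = phi x,
      viscosity_subsolution s f r u &
      viscosity_supersolution s f r u].

Definition poly_nonlinearity (L : {fset nat}) (c : nat -> 'rV[R]_d -> R) :
  'rV[R]_d -> R -> R := fun x y => \sum_(l <- L) c l x * y ^+ l.

Definition bounded_Lipschitz phi : Prop :=
  (exists M, forall x, `|phi x| <= M) /\
  (exists K, forall x y, `|phi x - phi y| <= K * enorm (x - y)).

Definition bounded_continuous_on (A : set 'rV[R]_d) (g : 'rV[R]_d -> R) :
    Prop :=
  (exists M, forall x, A x -> `|g x| <= M) /\ {within A, continuous g}.

End viscosity.

(* Main.v *)
Require Import Defs.
From HB Require Import structures.
From mathcomp Require Import all_boot all_order all_algebra.
From mathcomp Require Import finmap.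
From mathcomp Require Import all_classical all_reals all_analysis.
From mathcomp Require Import measurable_realfun.
From mathcomp Require Import ring lra.

(** No comparison principle for viscosity solutions is used.  Truncate the kernel
    [nu(dz) = |z|^-(d+2s) dz] at [|z| >= e].  The truncated problem is a monotone
    fixed-point equation in the pointwise order, solvable by Knaster-Tarski; the
    integral in it may be an upper integral, so its solution [u_e] need not be
    measurable.  The gain is the killing rate [nu(|z| >= 2r)], of order [r^-2s]:
    every jump of that size leaves [B(0,r)], so for small [r] the killing rate
    beats both the size and the Lipschitz constant of the nonlinearity.

    The [u_e] are equicontinuous up to an error vanishing with [e].  At the boundary
    this comes from the barrier [(r - |x| + e)^b] with [b] small: it is concave
    near [x], and the loss due to jumps out of the ball is of order [1] while the
    gain due to long jumps is of order [b].  In the interior it comes from comparing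
    [u_e] with its translates, the killing rate absorbing the nonlinearity.

    Hence [u_e] converges uniformly along an ultrafilter finer than [e -> 0+].  If
    [xi] touches the limit [u] from above at [x0], a near-maximum point of
    [u_e - xi - |. - x0|^2] tends to [x0]; there the integral of [u_e] over
    [|z| < rho'] is at most [O(rho'^(2-2s))] by Taylor's formula for [xi] and the
    rest passes to the limit.  It remains to let [rho'] tend to [0]. *)

Set Implicit Arguments.
Unset Strict Implicit.
Unset Printing Implicit Defensive.

Import Order.TTheory GRing.Theory Num.Theory.
Import numFieldNormedType.Exports.

Local Open Scope classical_set_scope.
Local Open Scope ring_scope.

(** * Euclidean norm *)

(** At fixed [e] the kernel has finite mass [lam], and this replaces attained maxima: a solution of
    the truncated problem need be neither continuous nor measurable, so suprema are only approached
    and its integral is never formed. It enters through integrable majorants [h] of its increments.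
    At a point whose value [v] lies below a supremum [m], the majorant carries the slack [m - v],
    which costs [(m - v) * lam]; if the rest of the inequality has a definite sign, every value is
    at most [m] minus a positive amount of order 1/(C lam + 1), which contradicts the definition of
    [m]. The resulting estimates do not contain [lam], hence survive [e -> 0+]. The level [M]
    exceeds a bound of |phi| by 1: a jump out of the ball loses at least 1 from the level [M], so a
    killing rate [kappa] with F <= C kappa keeps the solution below [M]. The two-point estimate
    needs K + 1 <= C kappa: [K] absorbs the nonlinearity and 1 is left over. Both hold for small
    [r], since [M], [F] and [K] are fixed before [r]. *)

Section euclidean.
Context {R : realType} {d : nat}.
Implicit Types (x y z n : 'rV[R]_d) (r : R).

Definition dot x y : R := \sum_(i < d) x 0 i * y 0 i.

Lemma dotC x y : dot x y = dot y x.
Proof. by apply: eq_bigr => i _; rewrite mulrC. Qed.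

Lemma dotDr x y z : dot x (y + z) = dot x y + dot x z.
Proof. by rewrite -big_split; apply: eq_bigr => i _; rewrite mxE mulrDr. Qed.

Lemma dotDl x y z : dot (x + y) z = dot x z + dot y z.
Proof. by rewrite !(dotC _ z) dotDr. Qed.

Lemma dotNr x y : dot x (- y) = - dot x y.
Proof. by rewrite -sumrN; apply: eq_bigr => i _; rewrite mxE mulrN. Qed.

Lemma dotNl x y : dot (- x) y = - dot x y.
Proof. by rewrite !(dotC _ y) dotNr. Qed.

Lemma dotZr r x y : dot x (r *: y) = r * dot x y.
Proof. by rewrite mulr_sumr; apply: eq_bigr => i _; rewrite mxE mulrCA. Qed.

Lemma dotZl r x y : dot (r *: x) y = r * dot x y.
Proof. by rewrite !(dotC _ y) dotZr. Qed.

Lemma enorm_ge0 x : 0 <= enorm x.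
Proof. exact: sqrtr_ge0. Qed.

Lemma sqr_enorm x : enorm x ^+ 2 = dot x x.
Proof.
rewrite sqr_sqrtr; first by apply: eq_bigr => i _; rewrite expr2.
by apply: sumr_ge0 => i _; exact: sqr_ge0.
Qed.

Lemma enorm0 : enorm (0 : 'rV[R]_d) = 0.
Proof. by rewrite /enorm big1 ?sqrtr0// => i _; rewrite mxE expr0n. Qed.

Lemma enormZ r x : enorm (r *: x) = `|r| * enorm x.
Proof.
rewrite /enorm -sqrtr_sqr -sqrtrM ?sqr_ge0//; congr Num.sqrt.
by rewrite mulr_sumr; apply: eq_bigr => i _; rewrite mxE exprMn.
Qed.

Lemma enormN x : enorm (- x) = enorm x.
Proof. by rewrite -scaleN1r enormZ normrN normr1 mul1r. Qed.

Lemma enormBC x y : enorm (x - y) = enorm (y - x).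
Proof. by rewrite -enormN opprB. Qed.

Lemma coord_le_enorm x i : `|x 0 i| <= enorm x.
Proof.
rewrite -sqrtr_sqr ler_wsqrtr// (bigD1 i)//= lerDl.
by apply: sumr_ge0 => j _; exact: sqr_ge0.
Qed.

Lemma enorm_eq0 x : enorm x = 0 -> x = 0.
Proof.
move=> x0; apply/rowP => i; rewrite mxE; apply/eqP; rewrite -normr_le0 -x0.
exact: coord_le_enorm.
Qed.

Lemma dot_le x y : dot x y <= enorm x * enorm y.
Proof.
have [->|y0] := eqVneq y 0.
  by rewrite /dot big1 ?mulr_ge0 ?enorm_ge0// => i _; rewrite mxE mulr0.
have ny : 0 < enorm y.
  by rewrite lt_def enorm_ge0 andbT; apply: contra_neq y0; exact: enorm_eq0.
have [->|x0] := eqVneq x 0.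
  by rewrite /dot big1 ?mulr_ge0 ?enorm_ge0// => i _; rewrite mxE mul0r.
have nx : 0 < enorm x.
  by rewrite lt_def enorm_ge0 andbT; apply: contra_neq x0; exact: enorm_eq0.
have : 0 <= dot (enorm y *: x + - (enorm x *: y)) (enorm y *: x + - (enorm x *: y)).
  by apply: sumr_ge0 => i _; rewrite -expr2 sqr_ge0.
rewrite !(dotDr, dotNr, dotZr) ![dot (_ + _) _]dotC !(dotDr, dotNr, dotZr).
rewrite -!sqr_enorm (dotC y x) => h.
have {h} : 0 <= (enorm x * enorm y) * (enorm x * enorm y - dot x y) *+ 2.
  by apply: le_trans h _; rewrite le_eqVlt; apply/orP; left; apply/eqP; ring.
by rewrite pmulrn_lge0// pmulr_rge0 ?mulr_gt0// subr_ge0.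
Qed.

Lemma ler_enormD x y : enorm (x + y) <= enorm x + enorm y.
Proof.
rewrite -(@ler_pXn2r _ 2)// ?nnegrE ?addr_ge0 ?enorm_ge0//.
rewrite sqr_enorm dotDr ![dot (_ + _) _]dotC !dotDr -!sqr_enorm (dotC y x) sqrrD.
have := dot_le x y; lra.
Qed.

Lemma ler_enormB x y z : enorm (x - z) <= enorm (x - y) + enorm (y - z).
Proof. by rewrite (le_trans _ (ler_enormD _ _))// addrA subrK. Qed.

Lemma norm_le_enorm x : `|x| <= enorm x.
Proof.
rewrite /Num.norm/= mx_normrE; apply: bigmax_le; first exact: enorm_ge0.
by move=> [i j] _ /=; rewrite ord1; exact: coord_le_enorm.
Qed.

Lemma coord_le_norm x i : `|x 0 i| <= `|x|.
Proof.
rewrite [leRHS]/Num.norm/= mx_normrE; apply/bigmax_geP; right.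
by exists (0, i).
Qed.

Lemma enorm_le_sum x : enorm x <= \sum_(i < d) `|x 0 i|.
Proof.
rewrite -(@ler_pXn2r _ 2)// ?nnegrE ?enorm_ge0 ?sumr_ge0//.
rewrite sqr_enorm expr2 mulr_suml; apply: ler_sum => i _.
have -> : x 0 i * x 0 i = `|x 0 i| * `|x 0 i| by rewrite -normrM ger0_norm// -expr2
  sqr_ge0.
by rewrite ler_wpM2l// (bigD1 i)//= lerDl sumr_ge0.
Qed.

Lemma enorm_le_norm x : enorm x <= d%:R * `|x|.
Proof.
rewrite (le_trans (enorm_le_sum x))// mulr_natl -[X in _ *+ X]card_ord -sumr_const.
by apply: ler_sum => i _; exact: coord_le_norm.
Qed.

Lemma enorm_ball_nbhs x r : 0 < r -> nbhs x (eball x r).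
Proof.
move=> r0; apply/nbhs_ballP; exists (r / d.+1%:R) => /=; first by rewrite divr_gt0.
move=> y; rewrite -ball_normE/= => xy; rewrite /eball/=.
rewrite enormBC (le_lt_trans (enorm_le_norm _))//.
have d0 : d%:R < d.+1%:R :> R by rewrite ltr_nat.
rewrite ltr_pdivlMr// mulrC in xy; apply: le_lt_trans xy.
by rewrite ler_wpM2r// ltW.
Qed.

Lemma near_eball x r (P : 'rV[R]_d -> Prop) : 0 < r ->
  (forall y, enorm (y - x) < r -> P y) -> \forall y \near x, P y.
Proof.
move=> r0 rP; have /nbhs_ballP[e/= e0 eE] := enorm_ball_nbhs x r0.
by apply/nbhs_ballP; exists e => // y /eE /rP.
Qed.

Lemma nbhs_eball x (A : set 'rV[R]_d) :
  nbhs x A -> exists2 r, 0 < r & eball x r `<=` A.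
Proof.
move=> /nbhs_ballP[r/= r0 rA]; exists r => // y; rewrite /eball/= => yx.
by apply: rA; rewrite -ball_normE/= (le_lt_trans (norm_le_enorm _))// enormBC.
Qed.

Lemma continuous_enorm : continuous (@enorm R d).
Proof.
move=> x; apply/(@cvgrPdist_lt _ _ _ (nbhs x) (nbhs_filter x)) => e e0.
apply: (near_eball e0) => y; move=> yx.
apply: le_lt_trans yx; rewrite ler_norml; apply/andP; split.
  by rewrite lerNl opprB lerBlDr -{1}(subrK x y) ler_enormD.
by rewrite lerBlDr enormBC -{1}(subrK y x) ler_enormD.
Qed.

Lemma open_eball x r : open (eball x r).
Proof.
rewrite openE => y; rewrite /interior /eball/= => yx.
have h : 0 < r - enorm (y - x) by rewrite subr_gt0.
apply: (near_eball h) => z zy; rewrite /eball/=.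
by rewrite (le_lt_trans (ler_enormB _ y _))// -ltrBrDr.
Qed.

Lemma closed_cball r : closed [set x | enorm (x : 'rV[R]_d) <= r].
Proof.
rewrite (_ : mkset _ = enorm @^-1` [set y | y <= r])//.
by apply: closed_comp; [move=> x _; exact: continuous_enorm|exact: closed_le].
Qed.

Lemma compact_cball r : compact [set x | enorm (x : 'rV[R]_d) <= r].
Proof.
apply: bounded_closed_compact; last exact: closed_cball.
exists r; split; first exact: num_real.
move=> M rM x /= xr; rewrite (le_trans (norm_le_enorm _))//.
by rewrite (le_trans xr)// ltW.
Qed.

End euclidean.

(** * Measurability and reflection on tuples *)

Section tuple_measurability.
Context {R : realType} {d : nat}.
Local Notation T := (d.-tuple (measurableTypeR R)).

Lemma measurable_box (q : 'I_d -> R) (e : R) :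
  measurable [set t : T | forall i, `|tnth t i - q i| < e].
Proof.
apply: (@measurable_tuple_box _ (measurableTypeR R) d (fun i =>
  [set y | `|y - q i| < e])).
move=> i; rewrite (_ : mkset _ = `](q i - e), (q i + e)[%classic).
  exact: measurable_itv.
by apply/seteqP; split => y /=; rewrite in_itv/= ltr_distl.
Qed.

(** Tuples carry the product sigma-algebra, so an open set is exhausted by countably many boxes:
    rational centres, radii 1/(k+1), and a box is kept only if it lies in [O]. *)
Lemma measurable_rowt_open (O : set 'rV[R]_d) : open O ->
  measurable ((@rowt R d) @^-1` O).
Proof.
move=> oO.
pose box (p : 'rV[rat]_d * nat) : set T :=
  [set t | forall i, `|tnth t i - ratr (p.1 0 i)| < p.2.+1%:R^-1].
pose F (p : 'rV[rat]_d * nat) : set T :=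
  if pselect (box p `<=` rowt @^-1` O) then box p else set0.
have -> : rowt @^-1` O = \bigcup_p F p; last first.
  apply: countable_bigcupT_measurable; first exact: countableP.
  move=> p; rewrite /F; case: pselect => h /=; last exact: measurable0.
  exact: (@measurable_box (fun i => ratr (p.1 0 i))).
apply/seteqP; split => [t Ot|t [p _]]; last first.
  by rewrite /F; case: pselect => // h /h.
have /nbhs_ballP[e/= e0 eO] := (@open_nbhs_nbhs _ (rowt t) O (conj oO Ot)).
have [k ke] : exists k : nat, k.+1%:R^-1 < e / 2.
  exists (Num.truncn (e / 2)^-1); rewrite invf_plt ?posrE ?divr_gt0//.
  by rewrite truncnS_gt.
have k0 : 0 < k.+1%:R^-1 :> R by rewrite invr_gt0.
have qP i : exists q : rat, `|tnth t i - ratr q| < k.+1%:R^-1.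
  have /rat_in_itvoo[q] : tnth t i - k.+1%:R^-1 < tnth t i by rewrite ltrBlDr ltrDl.
  rewrite in_itv/= => /andP[q1 q2]; exists q; rewrite gtr0_norm ?subr_gt0//.
  by rewrite ltrBlDr -ltrBlDl.
pose q := \row_(i < d) projT1 (cid (qP i)).
have Bt : box (q, k) t by move=> i /=; rewrite mxE; exact: projT2 (cid (qP i)).
exists (q, k) => //; rewrite /F; case: pselect => //; case=> t' /= Bt'.
apply: eO; rewrite -ball_normE/=.
rewrite [ltLHS]/Num.norm/= mx_normrE; apply: bigmax_lt => // -[i j] _ /=.
rewrite ord1 !mxE; have := Bt j; have := Bt' j; rewrite /= mxE => h1 h2.
have -> : tnth t j - tnth t' j = (tnth t j - ratr (projT1 (cid (qP j))))
   - (tnth t' j - ratr (projT1 (cid (qP j)))) by ring.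
rewrite (le_lt_trans (ler_normB _ _))// (splitr e) ltrD//.
  exact: lt_trans ke.
exact: lt_trans ke.
Qed.

Lemma measurable_rowt_shift (O : set 'rV[R]_d) (x : 'rV[R]_d) : open O ->
  measurable [set t : T | O (x + rowt t)].
Proof.
move=> oO; rewrite (_ : mkset _ = rowt @^-1` (+%R x @^-1` O))//.
apply: measurable_rowt_open; apply: open_comp => // y _.
by apply: (@cvgD _ _ _ (nbhs y) (nbhs_filter y));
  [exact: (@cvg_cst _ x _ (nbhs y) (nbhs_filter y))|exact: cvg_id].
Qed.

Lemma measurable_fun_gtP (f : T -> R) :
  (forall a, measurable [set t | a < f t]) -> measurable_fun setT f.
Proof.
move=> mf mD; apply: (measurability _ (RGenOInfty.measurableE R)) => //.
move=> /= _ [_ [a ->]] <-; rewrite setTI.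
rewrite (_ : _ @^-1` _ = [set t | a < f t]) //.
by apply/seteqP; split => t /=; rewrite in_itv/= andbT.
Qed.

Lemma measurable_fun_rowt_shift (f : 'rV[R]_d -> R) (x : 'rV[R]_d) :
  continuous f -> measurable_fun setT (fun t : T => f (x + rowt t)).
Proof.
move=> cf; apply: measurable_fun_gtP => a.
apply: (@measurable_rowt_shift [set y | a < f y] x).
rewrite (_ : mkset _ = f @^-1` [set y | a < y])//.
by apply: open_comp; [move=> y _; exact: cf|exact: open_gt].
Qed.

Lemma measurable_fun_rowt (f : 'rV[R]_d -> R) :
  continuous f -> measurable_fun setT (fun t : T => f (rowt t)).
Proof.
move=> cf; have := measurable_fun_rowt_shift 0 cf.
by under eq_fun do rewrite add0r.
Qed.

(** The patched function may jump across the boundary of [U], but each superlevel set is an open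
    subset of [U] together with a difference of two open sets. *)
Lemma measurable_fun_rowt_patch (u xi : 'rV[R]_d -> R) (U : set 'rV[R]_d)
    (x : 'rV[R]_d) :
  continuous u -> open U -> {within closure U, continuous xi} ->
  measurable_fun setT (fun t : T => patch u U xi (x + rowt t)).
Proof.
move=> cu oU cxi; apply: measurable_fun_gtP => a.
have {}cxi : {within U, continuous xi}.
  by apply: continuous_subspaceW cxi; exact: subset_closure.
rewrite (_ : mkset _ = [set t : T | (U `&` xi @^-1` [set y | a < y]) (x + rowt t)]
   `|` ([set t | (u @^-1` [set y | a < y]) (x + rowt t)] `\`
        [set t | U (x + rowt t)])).
  apply: measurableU; last apply: measurableD.
  - apply: measurable_rowt_shift.
    have xiU : {in U, continuous xi} by rewrite -(continuous_open_subspace _ oU).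
    rewrite openE => y [Uy ay].
    have h : {for y, continuous xi} by apply: xiU; rewrite inE.
    apply: filterI; first by apply: open_nbhs_nbhs.
    by apply: h; apply: open_nbhs_nbhs; split => //; exact: open_gt.
  - apply: measurable_rowt_shift.
    by apply: open_comp; [move=> y _; exact: cu|exact: open_gt].
  - exact: measurable_rowt_shift.
apply/seteqP; split => t /=; rewrite /patch.
  case: ifPn; rewrite ?inE ?notin_setE => tU h; first by left.
  by right.
case=> [[tU h]|[h /= tU]].
  by rewrite mem_set.
by rewrite memNset.
Qed.

Lemma measurable_enorm : measurable_fun setT (fun t : T => enorm (rowt t)).
Proof. exact: measurable_fun_rowt (@continuous_enorm R d). Qed.

Lemma measurable_cmp_enorm (a : R) :
  measurable [set t : T | enorm (rowt t) < a] /\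
  measurable [set t : T | a <= enorm (rowt t)].
Proof.
have h : measurable [set t : T | enorm (rowt t) < a].
  apply: (measurable_rowt_open (O := [set y | enorm y < a])).
  by have := @open_eball R d 0 a; rewrite /eball; under eq_fun do rewrite subr0.
split=> //; rewrite (_ : mkset _ = ~` [set t : T | enorm (rowt t) < a]).
  exact: measurableC.
by apply/seteqP; split=> t /=; [move=> + /lt_geF => ->|move/negP; rewrite -leNgt].
Qed.

Lemma out_eballE (r : R) : @out_eball R d r = [set t | r <= enorm (rowt t)].
Proof.
apply/seteqP; split=> t; rewrite /out_eball /eball/= subr0.
  by move/negP; rewrite -leNgt.
by move=> + /lt_geF => ->.
Qed.

Lemma measurable_out_eball (r : R) : measurable (@out_eball R d r).
Proof. by rewrite out_eballE; exact: (measurable_cmp_enorm r).2. Qed.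

End tuple_measurability.

Section product_invariance.
Local Open Scope ereal_scope.
Context d1 d2 (T1 : measurableType d1) (T2 : measurableType d2) (R : realType).
Variable m1 : {sigma_finite_measure set T1 -> \bar R}.
Variable m2 : {sigma_finite_measure set T2 -> \bar R}.
Variables (f1 : T1 -> T1) (f2 : T2 -> T2).
Hypotheses (mf1 : measurable_fun setT f1) (mf2 : measurable_fun setT f2).

Let f (p : T1 * T2) : T1 * T2 := (f1 p.1, f2 p.2).

Let mf : measurable_fun setT f.
Proof.
apply/measurable_fun_pairP; split.
  exact: (measurableT_comp mf1 measurable_fst).
exact: (measurableT_comp mf2 measurable_snd).
Qed.

(** The pushforward under the product map agrees with the product measure on rectangles, and these
    determine it. *)
Lemma product_measure_preimage X :
  (forall A, measurable A -> m1 (f1 @^-1` A) = m1 A) ->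
  (forall A, measurable A -> m2 (f2 @^-1` A) = m2 A) ->
  measurable X ->
  (m1 \x m2) ((fun p => (f1 p.1, f2 p.2)) @^-1` X) = (m1 \x m2) X.
Proof.
move=> m1f m2f mX.
rewrite -[LHS]/(pushforward (m1 \x m2) f X); apply/esym.
have h := @product_measure_unique _ _ _ _ _ m1 m2 (pushforward (m1 \x m2) f).
apply: h => // A B mA mB.
rewrite [LHS](_ : _ = (m1 \x m2) ((f1 @^-1` A) `*` (f2 @^-1` B)))//.
rewrite -(m1f _ mA) -(m2f _ mB) product_measure1E//.
  by rewrite -[X in measurable X]setTI; exact: mf1.
by rewrite -[X in measurable X]setTI; exact: mf2.
Qed.

End product_invariance.

Section reflection.
Context {R : realType}.
Local Open Scope ereal_scope.

Definition negt d (t : d.-tuple (measurableTypeR R)) : d.-tuple (measurableTypeR R) :=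
  [tuple (- tnth t i)%R | i < d].

Lemma rowt_negt d (t : d.-tuple (measurableTypeR R)) : rowt (negt t) = (- rowt t)%R.
Proof. by apply/rowP => i; rewrite !mxE tnth_mktuple. Qed.

Lemma measurable_negt d : measurable_fun setT (@negt d).
Proof.
apply/measurable_fun_tnthP => i.
rewrite (_ : _ \o _ = -%R \o (fun t : d.-tuple (measurableTypeR R) => tnth t i)).
  apply: measurableT_comp; last exact: measurable_tnth.
  exact: (@oppr_measurable R setT).
by apply/funext => t; rewrite /= tnth_mktuple.
Qed.

(** Reflection invariance makes odd functions integrate to 0, which later removes the first-order
    Taylor term. *)
Lemma lebesgue_tuple_negt d (A : set (d.-tuple (measurableTypeR R))) :
  measurable A -> lebesgue_tuple R d (@negt d @^-1` A) = lebesgue_tuple R d A.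
Proof.
elim: d A => [|d IH] A mA.
  have -> // : @negt 0 @^-1` A = A.
  by apply/seteqP; split=> t; rewrite /preimage/= [negt t]tuple0 [t]tuple0.
rewrite /= /cons_measure /pushforward.
set B := (X in (_ \x _) X = _).
have -> : B = (fun p => (- p.1, negt p.2)%R) @^-1` ((@cons_pair _ _ d) @^-1` A).
  rewrite /B -comp_preimage; congr (_ @^-1` A); apply/funext => -[x t] /=.
  apply: eq_from_tnth => i; rewrite tnth_mktuple.
  by case: (unliftP ord0 i) => [j|] ->; rewrite ?tnthS ?tnth_mktuple// !tnth0.
apply: (product_measure_preimage (m1 := lebesgue_measure)
  (m2 := lebesgue_tuple R d) (f1 := -%R) (f2 := @negt d)).
- exact: (@oppr_measurable R setT).
- exact: measurable_negt.
- exact: lebesgue_measureN.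
- exact: IH.
- by rewrite -[X in measurable X]setTI; exact: measurable_cons_pair.
Qed.

End reflection.

(** * Integrals of powers of the norm *)

Section cover.
Context dT (T : measurableType dT) {R : realType} (mu : {measure set T -> \bar R}).
Local Open Scope ereal_scope.

(* The covering sets may overlap: only an upper bound is needed. *)
Lemma integral_cover_le (D : set T) (f : T -> R) (B : nat -> set T)
    (c : nat -> R) (b q : R) :
  measurable D -> measurable_fun D f -> (forall t, D t -> 0 <= f t)%R ->
  (forall k, measurable (B k)) -> (forall k, 0 <= c k)%R -> (0 <= b)%R ->
  (0 < q < 1)%R ->
  (forall t, D t -> exists k, (f t <= c k)%R /\ B k t) ->
  (forall k, (c k)%:E * mu (B k) <= (b * q ^+ k)%:E) ->
  \int[mu]_(t in D) (f t)%:E <= (b / (1 - q))%:E.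
Proof.
move=> mD mf f0 mB c0 b0 /andP[q0 q1] cover cab.
pose g k (t : T) := (c k * \1_(B k) t)%:E.
have g0 k t : 0 <= g k t by rewrite lee_fin mulr_ge0.
have mg k : measurable_fun D (g k).
  by apply/measurable_EFinP; apply: measurable_funM => //; exact: measurable_indic.
apply: (@le_trans _ _ (\int[mu]_(t in D) \sum_(k <oo) g k t)).
  apply: ge0_le_integral => //.
  - exact/measurable_EFinP.
  - exact: ge0_emeasurable_sum.
  - move=> t Dt; have [k [fk Nk]] := cover t Dt.
    apply: le_trans (nneseries_lim_ge (u_ := g^~ t) (P := xpredT) k.+1 _) => //.
    rewrite big_nat_recr//=.
    apply: (@le_trans _ _ (g k t)).
      by rewrite /g indicE mem_set// mulr1 lee_fin.
    by rewrite leeDr// sume_ge0.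
rewrite integral_nneseries//.
have q1' : (`|q| < 1)%R by rewrite gtr0_norm.
apply: (@le_trans _ _ (\sum_(k <oo) (b * q ^+ k)%:E)).
  apply: lee_nneseries => [k _ _|k _]; first by apply: integral_ge0 => t _.
  apply: le_trans (cab k).
  rewrite /g; under eq_integral do rewrite EFinM.
  rewrite ge0_integralZl//; last 2 first.
  - by apply/measurable_EFinP; exact: measurable_indic.
  - by rewrite lee_fin.
  apply: lee_wpmul2l; first by rewrite lee_fin.
  rewrite integral_indic//.
  by apply: le_measure; rewrite ?inE; [exact: measurableI|exact: mB|exact: subIsetl].
apply: lime_le.
  by apply: is_cvg_nneseries => k _ _; rewrite lee_fin mulr_ge0// exprn_ge0// ltW.
apply: nearW => n.
rewrite sumEFin lee_fin; apply: le_trans (geometric_le_lim n b0 q0 q1').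
by rewrite /series/=.
Qed.

End cover.

Section radial.
Context {R : realType} {d : nat}.
Local Notation T := (d.-tuple (measurableTypeR R)).
Local Notation mu := (lebesgue_tuple R d).
Local Notation N := (fun t : T => enorm (rowt t)).
Local Open Scope ereal_scope.

Lemma lebesgue_tuple_cube (q : 'I_d -> R) (e : R) : (0 < e)%R ->
  mu [set t | forall i, (`|tnth t i - q i| < e)%R] = ((2 * e) ^+ d)%:E.
Proof.
move=> e0.
rewrite (_ : mkset _ = [set t | forall i, `](q i - e)%R, (q i
  + e)%R[%classic (tnth t i)]).
  rewrite (lebesgue_tuple_box (A := fun i => `](q i - e)%R, (q i + e)%R[%classic));
    last first.
    by move=> i; exact: measurable_itv.
  have h i : lebesgue_measure `](q i - e)%R, (q i + e)%R[%classic = (2 * e)%:E.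
    rewrite lebesgue_measure_itv/= lte_fin ltrBlDr -addrA ltrDl addr_gt0//.
    by rewrite -EFinB; congr EFin; ring.
  under eq_bigr do rewrite h.
  by rewrite prodEFin prodr_const card_ord.
by apply/seteqP; split => t /= h i; have := h i; rewrite in_itv/= ltr_distl.
Qed.

Lemma lebesgue_tuple_eball_le (a : R) : (0 < a)%R ->
  mu [set t | (N t < a)%R] <= ((2 * a) ^+ d)%:E.
Proof.
move=> a0; rewrite -(lebesgue_tuple_cube (fun=> 0%R))//.
apply: le_measure; rewrite ?inE.
- exact: (measurable_cmp_enorm a).1.
- exact: measurable_box.
- move=> t /= ta i; rewrite subr0.
  by have := coord_le_enorm (rowt t) i; rewrite mxE => /le_lt_trans; apply.
Qed.

Lemma integral_cover_balls_le (D : set T) (f : T -> R) (c a : nat -> R) (b q : R) :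
  measurable D -> measurable_fun D f -> (forall t, D t -> 0 <= f t)%R ->
  (forall k, 0 <= c k)%R -> (forall k, 0 < a k)%R -> (0 <= b)%R ->
  (0 < q < 1)%R ->
  (forall t, D t -> exists k, f t <= c k /\ N t < a k)%R ->
  (forall k, c k * (2 * a k) ^+ d <= b * q ^+ k)%R ->
  \int[mu]_(t in D) (f t)%:E <= (b / (1 - q))%:E.
Proof.
move=> mD mf f0 c0 a0 b0 q01 cover cab.
apply: (@integral_cover_le _ _ _ _ _ _ (fun k => [set t : T | (N t < a k)%R]) c) => //.
- by move=> k; exact: (measurable_cmp_enorm (a k)).1.
- move=> k; apply: (@le_trans _ _ (c k * (2 * a k) ^+ d)%:E); last by rewrite lee_fin.
  rewrite EFinM; apply: lee_wpmul2l; first by rewrite lee_fin.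
  exact: lebesgue_tuple_eball_le.
Qed.

Lemma measurable_enorm_powR (D : set T) (p : R) : measurable_fun D (fun t => N t `^ p)%R.
Proof.
apply: measurable_funTS.
exact: (measurableT_comp (measurable_powR p) measurable_enorm).
Qed.

Lemma powR2N_itv (a : R) : (0 < a -> 0 < 2 `^ (- a) < 1)%R.
Proof.
move=> a0; rewrite powR_gt0//= powRN invf_lt1 ?powR_gt0//.
by have := gt0_ltr_powR a0 (x := 1%R) (y := 2%R); rewrite powR1 !nnegrE; apply;
  rewrite ?ltr1n.
Qed.

(** Dyadic shells t0 2^k <= |z| < t0 2^(k+1): the lower radius bounds the integrand, the upper one
    the volume. The exponents of the radius combine to -a, so the series is geometric with ratio
    2^-a. *)
Lemma integral_enorm_powR_out (a : R) : (0 < a)%R ->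
  exists2 K : R, (0 < K)%R & forall t0, (0 < t0)%R ->
  \int[mu]_(t in out_eball t0) (N t `^ (- (d%:R + a)))%:E <= (K * t0 `^ (- a))%:E.
Proof.
move=> a0; have q01 := powR2N_itv a0.
exists (4 ^+ d / (1 - 2 `^ (- a)))%R.
  by rewrite divr_gt0 ?exprn_gt0// subr_gt0; case/andP: q01.
move=> t0 t00.
rewrite mulrAC.
apply: (@integral_cover_balls_le _ _ (fun k => (t0 * 2 ^+ k) `^ (- (d%:R + a)))%R
  (fun k => (t0 * 2 ^+ k.+1)%R)) => //.
- exact: measurable_out_eball.
- exact: measurable_enorm_powR.
- by move=> t _; exact: powR_ge0.
- by move=> k; exact: powR_ge0.
- by move=> k; rewrite mulr_gt0// exprn_gt0.
- by rewrite mulr_ge0// ?exprn_ge0// powR_ge0.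
- move=> t; rewrite out_eballE/= => tt.
  have ex : exists k, (N t < t0 * 2 ^+ k)%R.
    exists (Num.truncn (N t / t0)).+1; rewrite mulrC -ltr_pdivrMr//.
    apply: lt_trans (truncnS_gt _) _.
    by rewrite -natrX ltr_nat ltn_expl.
  have [k0 k0P k0min] := ex_minnP ex.
  case: k0 k0P k0min => [|k] kP kmin.
    by move: kP; rewrite expr0 mulr1 ltNge tt.
  exists k; split=> //.
  have tk : (t0 * 2 ^+ k <= N t)%R.
    by rewrite leNgt; apply/negP => /kmin; rewrite ltnn.
  have tk0 : (0 < t0 * 2 ^+ k)%R by rewrite mulr_gt0// exprn_gt0.
  rewrite !powRN lef_pV2 ?posrE ?powR_gt0//; last exact: lt_le_trans tk.
  by rewrite ge0_ler_powR// ?nnegrE ?addr_ge0// ?ltW// ?(lt_le_trans tk0).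
- move=> k.
  have p0 : (0 < t0 * 2 ^+ k)%R by rewrite mulr_gt0// exprn_gt0.
  have -> : (2 * (t0 * 2 ^+ k.+1) = 4 * (t0 * 2 ^+ k) :> R)%R by rewrite exprS; ring.
  rewrite exprMn mulrCA -[X in (_ * (_ * X))%R]powR_mulrn; last exact: ltW.
  rewrite -powRD; last by rewrite (gt_eqF p0) implybT.
  rewrite opprD addrAC addNr add0r powRM ?exprn_ge0//; last exact: ltW.
  rewrite (_ : ((2 ^+ k) `^ (- a) = (2 `^ (- a)) ^+ k :> R)%R) ?mulrA//.
  by rewrite -powR_mulrn// -powRrM mulrC powRrM powR_mulrn ?powR_ge0.
Qed.

(** Dyadic shells shrinking to 0. The sign of a - d is unknown, so |z|^a is bounded by the outer
    radius of the shell and |z|^-d by the inner one. *)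
Lemma integral_enorm_powR_in (a : R) : (0 < a)%R ->
  exists2 K : R, (0 < K)%R & forall t0, (0 < t0)%R ->
  \int[mu]_(t in [set t | 0 < N t < t0]%R) (N t `^ (a - d%:R))%:E <= (K * t0 `^ a)%:E.
Proof.
move=> a0; have q01 := powR2N_itv a0.
exists (4 ^+ d / (1 - 2 `^ (- a)))%R.
  by rewrite divr_gt0 ?exprn_gt0// subr_gt0; case/andP: q01.
move=> t0 t00; rewrite mulrAC.
have p0 k : (0 < t0 * 2 ^- k)%R by rewrite mulr_gt0// invr_gt0 exprn_gt0.
apply: (@integral_cover_balls_le _ _
  (fun k => (t0 * 2 ^- k) `^ a * (2 / (t0 * 2 ^- k)) ^+ d)%R
  (fun k => (t0 * 2 ^- k)%R)) => //.
- rewrite (_ : mkset _ = [set t | (N t < t0)%R] `\` [set t | (N t <= 0)%R]).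
    apply: measurableD; first exact: (measurable_cmp_enorm t0).1.
    rewrite (_ : mkset _ = ~` \bigcup_k [set t | (k.+1%:R^-1 <= N t)%R]).
      by apply/measurableC/bigcupT_measurable => k; exact: (measurable_cmp_enorm _).2.
    apply/seteqP; split=> t /=.
      move=> Nt [k _ /= kN]; have : (0 < k.+1%:R^-1 :> R)%R by rewrite invr_gt0.
      by rewrite ltNge (le_trans kN Nt).
    move=> h; rewrite leNgt; apply/negP => Nt; apply: h.
    exists (Num.truncn (N t)^-1) => //=.
    by rewrite invf_ple ?posrE// ltW// truncnS_gt.
  by apply/seteqP; split=> t /=; [move=> /andP[N0 Nt]; split=> //; rewrite leNgt N0|
    move=> [-> /negP]; rewrite -ltNge andbT].
- exact: measurable_enorm_powR.
- by move=> t _; exact: powR_ge0.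
- by move=> k; rewrite mulr_ge0 ?powR_ge0// exprn_ge0// divr_ge0// ltW.
- by rewrite mulr_ge0// ?exprn_ge0// powR_ge0.
- move=> t /= /andP[Nt0 Nt].
  have ex : exists k, (t0 * 2 ^- k.+1 <= N t)%R.
    exists (Num.truncn (t0 / N t)).
    rewrite ler_pdivrMr ?exprn_gt0// mulrC -ler_pdivrMr//.
    apply/ltW/(lt_trans (truncnS_gt _)).
    by rewrite -natrX ltr_nat ltn_expl.
  have [k kP kmin] := ex_minnP ex.
  have Ntk : (N t < t0 * 2 ^- k)%R.
    case: k kP kmin => [|k] kP kmin; first by rewrite expr0 invr1 mulr1.
    by rewrite ltNge; apply/negP => /kmin; rewrite ltnn.
  exists k; split=> //.
  rewrite powRB; last by rewrite (gt_eqF Nt0) implybT.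
  rewrite powR_mulrn ?(ltW Nt0)//; apply: ler_pM;
    rewrite ?powR_ge0 ?invr_ge0 ?exprn_ge0 ?(ltW Nt0)//.
    by rewrite ge0_ler_powR ?nnegrE ?(ltW a0) ?(ltW Nt0) ?(ltW (p0 _)) ?(ltW Ntk).
  rewrite -(exprVn (N t)); apply: lerXn2r;
    rewrite ?nnegrE ?invr_ge0 ?(ltW Nt0) ?divr_ge0 ?(ltW (p0 _))//; first exact: ltW.
  rewrite -invf_div lef_pV2 ?posrE ?divr_gt0//.
  by apply: le_trans kP; rewrite exprS invfM mulrCA mulrC.
- move=> k.
  rewrite -mulrA -exprMn (_ : (2 / _ * _ = 4 :> R)%R); last first.
    by field; rewrite gt_eqF//= gt_eqF// exprn_gt0.
  rewrite powRM ?invr_ge0 ?exprn_ge0 ?(ltW t00)//.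
  rewrite (_ : ((2 ^- k) `^ a = (2 `^ (- a)) ^+ k :> R)%R).
    by rewrite mulrC mulrA.
  rewrite -powR_inv1 ?exprn_ge0// -[(2 ^+ k)%R]powR_mulrn// -!powRrM.
  by rewrite -powR_mulrn ?powR_ge0// -powRrM; congr powR; ring.
Qed.

End radial.

(** * Positivity of the normalising constant *)

Section gamma.
Context {R : realType}.

(** This is ln y <= y - 1 at y = t/a. Exponentiated, it bounds t^a e^-t uniformly in t. *)
Lemma ln_le_scale (a t : R) : 0 < a -> 0 < t -> a * ln t <= t + a * (ln a - 1).
Proof.
move=> a0 t0.
have h : ln (t / a) <= t / a - 1.
  have := expR_ge1Dx (ln (t / a)); rewrite lnK ?posrE ?divr_gt0//; lra.
have : a * ln (t / a) <= a * (t / a - 1) by rewrite ler_wpM2l// ltW.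
rewrite ln_div ?posrE// !mulrBr mulrCA divff ?gt_eqF// !mulr1; lra.
Qed.

Let f (x t : R) : R := t `^ (x - 1) * expR (- t).

Let mf x (D : set R) : measurable_fun D (f x).
Proof.
apply: measurable_funTS; apply: measurable_funM; first exact: measurable_powR.
apply: measurableT_comp; first exact: measurable_expR.
exact: oppr_measurable.
Qed.

Let f0 x t : 0 <= f x t.
Proof. by rewrite mulr_ge0 ?powR_ge0 ?expR_ge0. Qed.

Let measure_itv0 (r : R) : 0 < r -> lebesgue_measure `]0%R, r]%classic = r%:E.
Proof. by move=> r0; rewrite lebesgue_measure_itv/= lte_fin r0 -EFinB subr0. Qed.

(** On 2^-(k+1) < t <= 2^-k the integrand is at most t^x / t <= (2^-k)^x 2^(k+1); the interval has
    length at most 2^-k, which leaves the ratio 2^-x. *)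
Let f_near0 x : 0 < x ->
  (\int[lebesgue_measure]_(t in `]0%R, 1%R]) (f x t)%:E < +oo)%E.
Proof.
move=> x0; have q01 := powR2N_itv x0.
apply: (@le_lt_trans _ _ (2 / (1 - 2 `^ (- x)))%:E); last exact: ltry.
have pk k : (0 < 2 ^- k :> R)%R by rewrite invr_gt0 exprn_gt0.
apply: (@integral_cover_le _ (measurableTypeR R) R lebesgue_measure _ (f x) (fun k =>
  `]0%R, (2 ^- k)%R]%classic)
   (fun k => 2 * 2 ^+ k * (2 ^- k) `^ x)) => //.
- exact: mf.
- move=> t /=; rewrite in_itv/= => /andP[t0 t1].
  have ex : exists k, 2 ^- k.+1 < t.
    exists (Num.truncn t^-1); rewrite invf_plt ?posrE ?exprn_gt0//.
    apply: lt_trans (truncnS_gt _) _.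
    by rewrite -natrX ltr_nat ltn_expl.
  have [k kP kmin] := ex_minnP ex.
  have tk : t <= 2 ^- k.
    case: k kP kmin => [|k] kP kmin; first by rewrite expr0 invr1.
    by rewrite leNgt; apply/negP => /kmin; rewrite ltnn.
  exists k; split; last by rewrite /= in_itv/= t0.
  rewrite /f powRB; last by rewrite (gt_eqF t0) implybT.
  rewrite powRr1 ?(ltW t0)// -[leRHS]mulr1; apply: ler_pM => //.
  + by rewrite divr_ge0 ?powR_ge0 ?(ltW t0).
  + rewrite mulrC; apply: ler_pM; rewrite ?invr_ge0 ?powR_ge0 ?(ltW t0)//.
      rewrite -[leRHS]invrK lef_pV2 ?posrE ?invr_gt0 ?mulr_gt0 ?exprn_gt0//.
      by rewrite -exprS ltW.
    by apply: ge0_ler_powR; rewrite ?nnegrE ?(ltW x0) ?(ltW t0) ?(ltW (pk _)).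
  + by rewrite -expR0 ler_expR oppr_le0 ltW.
- move=> k; rewrite [X in (_ * X)%E](_ : _ = (2 ^- k)%:E); last exact: measure_itv0.
  rewrite -EFinM lee_fin.
  rewrite (_ : (2 ^- k) `^ x = (2 `^ (- x)) ^+ k).
    rewrite le_eqVlt; apply/orP; left; apply/eqP.
    by field; rewrite expf_neq0.
  rewrite -powR_inv1 ?exprn_ge0// -[(2 ^+ k)%R]powR_mulrn// -!powRrM.
  by rewrite -powR_mulrn ?powR_ge0// -powRrM; congr powR; ring.
Qed.

(** Since t^(x+1) e^-t is bounded, the integrand decays at least like t^-2, and doubling intervals
    give a geometric series. *)
Let f_inf x : 0 < x ->
  (\int[lebesgue_measure]_(t in `]1%R, +oo[) (f x t)%:E < +oo)%E.
Proof.
move=> x0; pose K := expR ((x + 1) * (ln (x + 1) - 1)).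
have K0 : 0 < K by exact: expR_gt0.
have fK t : 1 < t -> f x t <= K * t ^- 2.
  move=> t1; have t0 : 0 < t by rewrite (lt_trans _ t1).
  have -> : f x t = t `^ (x + 1) * expR (- t) * t ^- 2.
    rewrite /f (_ : x - 1 = (x + 1) - 2); last by ring.
    rewrite powRB; last by rewrite (gt_eqF t0) implybT.
    by rewrite powR_mulrn ?(ltW t0)// mulrAC.
  apply: ler_wpM2r; first by rewrite invr_ge0 exprn_ge0// ltW.
  rewrite /powR (gt_eqF t0) -expRD ler_expR.
  have := @ln_le_scale (x + 1) t _ t0; rewrite addr_gt0//; lra.
apply: (@le_lt_trans _ _ (2 * K / (1 - 2^-1))%:E); last exact: ltry.
apply: (@integral_cover_le _ (measurableTypeR R) R lebesgue_measure _ (f x) (fun k =>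
  `]0%R, (2 ^+ k.+1)%R]%classic)
   (fun k => K * (2 ^+ k) ^- 2)) => //.
- exact: mf.
- by move=> k; rewrite mulr_ge0 ?(ltW K0)// invr_ge0 exprn_ge0// exprn_ge0.
- by rewrite mulr_ge0// ltW.
- by apply/andP; split; lra.
- move=> t /=; rewrite in_itv/= andbT => t1.
  have t0 : 0 < t by rewrite (lt_trans _ t1).
  have ex : exists k, t <= 2 ^+ k.+1.
    exists (Num.truncn t); apply/ltW/(lt_trans (truncnS_gt _)).
    by rewrite -natrX ltr_nat ltn_expl.
  have [k kP kmin] := ex_minnP ex.
  have tk : 2 ^+ k <= t.
    case: k kP kmin => [|k] kP kmin; first by rewrite expr0 ltW.
    by rewrite leNgt; apply/negP => /ltW/kmin; rewrite ltnn.
  exists k; split; last by rewrite /= in_itv/= t0.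
  rewrite (le_trans (fK _ t1))// ler_wpM2l ?(ltW K0)//.
  rewrite lef_pV2 ?posrE ?exprn_gt0// lerXn2r ?nnegrE ?exprn_ge0//.
  exact: ltW.
- move=> k; rewrite [X in (_ * X)%E](_ : _ = (2 ^+ k.+1)%:E); last first.
    by apply: measure_itv0; rewrite exprn_gt0.
  rewrite -EFinM lee_fin.
  rewrite le_eqVlt; apply/orP; left; apply/eqP.
  rewrite exprVn [2 ^+ k.+1]exprS.
  have : (2 : R) ^+ k != 0 by rewrite expf_neq0.
  by move: (2 ^+ k) => a a0; field.
Qed.

(** The real-valued integral is 0 by convention when the extended one is infinite, so positivity
    needs the finiteness [E] as well as the lower bound [P], taken on [1, 2]. *)
Lemma euler_integral_gt0 (x : R) : 0 < x -> 0 < euler_integral x.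
Proof.
move=> x0.
have S : `]0%R, +oo[%classic = `]0%R, 1%R]%classic `|` `]1%R, +oo[%classic :> set R.
  by rewrite -itv_bndbnd_setU ?bnd_simp.
have E : (\int[lebesgue_measure]_(t in `]0%R, +oo[) (f x t)%:E < +oo)%E.
  rewrite S ge0_integral_setU//=.
  - by rewrite lte_add_pinfty ?f_near0 ?f_inf.
  - by apply/measurable_EFinP; exact: mf.
  - by move=> t _; rewrite lee_fin.
  - apply/disj_setPS => t [] /=; rewrite !in_itv/= => /andP[_ t1].
    by rewrite ltNge t1.
have P : ((expR (- 2) / 2)%:E <= \int[lebesgue_measure]_(t in `]0%R, +oo[) (f x t)%:E)%E.
  apply: (@le_trans _ _ (\int[lebesgue_measure]_(t in `[1%R, 2%R]) (expR (- 2) /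
    2)%:E)%E).
    rewrite integral_cst//= lebesgue_measure_itv/= lte_fin ltr1n -EFinB -EFinM lee_fin;
      lra.
  apply: (@le_trans _ _ (\int[lebesgue_measure]_(t in `[1%R, 2%R]) (f x t)%:E)%E).
    apply: ge0_le_integral => //.
    - by apply/measurable_EFinP; exact: mf.
    - move=> t /=; rewrite in_itv/= => /andP[t1 t2]; rewrite lee_fin mulrC.
      apply: ler_pM; rewrite ?invr_ge0 ?expR_ge0//; last by rewrite ler_expR lerN2.
      apply: (@le_trans _ _ (t `^ (- 1))); last by rewrite ler_powR//; lra.
      rewrite powR_inv1 ?(le_trans _ t1)// lef_pV2 ?posrE//.
      exact: lt_le_trans t1.
  apply: ge0_subset_integral => //.
  - by apply/measurable_EFinP; exact: mf.
  - by move=> t _; rewrite lee_fin.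
  - by move=> t /=; rewrite !in_itv/= andbT => /andP[/(lt_le_trans _)->].
have c0 : 0 < expR (- 2) / 2 :> R by rewrite divr_gt0 ?expR_gt0.
rewrite /euler_integral /Rintegral; apply: fine_gt0.
by rewrite (lt_le_trans _ P)// lte_fin.
Qed.

Lemma frac_laplacian_const_gt0 (d : nat) (s : R) : 0 < s < 1 ->
  0 < frac_laplacian_const d s.
Proof.
move=> /andP[s0 s1].
have sd : 0 < s + d%:R / 2 by rewrite ltr_wpDr ?divr_ge0.
have G1 : 0 < Gamma (s + d%:R / 2).
  by rewrite /Gamma sd big_ord0 divr1 addr0 euler_integral_gt0.
have G2 : 0 < `|Gamma (- s)|.
  (* At -s the least shift is n = 1: Gamma(-s) is the Euler integral at 1 - s divided by -s. *)
  rewrite normr_gt0 /Gamma oppr_gt0 (lt_gtF s0) opprK.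
  have -> : Num.truncn s = 0%N by apply/truncn0Pn; rewrite -ltNge.
  rewrite big_ord1 addr0 addrC mulf_neq0 ?invr_neq0 ?oppr_eq0 ?(gt_eqF s0)//.
  by rewrite gt_eqF// euler_integral_gt0// subr_gt0.
rewrite /frac_laplacian_const divr_gt0// mulr_gt0 ?powR_gt0//.
exact: pi_gt0.
Qed.

End gamma.

(** * A Taylor bound from partial derivatives *)

Section taylor.
Context {R : realType} {d : nat}.
Local Notation X := 'rV[R]_d.

Let partial_line (f : X -> R) (p : X) (i : 'I_d) (g t : R) :
  is_derive (p + t *: delta_mx 0 i) (delta_mx 0 i : X) f g ->
  is_derive t 1 (fun t => f (p + t *: delta_mx 0 i)) g.
Proof.
move=> [df Df].
have E : (fun h : R => h^-1 *: (((fun t => f (p + t *: delta_mx 0 i)) \o shift t) (h *: 1)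
      - f (p + t *: delta_mx 0 i)))
  = (fun h => h^-1 *: ((f \o shift (p + t *: delta_mx 0 i)) (h *: delta_mx 0 i)
      - f (p + t *: delta_mx 0 i))).
  apply/funext => h; congr (_ *: (f _ - _)) => /=.
  by rewrite scalerDl addrCA /GRing.scale/= mulr1.
by split; [rewrite /derivable E|rewrite /derive E].
Qed.

Let line_bound (f : X -> R) (p : X) (i : 'I_d) (w a E : R) (g : R -> R) :
  (forall t, `|t| <= `|w| ->
    is_derive (p + t *: delta_mx 0 i) (delta_mx 0 i : X) f (g t) /\ `|g t - a| <= E) ->
  `|f (p + w *: delta_mx 0 i) - f p - a * w| <= E * `|w|.
Proof.
move=> H; pose phi t := f (p + t *: delta_mx 0 i).
have Hphi (t : R) : `|t| <= `|w| -> is_derive t 1 phi (g t).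
  by move=> /H[? _]; exact: partial_line.
have p0 : phi 0 = f p by rewrite /phi scale0r addr0.
rewrite -/(phi w) -p0.
have seg (u v c : R) : u < v -> `|u| <= `|w| -> `|v| <= `|w| -> c \in `[u, v] ->
  `|c| <= `|w|.
  move=> uv uw vw; rewrite in_itv/= => /andP[uc cv].
  by move: uw vw; rewrite !ler_norml => /andP[? ?] /andP[? ?]; apply/andP; split; lra.
have mvt (u v : R) : u < v -> `|u| <= `|w| -> `|v| <= `|w| ->
    `|phi v - phi u - a * (v - u)| <= E * (v - u).
  move=> uv uw vw.
  have dphi (x : R) : x \in `]u, v[ -> is_derive x 1 phi (g x).
    by move=> xuv; apply: Hphi; apply: (seg u v) => //; exact: subset_itv_oo_cc xuv.
  have cphi : {within `[u, v], continuous phi}.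
    apply: derivable_within_continuous => x xuv.
    by have [] := Hphi x (seg u v x uv uw vw xuv).
  have [c cuv ->] := MVT uv dphi cphi.
  rewrite -mulrBl normrM [X in _ * X]gtr0_norm ?subr_gt0//.
  rewrite ler_wpM2r ?subr_ge0 ?(ltW uv)//.
  by apply: (H c _).2; apply: (seg u v) => //; exact: subset_itv_oo_cc cuv.
have w0 : `|0 : R| <= `|w| by rewrite normr0.
have [w_lt0|w_gt0|->] := ltgtP w 0.
- have := mvt w 0 w_lt0 (lexx _) w0.
  rewrite sub0r (ltr0_norm w_lt0) => h.
  rewrite (_ : phi w - phi 0 - a * w = - (phi 0 - phi w - a * - w)) ?normrN//; ring.
- have := mvt 0 w w_gt0 w0 (lexx _).
  by rewrite subr0 (gtr0_norm w_gt0).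
- by rewrite subrr mulr0 subr0 normr0 mulr0.
Qed.

(** Only partial derivatives are given, so one walks from [x] to [x + z] one coordinate at a time,
    with the mean value theorem on each edge; every point visited stays in the box spanned by
    [z]. *)
Lemma partials_bound (f : X -> R) (G : 'I_d -> X -> R) (x z : X) (a : 'I_d -> R) (E : R) :
  (forall y : X, (forall i, `|y 0 i - x 0 i| <= `|z 0 i|) -> forall i,
    is_derive y (delta_mx 0 i : X) f (G i y) /\ `|G i y - a i| <= E) ->
  `|f (x + z) - f x - \sum_(i < d) a i * z 0 i| <= E * \sum_(i < d) `|z 0 i|.
Proof.
move=> H.
pose p (k : nat) : X := x + \row_i (if (i < k)%N then z 0 i else 0).
have p0 : p 0%N = x.
  by rewrite /p (_ : \row_i _ = 0) ?addr0//; apply/rowP => i; rewrite !mxE.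
have pd : p d = x + z.
  by rewrite /p; congr (x + _); apply/rowP => i; rewrite !mxE ltn_ord.
have pS (k : 'I_d) : p k.+1 = p k + z 0 k *: delta_mx 0 k.
  rewrite /p -addrA; congr (x + _); apply/rowP => i; rewrite !mxE eqxx/= ltnS.
  have [->|ik] := eqVneq i k; first by rewrite leqnn ltnn mulr1 add0r.
  by rewrite mulr0 addr0 leq_eqVlt (inj_eq val_inj) (negbTE ik).
have -> : f (x + z) - f x = \sum_(k < d) (f (p k.+1) - f (p k)).
  by rewrite -(big_mkord xpredT (fun k => f (p k.+1) - f (p k))) telescope_sumr// pd p0.
rewrite -sumrB mulr_sumr (le_trans (ler_norm_sum _ _ _))//.
apply: ler_sum => k _; rewrite pS.
apply: (line_bound (g := fun t => G k (p k + t *: delta_mx 0 k))) => t tz.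
apply: H => i; rewrite !mxE eqxx/=.
have [->|ik] := eqVneq i k.
  by rewrite ltnn addr0 mulr1 addrAC subrr add0r.
rewrite mulr0 addr0 addrAC subrr add0r; case: ifP => //.
by rewrite normr0.
Qed.

(** One constant serves all base points near [x0], because near-maximum points only tend to [x0].
    [partials_bound] is used twice: on each first partial with slopes 0, which makes it Lipschitz,
    then on [xi] with the first partials as slopes. Each use costs a factor [d] for passing to the
    sum norm. *)
Lemma C2_taylor (U : set X) (xi : X -> R) (x0 : X) :
  open U -> U x0 -> C2_closure U xi ->
  exists rho M : R, exists D : X -> X, [/\ 0 < rho, 0 <= M,
    eball x0 (rho + rho) `<=` U &
    forall x z, enorm (x - x0) < rho -> enorm z < rho ->
      `|xi (x + z) - xi x - dot (D x) z| <= M * enorm z ^+ 2].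
Proof.
move=> oU Ux0 [_ [D1 [D2 HD]]].
have [rho0 rho00 rhoU] := nbhs_eball (open_nbhs_nbhs (conj oU Ux0)).
have D2b i j : exists2 rr, 0 < rr & forall y, enorm (y - x0) < rr ->
    `|D2 i j y| <= `|D2 i j x0| + 1.
  have [_ _ /(_ j)[cD2 _]] := HD i.
  have {}cD2 : {within U, continuous (D2 i j)}.
    by apply: continuous_subspaceW cD2; exact: subset_closure.
  have D2U : {in U, continuous (D2 i j)} by rewrite -(continuous_open_subspace _ oU).
  have cx0 : {for x0, continuous (D2 i j)} by apply: D2U; rewrite inE.
  have /nbhs_eball[rr rr0 rrP] : nbhs x0 [set y | `|D2 i j x0 - D2 i j y| < 1].
    by move/(@cvgrPdist_lt _ _ _ (nbhs x0) (nbhs_filter x0)) : cx0; apply.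
  exists rr => // y yx0; have := rrP y yx0 => /= h.
  rewrite -[D2 i j y](subrK (D2 i j x0)) (le_trans (ler_normD _ _))// addrC lerD2l.
  by rewrite distrC ltW.
pose rr i j := projT1 (cid2 (D2b i j)).
have rr0 i j : 0 < rr i j by rewrite /rr; case: cid2.
have rrP i j y : enorm (y - x0) < rr i j -> `|D2 i j y| <= `|D2 i j x0| + 1.
  by rewrite /rr; case: cid2 => /= r _ rP; exact: rP.
pose B := \sum_(i < d) \sum_(j < d) (`|D2 i j x0| + 1).
have le_B i j : `|D2 i j x0| + 1 <= B.
  rewrite /B (bigD1 i)//= (bigD1 j)//= -addrA lerDl addr_ge0//.
    by rewrite sumr_ge0// => k _; rewrite addr_ge0.
  by rewrite sumr_ge0// => k _; rewrite sumr_ge0// => l _; rewrite addr_ge0.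
have B0 : 0 <= B by rewrite !sumr_ge0// => k _; rewrite sumr_ge0// => l _;
  rewrite addr_ge0.
pose rho1 := \big[Num.min/rho0]_(p : 'I_d * 'I_d) rr p.1 p.2.
have rho10 : 0 < rho1.
  by rewrite /rho1; elim/big_ind: _ => // a b a0 b0; rewrite lt_min a0 b0.
have rho1r i j : rho1 <= rr i j.
  by rewrite /rho1 (bigD1 (i, j))//= ge_min lexx.
have rho1_0 : rho1 <= rho0.
  rewrite /rho1; elim/big_rec: _ => // p a _ a0; by rewrite ge_min a0 orbT.
(* Then the box around [x] spanned by [z] stays within [rho1] of [x0], where all second partials are
   bounded by [B]. *)
pose rho := rho1 / (2 * d.+1%:R).
have rho_0 : 0 < rho by rewrite divr_gt0// mulr_gt0.
have rd : d.+1%:R * rho + d.+1%:R * rho = rho1.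
  have : d.+1%:R != 0 :> R by rewrite pnatr_eq0.
  by rewrite /rho; move: (d.+1%:R) => D D0; field.
have d1 : 1 <= d.+1%:R :> R by rewrite ler1n.
have rho_le : rho <= d.+1%:R * rho by rewrite ler_peMl// ltW.
exists rho, (B * d%:R ^+ 2), (fun x => \row_i D1 i x); split => //.
- by rewrite mulr_ge0// exprn_ge0.
- move=> y /= yx0; apply: rhoU; rewrite /eball/= in yx0 *; lra.
move=> x z xx0 z0.
have box (w y : X) : (forall i, `|y 0 i - w 0 i| <= `|z 0 i|) ->
  enorm (y - w) <= d%:R * rho.
  move=> H; rewrite (le_trans (enorm_le_sum _))//.
  rewrite mulr_natl -[X in _ *+ X]card_ord -sumr_const; apply: ler_sum => i _;
    rewrite !mxE.
  by rewrite (le_trans (H i))// (le_trans (coord_le_enorm _ _))// ltW.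
have dd : d%:R * rho + rho = d.+1%:R * rho by rewrite -natr1 mulrDl mul1r.
have boxx (y : X) : (forall i, `|y 0 i - x 0 i| <= `|z 0 i|) -> enorm (y - x0) < rho1.
  by move=> H; have := box x y H; have := ler_enormB y x x0; lra.
have inU (y : X) : enorm (y - x0) < rho1 -> U y by move=> H; apply: rhoU;
  exact: lt_le_trans rho1_0.
have sz : \sum_(i < d) `|z 0 i| <= d%:R * enorm z.
  rewrite mulr_natl -[X in _ *+ X]card_ord -sumr_const.
  by apply: ler_sum => i _; exact: coord_le_enorm.
have D1lip (y : X) i : (forall k, `|y 0 k - x 0 k| <= `|z 0 k|) ->
    `|D1 i y - D1 i x| <= B * (d%:R * enorm z).
  move=> yz; have := @partials_bound (D1 i) (D2 i) x (y - x) (fun=> 0) B.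
  rewrite big1 ?subr0; last by move=> k _; rewrite mul0r.
  rewrite [x + (y - x)]addrC subrK => H; apply: le_trans (H _) _.
    move=> y' yy' k; split.
      have [_ _ /(_ k)[_]] := HD i; apply; apply: inU; apply: boxx => l.
      by rewrite (le_trans (yy' l))// !mxE yz.
    rewrite subr0 (le_trans _ (le_B i k))//; apply: rrP.
    apply: (@lt_le_trans _ _ rho1) => //; apply: boxx => l.
    by rewrite (le_trans (yy' l))// !mxE yz.
  rewrite ler_wpM2l// (le_trans _ sz)//; apply: ler_sum => k _.
  by rewrite !mxE yz.
have := @partials_bound xi D1 x z (fun i => D1 i x) (B * (d%:R * enorm z)).
have -> : \sum_(i < d) D1 i x * z 0 i = dot (\row_i D1 i x) z.
  by apply: eq_bigr => i _; rewrite mxE.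
move=> H; apply: le_trans (H _) _.
  move=> y yz i; split; last exact: D1lip.
  by have [_ + _] := HD i; apply; apply: inU; exact: boxx.
apply: (@le_trans _ _ (B * (d%:R * enorm z) * (d%:R * enorm z))).
  by rewrite ler_wpM2l// !mulr_ge0// enorm_ge0.
by rewrite le_eqVlt; apply/orP; left; apply/eqP; ring.
Qed.

End taylor.

(** * The truncated kernel *)

Section truncated_functional.
Context {R : realType} {d : nat}.
Variable s : R.
Hypothesis s01 : 0 < s < 1.
Local Notation T := (d.-tuple (measurableTypeR R)).
Local Notation mu := (lebesgue_tuple R d).
Local Notation N := (fun t : T => enorm (rowt t)).
Implicit Types (e r : R) (h g : T -> R).

Definition weight (t : T) : R := (N t `^ (d%:R + 2 * s))^-1.

Definition nu_integrable e h := mu.-integrable (out_eball e) (fun t =>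
  (h t * weight t)%:E).

Definition nu_integral e h : R := \int[mu]_(t in out_eball e) (h t * weight t).

Let s0 : 0 < s. Proof. by case/andP: s01. Qed.
Let s1 : s < 1. Proof. by case/andP: s01. Qed.

Lemma weight_ge0 t : 0 <= weight t.
Proof. by rewrite invr_ge0 powR_ge0. Qed.

Lemma measurable_weight D : measurable_fun D weight.
Proof.
rewrite /weight; under eq_fun do rewrite -powRN.
exact: measurable_enorm_powR.
Qed.

Lemma out_eball_le e1 e2 : e1 <= e2 ->
  @out_eball R d e2 `<=` out_eball e1.
Proof. by move=> e12; rewrite !out_eballE => t /=; exact: le_trans. Qed.

Lemma nu_integrable_measurable e h : measurable_fun setT h ->
  measurable_fun (out_eball e) (fun t => (h t * weight t)%:E).
Proof.
move=> mh; apply/measurable_EFinP; apply: measurable_funM.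
  exact: measurable_funTS.
exact: measurable_weight.
Qed.

Lemma nu_integrable_le e h g : nu_integrable e g -> measurable_fun setT h ->
  (forall t, e <= N t -> `|h t| <= g t) -> nu_integrable e h.
Proof.
move=> ag mh hg; apply: (le_integrable _ _ _ ag).
- exact: measurable_out_eball.
- exact: nu_integrable_measurable.
- rewrite out_eballE => t /= et; rewrite lee_fin !normrM.
  by rewrite ler_wpM2r// (le_trans (hg _ et))// ler_norm.
Qed.

Lemma eq_nu_integrable e h g : (forall t, e <= N t -> h t = g t) ->
  nu_integrable e h -> nu_integrable e g.
Proof.
move=> hg; apply: eq_integrable; first exact: measurable_out_eball.
by move=> t; rewrite inE out_eballE => /= et; rewrite hg.
Qed.

Lemma eq_nu_integral e h g : (forall t, e <= N t -> h t = g t) ->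
  nu_integral e h = nu_integral e g.
Proof.
move=> hg; apply: eq_Rintegral.
by move=> t; rewrite inE out_eballE => /= et; rewrite hg.
Qed.

Lemma nu_integrableD e h g : nu_integrable e h -> nu_integrable e g ->
  nu_integrable e (fun t => h t + g t).
Proof.
move=> ah ag.
have := integrableD (measurable_out_eball e) ah ag; apply: eq_integrable.
  exact: measurable_out_eball.
by move=> t _; rewrite /= mulrDl.
Qed.

Lemma nu_integrableZ e c h : nu_integrable e h -> nu_integrable e (fun t => c * h t).
Proof.
move=> ah.
have := integrableZl (measurable_out_eball e) c ah; apply: eq_integrable.
  exact: measurable_out_eball.
by move=> t _; rewrite -EFinM mulrA.
Qed.

Lemma nu_integralD e h g : nu_integrable e h -> nu_integrable e g ->
  nu_integral e (fun t => h t + g t) = nu_integral e h + nu_integral e g.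
Proof.
move=> ah ag; rewrite /nu_integral -RintegralD//; last exact: measurable_out_eball.
by apply: eq_Rintegral => t _; rewrite mulrDl.
Qed.

Lemma nu_integralZ e c h : nu_integrable e h ->
  nu_integral e (fun t => c * h t) = c * nu_integral e h.
Proof.
move=> ah; rewrite /nu_integral -RintegralZl//; last exact: measurable_out_eball.
by apply: eq_Rintegral => t _; rewrite mulrA.
Qed.

Lemma le_nu_integral e h g : nu_integrable e h -> nu_integrable e g ->
  (forall t, e <= N t -> h t <= g t) -> nu_integral e h <= nu_integral e g.
Proof.
move=> ah ag hg; apply: le_Rintegral => //; first exact: measurable_out_eball.
by rewrite out_eballE => t et; rewrite ler_wpM2r ?weight_ge0 ?hg.
Qed.

Lemma nu_integral_ge0 e h : (forall t, e <= N t -> 0 <= h t) -> 0 <= nu_integral e h.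
Proof.
move=> h0; apply: Rintegral_ge0; rewrite out_eballE => t et.
by rewrite mulr_ge0 ?weight_ge0 ?h0.
Qed.

Lemma weightM_out e a t : 0 < e -> e <= N t ->
  N t `^ (2 * s - a) * weight t = N t `^ (- (d%:R + a)).
Proof.
move=> e0 et; rewrite /weight -powRN -powRD; first by congr powR; ring.
by rewrite (gt_eqF (lt_le_trans e0 et)) implybT.
Qed.

(** The exponent is written so that the product with the kernel is |z|^-(d+a). The case a = 2s makes
    constants integrable; a = s controls the long jumps of the barrier. *)
Lemma nu_integral_enorm_powR a : 0 < a -> exists2 K : R, 0 < K &
  forall e, 0 < e -> nu_integrable e (fun t => N t `^ (2 * s - a)) /\
    nu_integral e (fun t => N t `^ (2 * s - a)) <= K * e `^ (- a).
Proof.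
move=> a0; have [K K0 KP] := @integral_enorm_powR_out R d a a0.
exists K => // e e0.
have mp : measurable_fun setT (fun t : T => N t `^ (2 * s - a)).
  exact: measurable_enorm_powR.
have E : (\int[mu]_(t in out_eball e) (N t `^ (2 * s - a) * weight t)%:E
          <= (K * e `^ (- a))%:E)%E.
  apply: le_trans (KP e e0).
  rewrite le_eqVlt; apply/orP; left; apply/eqP; apply: eq_integral => t.
  by rewrite inE out_eballE => /= et; rewrite (weightM_out _ e0 et).
have A : nu_integrable e (fun t => N t `^ (2 * s - a)).
  apply/integrableP; split; first exact: nu_integrable_measurable.
  rewrite (le_lt_trans _ (ltry (K * e `^ (- a))))//; apply: le_trans E.
  rewrite le_eqVlt; apply/orP; left; apply/eqP; apply: eq_integral => t _.
  by rewrite gee0_abs// lee_fin mulr_ge0 ?powR_ge0 ?weight_ge0.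
split=> //; rewrite -lee_fin /nu_integral /Rintegral fineK//.
by apply: integrable_fin_num A; exact: measurable_out_eball.
Qed.

Lemma nu_integrable1 e : 0 < e -> nu_integrable e (fun=> 1).
Proof.
move=> e0; have [K K0 /(_ e e0)[A _]] := @nu_integral_enorm_powR (2 * s) (mulr_gt0
  (ltr0n _ 2) s0).
by apply: eq_nu_integrable A => t _; rewrite subrr powRr0.
Qed.

Lemma nu_integrable_bounded e h M : 0 < e -> measurable_fun setT h ->
  (forall t, e <= N t -> `|h t| <= M) -> nu_integrable e h.
Proof.
move=> e0 mh hM; apply: (nu_integrable_le (g := fun=> M * 1)) => //.
  by apply: nu_integrableZ; exact: nu_integrable1.
by move=> t et; rewrite mulr1 hM.
Qed.

Lemma nu_integrable_cst e c : 0 < e -> nu_integrable e (fun=> c).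
Proof. by move=> e0; apply: (@nu_integrable_bounded e _ `|c|). Qed.

Lemma nu_integral_cst e c : 0 < e -> nu_integral e (fun=> c)
  = c * nu_integral e (fun=> 1).
Proof.
by move=> e0; rewrite -nu_integralZ; [apply: eq_nu_integral => t _;
  rewrite mulr1|exact: nu_integrable1].
Qed.

Lemma measurable_indicM (A : set T) h : measurable A -> measurable_fun setT h ->
  measurable_fun setT (fun t => \1_A t * h t).
Proof. by move=> mA mh; apply: measurable_funM => //; exact: measurable_indic. Qed.

Lemma nu_integrable_indicM e (A : set T) h : measurable A -> measurable_fun setT h ->
  nu_integrable e h -> nu_integrable e (fun t => \1_A t * h t).
Proof.
move=> mA mh ah; apply: (nu_integrable_le (g := fun t => `|h t|)); last 2 first.
- exact: measurable_indicM.
- move=> t _; rewrite normrM indicE; case: (t \in A); rewrite ?normr1 ?normr0 ?mul1r//.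
  by rewrite mul0r.
have := integrable_abse ah; apply: eq_integrable.
  exact: measurable_out_eball.
by move=> t _; rewrite /= normrM (ger0_norm (weight_ge0 t)).
Qed.

Lemma nu_integral_indicM e (A : set T) h :
  nu_integral e (fun t => \1_A t * h t) = \int[mu]_(t in out_eball e `&` A) (h t *
    weight t).
Proof.
rewrite Rintegral_mkcondr; apply: eq_Rintegral => t _.
by rewrite /patch indicE; case: (t \in A); rewrite ?mul1r ?mul0r.
Qed.

Lemma nu_integral_far e r h : e <= r -> nu_integral e (fun t =>
  \1_(out_eball r) t * h t) = nu_integral r h.
Proof. by move=> er; rewrite nu_integral_indicM setIidr//; exact: out_eball_le. Qed.

(** Here s < 1 enters: |z|^2 is integrable against the full kernel near 0, so the bound does not
    involve [e] and vanishes with [r]. *)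
Lemma nu_integral_near_sqr : exists2 K : R, 0 < K & forall e r, 0 < e -> 0 < r ->
  nu_integrable e (fun t => \1_[set t | N t < r] t * N t ^+ 2) /\
  nu_integral e (fun t => \1_[set t | N t < r] t * N t ^+ 2) <= K * r `^ (2 - 2 * s).
Proof.
have a0 : 0 < 2 - 2 * s by move: s1; lra.
have [K K0 KP] := @integral_enorm_powR_in R d _ a0.
exists K => // e r e0 r0.
have mA : measurable [set t : T | N t < r] by exact: (measurable_cmp_enorm r).1.
have mN2 : measurable_fun setT (fun t : T => N t ^+ 2).
  exact: (measurableT_comp (exprn_measurable 2) measurable_enorm).
have A : nu_integrable e (fun t => \1_[set t | N t < r] t * N t ^+ 2).
  apply: (@nu_integrable_bounded e _ (r ^+ 2)) => //; first exact: measurable_indicM.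
  move=> t _; rewrite indicE; case: (boolP (_ \in _)) => [|_]; last first.
    by rewrite mul0r normr0 sqr_ge0.
  rewrite inE/= => tr; rewrite mul1r ger0_norm ?sqr_ge0//.
  by rewrite lerXn2r ?nnegrE ?enorm_ge0// ltW.
split=> //; rewrite -lee_fin.
have := integrable_fin_num (measurable_out_eball e) A => fin.
rewrite /nu_integral /Rintegral fineK//.
have := integral_mkcondr mu (out_eball e) [set t | N t < r] (fun t =>
  (N t ^+ 2 * weight t)%:E).
rewrite [X in _ = X -> _](_ : _ = (\int[mu]_(x in out_eball e) (\1_[set t | N t < r] x
  * N x ^+ 2 * weight x)%:E)%E); last first.
  apply: eq_integral => t _; rewrite /patch indicE.
  by case: (t \in _); rewrite ?mul1r ?mul0r.
move=> <-; apply: le_trans (KP r r0).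
set D := _ `&` _.
have mD : measurable D by apply: measurableI => //; exact: measurable_out_eball.
have NP t : D t -> N t ^+ 2 * weight t = N t `^ (2 - 2 * s - d%:R).
  rewrite /D out_eballE => -[/= et _].
  have Nt := lt_le_trans e0 et.
  rewrite -powR_mulrn ?enorm_ge0// /weight -powRN -powRD; first by congr powR; ring.
  by rewrite (gt_eqF Nt) implybT.
rewrite (eq_integral (fun t => (N t `^ (2 - 2 * s - d%:R))%:E)); last first.
  by move=> t; rewrite inE => Dt; rewrite NP.
apply: ge0_subset_integral => //.
- rewrite (_ : mkset _ = [set t | N t < r] `&` \bigcup_k [set t : T | k.+1%:R^-1 <= N t]).
    apply: measurableI => //; apply: bigcupT_measurable => k.
    exact: (measurable_cmp_enorm _).2.
  apply/seteqP; split=> t /=.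
    move=> /andP[N0 Nt]; split=> //; exists (Num.truncn (N t)^-1) => //=.
    by rewrite invf_ple ?posrE// ltW// truncnS_gt.
  by move=> [-> [k _ /= kN]]; rewrite andbT (lt_le_trans _ kN)// invr_gt0.
- by apply/measurable_EFinP; exact: measurable_enorm_powR.
- by move=> t _; rewrite lee_fin powR_ge0.
- rewrite /D out_eballE => t [/= et ->]; rewrite andbT.
  exact: lt_le_trans et.
Qed.

Lemma nu_integral_odd e h : measurable_fun setT h -> nu_integrable e h ->
  (forall t, h (negt t) = - h t) -> nu_integral e h = 0.
Proof.
move=> mh ah hN.
have wN t : weight (negt t) = weight t by rewrite /weight rowt_negt enormN.
pose F (t : T) := (h t * weight t)%:E.
have mF : measurable_fun setT F.
  by apply/measurable_EFinP/measurable_funM => //; exact: measurable_weight.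
have DN : @negt R d @^-1` out_eball e = out_eball e.
  by rewrite out_eballE; apply/seteqP; split=> t /=; rewrite rowt_negt enormN.
have FN : F \o @negt R d = fun t => (- 1 * h t * weight t)%:E.
  by apply/funext => t; rewrite /F/= hN wN mulN1r.
have aN : mu.-integrable (@negt R d @^-1` out_eball e) (F \o @negt R d).
  by rewrite DN FN; exact: nu_integrableZ.
have := integral_pushforward (@measurable_negt R d) mF aN (measurable_out_eball e).
rewrite (_ : integral (pushforward _ _) _ _ = integral mu (out_eball e) F); last first.
  apply: eq_measure_integral; first exact: measurable_negt.
  by move=> mneg A mA _; exact: lebesgue_tuple_negt.
rewrite DN FN => /(congr1 fine) E.
have : nu_integral e h = nu_integral e (fun t => - 1 * h t) by exact: E.
rewrite (nu_integralZ _ ah) mulN1r => /eqP; rewrite -addr_eq0 -mulr2n => /eqP.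
by move=> /eqP; rewrite mulrn_eq0/= => /eqP.
Qed.

Lemma measurable_dot (p : 'rV[R]_d) : measurable_fun setT (fun t : T => dot p (rowt t)).
Proof.
apply: measurable_sum => i; apply: measurable_funM => //.
rewrite (_ : (fun _ => _) = fun t : T => tnth t i); first exact: measurable_tnth.
by apply/funext => t; rewrite mxE.
Qed.

(** The region e <= |z| < r is symmetric. Thus gradients cost nothing at any [e], whatever their
    size. *)
Lemma nu_integral_near_dot e r (p : 'rV[R]_d) : 0 < e ->
  nu_integrable e (fun t => \1_[set t | N t < r] t * dot p (rowt t)) /\
  nu_integral e (fun t => \1_[set t | N t < r] t * dot p (rowt t)) = 0.
Proof.
move=> e0.
have mA : measurable [set t : T | N t < r] by exact: (measurable_cmp_enorm r).1.
have mh := measurable_indicM mA (measurable_dot p).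
have ah : nu_integrable e (fun t => \1_[set t | N t < r] t * dot p (rowt t)).
  apply: (@nu_integrable_bounded e _ (enorm p * `|r|)) => // t _.
  rewrite indicE; case: (boolP (_ \in _)) => [|_]; last first.
    by rewrite mul0r normr0 mulr_ge0 ?enorm_ge0.
  rewrite inE/= => tr; rewrite mul1r.
  apply: (@le_trans _ _ (enorm p * N t)); last first.
    by rewrite ler_wpM2l ?enorm_ge0// (le_trans (ltW tr))// ler_norm.
  rewrite ler_norml dot_le andbT lerNl -dotNr (le_trans (dot_le _ _))//.
  by rewrite enormN.
split=> //; apply: nu_integral_odd => // t.
rewrite rowt_negt dotNr mulrN !indicE; congr (- (_ * _)).
congr (_%:R); congr nat_of_bool.
by apply/idP/idP; rewrite !inE /= rowt_negt enormN.
Qed.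

(** The mass of jumps that advance by at least [r] in a given direction. It drives both the boundary
    barrier and the growth of the killing rate. *)
Lemma nu_integral_cone : (0 < d)%N -> exists2 c : R, 0 < c &
  forall e r (n : 'rV[R]_d), 0 < e -> e <= r -> 3 * r < 1 -> enorm n = 1 ->
  let E := [set t : T | r <= dot n (rowt t) /\ N t < 1] in
  measurable E /\ c * r `^ (- (2 * s)) <= nu_integral e (\1_E).
Proof.
move=> d0.
have d0' : 0 < d%:R :> R by rewrite ltr0n.
have k0 : 0 < 3 `^ (- (d%:R + 2 * s)) :> R by rewrite powR_gt0.
exists ((2 / d%:R) ^+ d * 3 `^ (- (d%:R + 2 * s))).
  by rewrite mulr_gt0// exprn_gt0// divr_gt0.
move=> e r n e0 er r1 n1 E.
have r0 := lt_le_trans e0 er.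
have mE : measurable E.
  apply: measurableI; last exact: (measurable_cmp_enorm 1).1.
  have := measurable_dot n measurableT (measurable_itv `[r, +oo[).
  rewrite setTI (_ : _ @^-1` _ = [set t | r <= dot n (rowt t)])//.
  by apply/seteqP; split=> t /=; rewrite in_itv/= andbT.
split=> //.
(* A cube around 2r n with half-side r/d lies within Euclidean distance r of its centre, so on it
   n.z >= r and |z| <= 3r < 1. Its volume is of order r^d and the kernel is at least
   (3r)^-(d+2s). *)
pose B := [set t : T | forall i, `|tnth t i - 2 * r * n 0 i| < r / d%:R].
have rd0 : 0 < r / d%:R by rewrite divr_gt0.
have mB : measurable B by exact: (@measurable_box R d (fun i =>
  2 * r * n 0 i) (r / d%:R)).
have muB : (mu B = ((2 * (r / d%:R)) ^+ d)%:E)%E.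
  exact: (@lebesgue_tuple_cube R d (fun i => 2 * r * n 0 i) (r / d%:R) rd0).
have BP t : B t -> enorm (rowt t - (2 * r) *: n) <= r.
  move=> Bt; rewrite (le_trans (enorm_le_sum _))//.
  apply: (@le_trans _ _ (\sum_(i < d) r / d%:R)).
    by apply: ler_sum => i _; rewrite !mxE; exact/ltW/Bt.
  by rewrite sumr_const card_ord -[leLHS]mulr_natr divfK// gt_eqF.
have BN t : B t -> N t <= 3 * r.
  move=> Bt; rewrite -[rowt t](subrK ((2 * r) *: n)).
  rewrite (le_trans (ler_enormD _ _))// enormZ n1 mulr1 gtr0_norm ?mulr_gt0//.
  by have := BP t Bt; lra.
have BE t : B t -> E t.
  move=> Bt; split; last exact: le_lt_trans (BN t Bt) r1.
  rewrite -[rowt t](subrK ((2 * r) *: n)) dotDr dotZr -sqr_enorm n1 expr1n mulr1.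
  have := dot_le (- n) (rowt t - (2 * r) *: n).
  rewrite dotC dotNr dotC enormN n1 mul1r; have := BP t Bt; lra.
have EO t : E t -> r <= N t.
  by move=> [rt _]; rewrite (le_trans rt)// (le_trans (dot_le _ _))// n1 mul1r.
have aE : nu_integrable e (\1_E).
  by apply: (@nu_integrable_bounded e _ 1) => // t _; rewrite indicE;
    case: (t \in E); rewrite ?normr1 ?normr0.
rewrite -lee_fin /nu_integral /Rintegral fineK; last first.
  by apply: integrable_fin_num aE; exact: measurable_out_eball.
apply: (@le_trans _ _ (\int[mu]_(t in B) ((3 * r) `^ (- (d%:R + 2 * s)))%:E)%E).
  rewrite integral_cst//.
  rewrite (_ : (_ * _ = ((3 * r) `^ (- (d%:R
    + 2 * s)))%:E * ((2 * (r / d%:R)) ^+ d)%:E)%E); last first.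
    by congr (_ * _)%E; exact: muB.
  rewrite -EFinM lee_fin le_eqVlt; apply/orP; left; apply/eqP.
  have -> : r `^ (- (2 * s)) = r ^+ d * r `^ (- (d%:R + 2 * s)).
    rewrite -powR_mulrn ?(ltW r0)// -powRD; first by congr powR; ring.
    by rewrite (gt_eqF r0) implybT.
  have -> : (2 * (r / d%:R)) ^+ d = (2 / d%:R) ^+ d * r ^+ d.
    by rewrite -exprMn; congr (_ ^+ _); ring.
  by rewrite powRM ?(ltW r0)//; ring.
apply: (@le_trans _ _ (\int[mu]_(t in B) (\1_E t * weight t)%:E)%E).
  apply: ge0_le_integral => //.
  - by move=> t _; rewrite lee_fin powR_ge0.
  - apply/measurable_EFinP; apply: measurable_funM; first exact: measurable_indic.
    exact: measurable_weight.
  - move=> t Bt; rewrite lee_fin indicE mem_set ?mul1r; last exact: BE.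
    have Nt0 := lt_le_trans r0 (EO _ (BE _ Bt)).
    rewrite powRN lef_pV2 ?posrE ?powR_gt0 ?mulr_gt0//.
    apply: ge0_ler_powR; rewrite ?nnegrE.
    + by rewrite addr_ge0 ?mulr_ge0// ltW.
    + exact: enorm_ge0.
    + by rewrite mulr_ge0// ltW.
    + exact: BN.
apply: ge0_subset_integral => //.
- exact: measurable_out_eball.
- by apply: nu_integrable_measurable; exact: measurable_indic.
- by move=> t _; rewrite lee_fin mulr_ge0 ?weight_ge0.
- by rewrite out_eballE => t Bt /=; rewrite (le_trans er)// EO//; exact: BE.
Qed.

End truncated_functional.

(** * The truncated problem *)

Section upper_integral.
Context {R : realType} {d : nat}.
Variable s : R.
Hypothesis s01 : 0 < s < 1.
Local Notation T := (d.-tuple (measurableTypeR R)).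
Local Notation N := (fun t : T => enorm (rowt t)).
Local Notation Jnu := (@nu_integral R d).

(* The upper integral is monotone and commutes with adding integrable functions,
   which is all the truncated problem needs; its unknown need not be measurable. *)
Definition upper_nu_integral e (f : T -> R) : R :=
  inf [set Jnu s e h | h in [set h | nu_integrable s e h /\ forall t, e <= N t ->
    f t <= h t]].

Variable e : R.
Hypothesis e0 : 0 < e.

Definition bounded_out M (f : T -> R) := forall t, e <= N t -> `|f t| <= M.

Let lb M f : bounded_out M f ->
  lbound [set Jnu s e h | h in [set h | nu_integrable s e h /\ forall t, e <= N t ->
    f t <= h t]]
   (Jnu s e (fun=> - M)).
Proof.
move=> fM _ [h [ah fh] <-]; apply: le_nu_integral => //; first exact: nu_integrable_cst.
by move=> t et; rewrite (le_trans _ (fh _ et))// lerNl; have := fM t et;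
  rewrite ler_norml => /andP[]; lra.
Qed.

Lemma upper_nu_integral_le M f h : bounded_out M f -> nu_integrable s e h ->
  (forall t, e <= N t -> f t <= h t) -> upper_nu_integral e f <= Jnu s e h.
Proof.
move=> fM ah fh; apply: ge_inf; last by exists h.
by exists (Jnu s e (fun=> - M)); exact: lb fM.
Qed.

Lemma le_upper_nu_integral M f h : bounded_out M f -> nu_integrable s e h ->
  (forall t, e <= N t -> h t <= f t) -> Jnu s e h <= upper_nu_integral e f.
Proof.
move=> fM ah hf; apply: lb_le_inf.
  exists (Jnu s e (fun=> M)), (fun=> M) => //; split; first exact: nu_integrable_cst.
  by move=> t et; rewrite (le_trans (ler_norm _))// fM.
move=> _ [h' [ah' fh'] <-]; apply: le_nu_integral => // t et.
exact: le_trans (hf t et) (fh' t et).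
Qed.

Lemma upper_nu_integral_leD M f f' h : bounded_out M f -> bounded_out M f' ->
  nu_integrable s e h ->
  (forall t, e <= N t -> f t <= f' t + h t) ->
  upper_nu_integral e f <= upper_nu_integral e f' + Jnu s e h.
Proof.
move=> fM fM' ah ff'; rewrite -lerBlDr; apply: lb_le_inf.
  exists (Jnu s e (fun=> M)), (fun=> M) => //; split; first exact: nu_integrable_cst.
  by move=> t et; rewrite (le_trans (ler_norm _))// fM'.
move=> _ [h' [ah' fh'] <-]; rewrite lerBlDr -nu_integralD//.
apply: (upper_nu_integral_le fM); first exact: nu_integrableD.
by move=> t et; rewrite (le_trans (ff' _ et))// lerD2r fh'.
Qed.

End upper_integral.

Section truncated_problem.
Context {R : realType} {d : nat}.
Variable s : R.
Hypothesis s01 : 0 < s < 1.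
Local Notation T := (d.-tuple (measurableTypeR R)).
Local Notation N := (fun t : T => enorm (rowt t)).
Local Notation Jnu := (@nu_integral R d).
Local Notation X := 'rV[R]_d.

(** The truncated inequality for a possibly non-measurable [u]: the increment is replaced by each of
    its integrable majorants. *)
Definition eps_sub (C e r : R) (g : X -> R -> R) (u : X -> R) : Prop :=
  forall x h, eball 0 r x -> nu_integrable s e h ->
  (forall t, e <= N t -> u (x + rowt t) - u x <= h t) ->
  0 <= C * Jnu s e h + g x (u x).

(** The difference of the equations at two points. The one-sided tests of [u] and [- u] do not yield
    it, since upper and lower integrals may differ. *)
Definition eps_two (C e r : R) (g : X -> R -> R) (u : X -> R) : Prop :=
  forall x y h, eball 0 r x -> eball 0 r y -> nu_integrable s e h ->
  (forall t, e <= N t -> u (y + rowt t) - u y <= u (x + rowt t) - u x + h t) ->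
  g x (u x) <= g y (u y) + C * Jnu s e h.

Definition opp_nonlin (g : X -> R -> R) : X -> R -> R := fun x y => - g x (- y).

Record eps_solution (C e r M : R) (g : X -> R -> R) (phi u : X -> R) : Prop :=
 EpsSolution {
  eps_bounded : forall x, `|u x| <= M ;
  eps_exterior : forall x, ~ eball 0 r x -> u x = phi x ;
  eps_sub_pos : eps_sub C e r g u ;
  eps_sub_neg : eps_sub C e r (opp_nonlin g) (fun x => - u x) ;
  eps_twoP : eps_two C e r g u }.

(** This symmetry turns each upper bound into a lower bound and the subsolution property into the
    supersolution property. The two points of [eps_two] exchange roles. *)
Lemma eps_solutionN C e r M g phi u : eps_solution C e r M g phi u ->
  eps_solution C e r M (opp_nonlin g) (fun x => - phi x) (fun x => - u x).
Proof.
case=> u1 u2 u3 u4 u5; split => //.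
- by move=> x; rewrite normrN.
- by move=> x /u2 ->.
- move=> x h Bx ah uh; rewrite /opp_nonlin !opprK.
  by apply: u3 => // t et; have := uh t et; lra.
- move=> x y h Bx By ah uh; rewrite /opp_nonlin !opprK.
  have := u5 y x h By Bx ah.
  have A : forall t, e <= N t -> u (x + rowt t) - u x <= u (y + rowt t) - u y + h t.
    by move=> t /uh; lra.
  by move=> /(_ A); lra.
Qed.

Lemma eball_far r (x : X) (t : T) : eball 0 r x -> 2 * r <= N t ->
  ~ eball 0 r (x + rowt t).
Proof.
rewrite /eball/= !subr0 => xr rt h.
have := ler_enormB (x + rowt t) 0 x.
rewrite subr0 sub0r enormN (addrC x) addrK.
by move: h rt xr; rewrite (addrC x) /=; lra.
Qed.

Variables (C e r M K : R) (g : X -> R -> R) (phi : X -> R).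
Hypotheses (C0 : 0 < C) (e0 : 0 < e) (er : e <= 2 * r) (K0 : 0 < K).
Hypothesis phiM : forall x, `|phi x| <= M - 1.
Hypothesis gK : forall x y y', eball 0 r x -> `|y| <= M -> `|y'| <= M ->
  `|g x y - g x y'| <= K * `|y - y'|.
Hypothesis gkappa : forall x y, eball 0 r x -> `|y| <= M ->
  `|g x y| <= C * Jnu s (2 * r) (fun=> 1).

Let lam : R := Jnu s e (fun=> 1).
Let kappa : R := Jnu s (2 * r) (fun=> 1).

Let lam0 : 0 <= lam. Proof. exact: nu_integral_ge0. Qed.

Let den : R := C * lam + K.

Let den0 : 0 < den.
Proof. by rewrite ltr_wpDl// mulr_ge0// ltW. Qed.

Let adm1' : @nu_integrable R d s e (fun=> 1). Proof. exact: nu_integrable1. Qed.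

Let V : set (X -> R) := [set v | (forall x, `|v x| <= M) /\
  forall x, ~ eball 0 r x -> v x = phi x].

Let shift (v : X -> R) x (t : T) := v (x + rowt t).

Let Vb v x : V v -> bounded_out e M (shift v x).
Proof. by move=> [vM _] t _; exact: vM. Qed.

(** The equation C (upper integral) - C lam u + g(x, u) = 0 solved for u after adding K u to both
    sides; as [g] is K-Lipschitz in its second argument, the right-hand side becomes monotone. *)
Let Phi (v : X -> R) (x : X) : R :=
  if pselect (eball 0 r x) then
    (C * upper_nu_integral s e (shift v x) + g x (v x) + K * v x) / den
  else phi x.

Let mfar : measurable (@out_eball R d (2 * r)).
Proof. exact: measurable_out_eball. Qed.

Let afar : @nu_integrable R d s e (fun t => \1_(out_eball (2 * r)) t * 1).
Proof. by apply: nu_integrable_indicM. Qed.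

(** On jumps of length at least 2r the value is that of [phi], of size at most M - 1. This lowers
    the upper integral from M lam to M lam - kappa, and C kappa pays for |g|; the lower bound is
    symmetric. *)
Let Phi_V v : V v -> V (Phi v).
Proof.
move=> Vv; have [vM vphi] := Vv; split; last first.
  by move=> x nBx; rewrite /Phi; case: pselect.
move=> x; rewrite /Phi; case: pselect => Bx /=; last first.
  by rewrite (le_trans (phiM x))// gerBl.
have far1 t : \1_(out_eball (2 * r)) t * 1 <= M - shift v x t.
  rewrite mulr1 indicE; case: (boolP (t \in _)) => [|_]; rewrite ?mulr1n ?mulr0n.
    rewrite inE out_eballE => /(eball_far Bx)/vphi; rewrite /shift => ->.
    by have := phiM (x + rowt t); rewrite ler_norml => /andP[_ /=]; lra.
  by have := vM (x + rowt t); rewrite ler_norml /shift => /andP[_ +]; lra.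
have far2 t : \1_(out_eball (2 * r)) t * 1 <= M + shift v x t.
  rewrite mulr1 indicE; case: (boolP (t \in _)) => [|_]; rewrite ?mulr1n ?mulr0n.
    rewrite inE out_eballE => /(eball_far Bx)/vphi; rewrite /shift => ->.
    by have := phiM (x + rowt t); rewrite ler_norml => /andP[/= + _]; lra.
  by have := vM (x + rowt t); rewrite ler_norml /shift => /andP[+ _]; lra.
have J1 : Jnu s e (fun t => M + -1 * (\1_(out_eball (2 * r)) t * 1)) = M * lam - kappa.
  rewrite nu_integralD//; [|exact: nu_integrable_cst|exact: nu_integrableZ].
  by rewrite nu_integralZ// nu_integral_cst// nu_integral_far// mulN1r.
have J2 : Jnu s e (fun t => - M + (\1_(out_eball (2 * r)) t * 1)) = - (M * lam) + kappa.
  rewrite nu_integralD//; last exact: nu_integrable_cst.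
  by rewrite nu_integral_cst// nu_integral_far// mulNr.
have U : upper_nu_integral s e (shift v x) <= M * lam - kappa.
  rewrite -J1; apply: (upper_nu_integral_le s01 e0 (Vb x Vv)).
    by apply: nu_integrableD; [exact: nu_integrable_cst|exact: nu_integrableZ].
  by move=> t _; have := far1 t; lra.
have L : - (M * lam) + kappa <= upper_nu_integral s e (shift v x).
  rewrite -J2; apply: (le_upper_nu_integral s01 e0 (Vb x Vv)).
    by apply: nu_integrableD => //; exact: nu_integrable_cst.
  by move=> t _; have := far2 t; lra.
have CU : C * upper_nu_integral s e (shift v x)
  <= C * (M * lam - kappa) by rewrite ler_pM2l.
have CL : C * (- (M * lam) + kappa) <= C * upper_nu_integral s e (shift v x) by rewrite
  ler_pM2l.
have := gkappa Bx (vM x); rewrite -/kappa ler_norml => /andP[g1 g2].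
have := vM x; rewrite ler_norml => /andP[v1 v2].
have K1 : K * v x <= K * M by rewrite ler_pM2l.
have K2 : K * - M <= K * v x by rewrite ler_pM2l.
rewrite ler_norml; apply/andP; split.
  by rewrite ler_pdivlMr// /den; move: CL g1 K2; lra.
by rewrite ler_pdivrMr// /den; move: CU g2 K1; lra.
Qed.

Let Phi_mono v v' : V v -> V v' -> (forall x, v x <= v' x) ->
  forall x, Phi v x <= Phi v' x.
Proof.
move=> Vv Vv' vv' x; rewrite /Phi; case: pselect => //= Bx.
rewrite ler_pM2r ?invr_gt0//.
have U : upper_nu_integral s e (shift v x) <= upper_nu_integral s e (shift v' x).
  have := upper_nu_integral_leD s01 e0 (Vb x Vv) (Vb x Vv') (@nu_integrable_cst R d s
    s01 e 0 e0).
  rewrite nu_integral_cst// mul0r addr0; apply => t _; rewrite addr0; exact: vv'.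
have CU : C * upper_nu_integral s e (shift v x)
  <= C * upper_nu_integral s e (shift v' x) by rewrite ler_pM2l.
have := gK Bx (Vv.1 x) (Vv'.1 x).
rewrite [X in X <= _]distrC [X in _ <= _ * X]distrC [X in _
  <= _ * X]ger0_norm ?subr_ge0//.
rewrite ler_norml => /andP[+ _]; move: CU; lra.
Qed.

Lemma eps_solution_exists : exists u, eps_solution C e r M g phi u.
Proof.
have M1 : 1 <= M.
  by have := le_trans (normr_ge0 _) (phiM 0); rewrite subr_ge0.
(* Knaster-Tarski: the pointwise supremum [u] of the post-fixed points satisfies u <= Phi u, and Phi
   u is again post-fixed, which gives equality. The least candidate [v0] shows that [A] is
   nonempty. *)
pose A : set (X -> R) := [set v | V v /\ forall x, v x <= Phi v x].
pose v0 : X -> R := fun x => if pselect (eball 0 r x) then - M else phi x.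
have Vv0 : V v0.
  split=> x; rewrite /v0; case: pselect => //= _.
    by rewrite normrN ger0_norm// (le_trans _ M1).
  by rewrite (le_trans (phiM x))// gerBl.
have Av0 : A v0.
  split=> // x; rewrite {1}/v0; case: pselect => /= Bx.
    by have := (Phi_V Vv0).1 x; rewrite ler_norml => /andP[].
  by rewrite (Phi_V Vv0).2.
pose u x := sup [set v x | v in A].
have hs x : has_sup [set v x | v in A].
  split; first by exists (v0 x), v0.
  by exists M => _ [v [Vv _] <-]; rewrite (le_trans (ler_norm _))// Vv.1.
have uA v x : A v -> v x <= u x.
  by move=> Av; apply: ub_le_sup; [exact: (hs x).2|exists v].
have Vu : V u.
  split=> x.
    rewrite ler_norml; apply/andP; split.
      rewrite (le_trans _ (uA _ x Av0))//.
      by have := Vv0.1 x; rewrite ler_norml => /andP[].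
    apply: ge_sup; first exact: (hs x).1.
    by move=> _ [v [Vv _] <-]; rewrite (le_trans (ler_norm _))// Vv.1.
  move=> nBx; rewrite /u (_ : [set _ | _ in _] = [set phi x]) ?sup1//.
  apply/seteqP; split=> [_ [v [Vv _] <-]|_ ->]; first by rewrite /= Vv.2.
  by exists v0 => //; rewrite Vv0.2.
have u_le x : u x <= Phi u x.
  apply: ge_sup; first exact: (hs x).1.
  move=> _ [v Av <-]; apply: le_trans (Av.2 x) _.
  by apply: Phi_mono => //; [exact: Av.1|move=> y; exact: uA].
have uE x : u x = Phi u x.
  apply/le_anti; rewrite u_le/=; apply: uA; split; first exact: Phi_V.
  by apply: Phi_mono => //; exact: Phi_V.
have E x : eball 0 r x ->
    C * upper_nu_integral s e (shift u x) - C * lam * u x + g x (u x) = 0.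
  move=> Bx; have := uE x; rewrite /Phi; case: pselect => //= _.
  by move=> /(congr1 (fun z => z * den)); rewrite divfK ?gt_eqF// /den; lra.
have ub x := Vb x Vu.
exists u; split; [exact: Vu.1|exact: Vu.2| | | ].
- move=> x h Bx ah uh.
  have U : upper_nu_integral s e (shift u x) <= Jnu s e (fun t => h t + u x).
    apply: (upper_nu_integral_le s01 e0 (ub x));
      first by apply: nu_integrableD => //; exact: nu_integrable_cst.
    by move=> t /uh; rewrite lerBlDr.
  rewrite nu_integralD//in U; last exact: nu_integrable_cst.
  rewrite nu_integral_cst// -/lam in U.
  have CU := ler_pM2l C0; rewrite -(CU _ _) in U.
  by have := E x Bx; move: U; lra.
- move=> x h Bx ah uh.
  have U : Jnu s e (fun t => -1 * h t + u x) <= upper_nu_integral s e (shift u x).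
    apply: (le_upper_nu_integral s01 e0 (ub x)).
      by apply: nu_integrableD; [exact: nu_integrableZ|exact: nu_integrable_cst].
    by move=> t /uh; rewrite /shift; lra.
  rewrite nu_integralD in U; [|exact: nu_integrableZ|exact: nu_integrable_cst].
  rewrite nu_integralZ// nu_integral_cst// -/lam in U.
  have CU := ler_pM2l C0; rewrite -(CU _ _) in U.
  by have := E x Bx; rewrite /opp_nonlin opprK; move: U; lra.
- move=> x y h Bx By ah uh.
  have U : upper_nu_integral s e (shift u y) <=
      upper_nu_integral s e (shift u x) + Jnu s e (fun t => h t + (u y - u x)).
    apply: (upper_nu_integral_leD s01 e0 (ub y) (ub x)).
      by apply: nu_integrableD => //; exact: nu_integrable_cst.
    by move=> t /uh; rewrite /shift; lra.
  rewrite nu_integralD//in U; last exact: nu_integrable_cst.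
  rewrite nu_integral_cst// -/lam in U.
  have CU := ler_pM2l C0; rewrite -(CU _ _) in U.
  by have := E x Bx; have := E y By; move: U; lra.
Qed.

End truncated_problem.

(** * The boundary barrier *)

Section power_inequalities.
Context {R : realType}.
Implicit Types (b s t w y : R).

(** Young's inequality for y^b and 1 with conjugate exponents 1/b and 1/(1-b). *)
Lemma powR_le_tangent b y : 0 < b < 1 -> 0 <= y -> y `^ b <= 1 + b * (y - 1).
Proof.
move=> /andP[b0 b1] y0.
have := @conjugate_powR R (y `^ b) 1 b^-1 (1 - b)^-1 (powR_ge0 _ _) ler01.
rewrite !invr_gt0 subr_gt0 !invrK => /(_ b0 b1); rewrite addrC subrK => /(_ erefl).
rewrite -powRrM mulfV ?gt_eqF// powRr1// powR1 !mulr1; lra.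
Qed.

Lemma powR_sub_tangent b t w : 0 < b < 1 -> 0 < t -> w <= t ->
  (t - w) `^ b <= t `^ b - b * t `^ (b - 1) * w.
Proof.
move=> b01 t0 wt.
have y0 : 0 <= (t - w) / t by rewrite divr_ge0 ?subr_ge0// ltW.
have -> : t - w = t * ((t - w) / t) by rewrite mulrC divfK// gt_eqF.
rewrite powRM ?(ltW t0)//; apply: (@le_trans _ _ (t `^ b * (1 + b * ((t - w) / t - 1)))).
  by rewrite ler_wpM2l ?powR_ge0// powR_le_tangent.
rewrite powRB; last by rewrite (gt_eqF t0) implybT.
rewrite powRr1 ?(ltW t0)// le_eqVlt; apply/orP; left; apply/eqP.
by field; rewrite gt_eqF.
Qed.

(** The factor [b] is the point: it makes the gain from long jumps small. With l = ln y, e^(bl) - 1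
    <= b l e^(bl), and l is absorbed by (2/s) e^(sl/2). *)
Lemma powR_sub1_le b s y : 0 < s -> 0 < b -> 2 * b <= s -> 1 <= y ->
  y `^ b - 1 <= 2 * b / s * y `^ s.
Proof.
move=> s0 b0 bs y1.
have y0 : 0 < y by rewrite (lt_le_trans _ y1).
have L0 : 0 <= ln y by rewrite ln_ge0.
rewrite /powR (gt_eqF y0); set l := ln y in L0 *.
have h1 : expR (b * l) - 1 <= b * l * expR (b * l).
  have : (1 - b * l) * expR (b * l) <= expR (- (b * l)) * expR (b * l).
    by rewrite ler_wpM2r ?expR_ge0//; have := expR_ge1Dx (- (b * l)); lra.
  by rewrite -expRD addNr expR0; lra.
have h2 : l <= 2 / s * expR (s / 2 * l).
  have := expR_ge1Dx (s / 2 * l) => h.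
  have e : l = 2 / s * (s / 2 * l) by field; rewrite gt_eqF.
  by rewrite {1}e ler_wpM2l ?divr_ge0 ?(ltW s0)//; lra.
apply: (le_trans h1); apply: (@le_trans _ _ (b * (2 / s * expR (s / 2 * l)) * expR (b *
  l))).
  by rewrite ler_wpM2r ?expR_ge0// ler_wpM2l ?(ltW b0).
rewrite [leLHS](_ : _ = 2 * b / s * (expR (s / 2 * l) * expR (b * l))); last by ring.
rewrite -expRD; apply: ler_wpM2l.
  by rewrite divr_ge0 ?mulr_ge0 ?(ltW b0) ?(ltW s0).
rewrite ler_expR -mulrDl.
by rewrite ler_wpM2r//; lra.
Qed.

Lemma powR_add_sub_le b s t w : 0 < s -> 0 < b -> 2 * b <= s -> 0 < t -> t <= w ->
  (t + w) `^ b - t `^ b <= 2 * b / s * 2 `^ s * t `^ (b - s) * w `^ s.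
Proof.
move=> s0 b0 bs t0 tw.
have w0 := lt_le_trans t0 tw.
have -> : t + w = t * (1 + w / t) by rewrite mulrDr mulr1 mulrCA mulfV ?mulr1// gt_eqF.
have wt0 : 0 <= w / t by rewrite divr_ge0// ltW.
rewrite powRM ?addr_ge0 ?(ltW t0)// -[X in _ - X]mulr1 -mulrBr.
have y1 : 1 <= 1 + w / t by rewrite lerDl.
apply: (@le_trans _ _ (t `^ b * (2 * b / s * (1 + w / t) `^ s))).
  by rewrite ler_wpM2l ?powR_ge0// powR_sub1_le.
have : (1 + w / t) `^ s <= 2 `^ s * w `^ s / t `^ s.
  rewrite -powRN -powRM ?(ltW w0)// -powR_inv1 ?(ltW t0)// in y1 wt0 *.
  apply: (@le_trans _ _ ((2 * w * t `^ (- 1)) `^ s)).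
    apply: ge0_ler_powR; rewrite ?nnegrE ?(ltW s0) ?mulr_ge0 ?(ltW w0) ?powR_ge0
      ?addr_ge0//.
    rewrite powR_inv1 ?(ltW t0)//.
    by rewrite ler_pdivlMr// mulrDl mul1r divfK ?gt_eqF//; lra.
  by rewrite powRM ?mulr_ge0 ?(ltW w0) ?powR_ge0// -powRrM mulN1r.
rewrite powRB; last by rewrite (gt_eqF t0) implybT.
set A := (1 + w / t) `^ s => h.
have c0 : 0 <= t `^ b * (2 * b / s).
  by rewrite mulr_ge0 ?powR_ge0// divr_ge0 ?mulr_ge0 ?(ltW b0) ?(ltW s0).
rewrite [leLHS]mulrA; apply: le_trans (ler_wpM2l c0 h) _.
rewrite le_eqVlt; apply/orP; left; apply/eqP; ring.
Qed.

Lemma powR_ge1_le1 t b : 0 < t <= 1 -> b <= 0 -> 1 <= t `^ b.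
Proof. by move=> t01 b0; rewrite -(powRr0 t) ger_powR. Qed.

End power_inequalities.

Section barrier.
Context {R : realType} {d : nat}.
Variable s : R.
Hypothesis s01 : 0 < s < 1.
Local Notation T := (d.-tuple (measurableTypeR R)).
Local Notation N := (fun t : T => enorm (rowt t)).
Local Notation X := 'rV[R]_d.
Local Notation Jnu := (@nu_integral R d).

Let s0 : 0 < s. Proof. by case/andP: s01. Qed.

Definition cone (r : R) (n : X) : set T :=
  [set t | r <= dot n (rowt t) /\ N t < 1].

(** The shift by [e] keeps r - |y| + e above [e] in the ball, so that the jumps of [cone] at that
    scale are long enough to be seen by the truncated kernel. *)
Definition barrier (r e b : R) (y : X) : R :=
  if enorm y < r then (r - enorm y + e) `^ b else 0.

(** Here [t] is the shifted distance to the sphere. Short jumps: the tangent of the concave power,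
    which is odd in [z]. Jumps longer than [t]: growth with the small factor [b]. Jumps in the cone
    leave the ball and lose the full value t^b. *)
Definition barrier_majorant (b t : R) (n : X) (z : T) : R :=
  \1_[set z | N z < t] z * dot (- (b * t `^ (b - 1)) *: n) (rowt z)
  + (2 * b / s * 2 `^ s * t `^ (b - s)) * (\1_(out_eball t) z * N z `^ s)
  + - t `^ b * \1_(cone t n) z.

(** The hypothesis on [n] says that it is a subgradient of the norm at [x]; it gives r - |x+z| + e
    <= t - n.z and reduces the estimate to one variable. *)
Lemma barrier_majorantP (r e b : R) (x n : X) :
  0 < e -> 0 < b -> b < 1 -> 2 * b <= s ->
  enorm x < r -> enorm n = 1 -> (forall z, enorm x + dot n z <= enorm (x + z)) ->
  forall z, N z < 1 ->
  barrier r e b (x + rowt z) - barrier r e b x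
    <= barrier_majorant b (r - enorm x + e) n z.
Proof.
move=> e0 b0 b1 bs xr n1 nP z z1.
set t := r - enorm x + e.
have t0 : 0 < t by rewrite /t; lra.
have nz : dot n (rowt z) <= N z by rewrite (le_trans (dot_le _ _))// n1 mul1r.
have nPz := nP (rowt z).
have -> : barrier r e b x = t `^ b by rewrite /barrier xr.
have tN : 0 < t `^ b by rewrite powR_gt0.
rewrite /barrier_majorant !indicE; have [zt|tz] := ltP (N z) t.
  rewrite mem_set// memNset ?out_eballE/=; last by rewrite leNgt zt.
  rewrite memNset; last by move=> [tn _]; move: zt; rewrite ltNge (le_trans tn).
  rewrite mulr1n mul1r mulr0n mul0r !mulr0 !addr0 dotC dotZr dotC.
  have wt : dot n (rowt z) <= t by rewrite (le_trans nz)// ltW.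
  have := @powR_sub_tangent _ b t _ _ t0 wt; rewrite b0 b1 => /(_ erefl).
  have := powR_ge0 (t - dot n (rowt z)) b.
  rewrite /barrier; case: ifPn => [xzr|_]; last by lra.
  have : (r - enorm (x + rowt z) + e) `^ b <= (t - dot n (rowt z)) `^ b.
    by apply: ge0_ler_powR; rewrite ?nnegrE ?(ltW b0)// /t; lra.
  by clear - s01 s0; lra.
rewrite memNset; last by rewrite /= ltNge tz.
rewrite mulr0n mul0r add0r mem_set ?out_eballE//= mulr1n mul1r.
have G0 : 0 <= 2 * b / s * 2 `^ s * t `^ (b - s) * N z `^ s.
  by rewrite !mulr_ge0 ?powR_ge0 ?invr_ge0 ?(ltW b0) ?(ltW s0).
case: (boolP (z \in _)) => [|_].
  rewrite inE /cone/= => -[tn _]; rewrite mulr1n mulr1 /barrier.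
  by case: ifPn => [|_]; [move: tn nPz e0; rewrite /t; clear - s01 s0; lra|move: G0;
    clear; lra].
rewrite mulr0n mulr0 addr0.
rewrite /barrier; case: ifPn => [xzr|_]; last by lra.
apply: le_trans (powR_add_sub_le s0 b0 bs t0 tz); rewrite lerD2r.
have := ler_enormB x (x + rowt z) 0.
rewrite !subr0 opprD addrA subrr sub0r enormN => h.
by apply: ge0_ler_powR; rewrite ?nnegrE ?(ltW b0)// /t; lra.
Qed.

(** The linear term integrates to 0; the long jumps give at most b A t^(b-2s) and the cone at most
    -c0 t^(b-2s). The choice of [b] makes the first at most half of the second, and t^(b-2s) >= 1
    because t < 1 and b <= 2s. *)
Lemma nu_integral_barrier_majorant : (0 < d)%N ->
  exists b c : R, [/\ 0 < b < 1, 2 * b <= s, 0 < c &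
  forall (e t : R) (n : X), 0 < e -> e <= t -> 3 * t < 1 -> enorm n = 1 ->
   nu_integrable s e (barrier_majorant b t n) /\ Jnu s e (barrier_majorant b t n) <= - c].
Proof.
move=> d0.
have [c0 c00 cP] := nu_integral_cone s01 d0.
have [Ks Ks0 KP] := @nu_integral_enorm_powR R d s s s0.
pose A := 2 / s * 2 `^ s * Ks.
have A0 : 0 < A by rewrite !mulr_gt0 ?invr_gt0 ?powR_gt0.
pose b := Num.min (s / 2) (c0 / (2 * A)).
have b0 : 0 < b by rewrite lt_min; apply/andP; split; apply: divr_gt0 => //;
  exact: mulr_gt0.
have bs : b <= s / 2 by rewrite ge_min lexx.
have bA : b * A <= c0 / 2.
  rewrite -ler_pdivlMr// (_ : c0 / 2 / A = c0 / (2 * A));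
    first by rewrite ge_min lexx orbT.
  by field; rewrite gt_eqF.
have s1 : s < 1 by case/andP: s01.
exists b, (c0 / 2); split; [by apply/andP; split; lra|lra|lra|].
move=> e t n e0 et t1 n1; have t0 := lt_le_trans e0 et.
have [mE cE] := cP e t n e0 et t1 n1.
have aE : nu_integrable s e (\1_(cone t n)).
  apply: (@nu_integrable_bounded _ _ _ s01 e _ 1) => //.
  by move=> z _; rewrite indicE; case: (_ \in _); rewrite ?normr1 ?normr0.
have [a1 J1] := @nu_integral_near_dot R d s s01 e t (- (b * t `^ (b - 1)) *: n) e0.
have mo := measurable_out_eball (d := d) t.
have mN : measurable_fun setT (fun z : T => N z `^ s) by exact: measurable_enorm_powR.
have [a2 _] := KP e e0; have [a2' J2] := KP t t0.
have s2s : 2 * s - s = s by ring.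
rewrite !s2s in a2 a2' J2.
have a3 := nu_integrable_indicM mo mN a2.
have J3 : Jnu s e (fun z => \1_(out_eball t) z * N z `^ s) = Jnu s t (fun z => N z `^ s).
  exact: nu_integral_far.
rewrite /barrier_majorant; split.
  by apply: nu_integrableD; [apply: nu_integrableD => //;
    exact: nu_integrableZ|exact: nu_integrableZ].
rewrite nu_integralD; [|by apply: nu_integrableD => //;
  exact: nu_integrableZ|exact: nu_integrableZ].
rewrite nu_integralD//; last exact: nu_integrableZ.
rewrite J1 add0r !nu_integralZ// J3.
have G0 : 0 <= 2 * b / s * 2 `^ s * t `^ (b - s).
  by rewrite !mulr_ge0 ?powR_ge0 ?invr_ge0 ?(ltW b0) ?(ltW s0).
have H1 := ler_wpM2l G0 J2.
have H2 := ler_wpM2l (powR_ge0 t b) cE.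
have tE : t `^ (b - s) * t `^ (- s) = t `^ (b - 2 * s).
  rewrite -powRD; first by congr powR; ring.
  by rewrite (gt_eqF t0) implybT.
have tE' : t `^ b * t `^ (- (2 * s)) = t `^ (b - 2 * s).
  by rewrite -powRD//; rewrite (gt_eqF t0) implybT.
rewrite -/(cone t n) in H2.
have {}H1 : 2 * b / s * 2 `^ s * t `^ (b - s) * Jnu s t (fun z => N z `^ s)
    <= c0 / 2 * t `^ (b - 2 * s).
  apply: le_trans H1 _; rewrite -tE.
  rewrite [leLHS](_ : _ = (b * A) * (t `^ (b - s) * t `^ (- s))); last by rewrite /A;
    ring.
  by rewrite ler_wpM2r// mulr_ge0 ?powR_ge0.
have {}H2 : c0 * t `^ (b - 2 * s) <= t `^ b * Jnu s e (\1_(cone t n)).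
  by apply: le_trans H2; rewrite -tE' mulrCA.
have H3 : 1 <= t `^ (b - 2 * s).
  apply: powR_ge1_le1; last by move: bs s0; clear - s01 s0; lra.
  by move: t0 t1; clear - s01 s0; lra.
have c02 : 0 <= c0 / 2 by rewrite divr_ge0// ltW.
have H4 := ler_wpM2l c02 H3.
by rewrite mulNr; move: H1 H2 H4; clear - s01 s0; lra.
Qed.

End barrier.

(** * Uniform estimates *)

Section uniform_estimates.
Context {R : realType} {d : nat}.
Variable s : R.
Hypothesis s01 : 0 < s < 1.
Hypothesis d0 : (0 < d)%N.
Local Notation T := (d.-tuple (measurableTypeR R)).
Local Notation N := (fun t : T => enorm (rowt t)).
Local Notation X := 'rV[R]_d.
Local Notation Jnu := (@nu_integral R d).

Lemma exists_direction (x : X) : exists n : X, enorm n = 1 /\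
  forall z, enorm x + dot n z <= enorm (x + z).
Proof.
have [->|x0] := eqVneq x 0.
  exists (delta_mx 0 (Ordinal d0)); have n1 : enorm (delta_mx 0 (Ordinal d0) : X) = 1.
    rewrite /enorm (bigD1 (Ordinal d0))//= big1 ?mxE ?eqxx ?expr1n ?addr0 ?sqrtr1//.
    by move=> i /negbTE iN; rewrite mxE iN andbF expr0n.
  by split=> // z; rewrite enorm0 !add0r (le_trans (dot_le _ _))// n1 mul1r.
have nx : 0 < enorm x.
  by rewrite lt_def enorm_ge0 andbT; apply: contra_neq x0; exact: enorm_eq0.
pose n := (enorm x)^-1 *: x.
have n1 : enorm n = 1 by rewrite enormZ ger0_norm ?invr_ge0 ?enorm_ge0// mulVf// gt_eqF.
exists n; split=> // z.
have -> : enorm x = dot n x.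
  by rewrite dotC dotZr -sqr_enorm expr2 mulKf// gt_eqF.
by rewrite -dotDr (le_trans (dot_le _ _))// n1 mul1r.
Qed.

Lemma sqr_enormD (x z : X) :
  enorm (x + z) ^+ 2 = enorm x ^+ 2 + 2 * dot x z + enorm z ^+ 2.
Proof. by rewrite !sqr_enorm dotDr dotC dotDr [dot (x + z) z]dotC dotDr (dotC z x);
  ring. Qed.

(** For each x0 the function [W] lies above [u] off the ball and is a strict supersolution in it;
    the bound follows by comparing [u] with [W] and evaluating at x0. *)
Lemma boundary_upper (C M F L tau : R) : 0 < C -> 0 <= M -> 0 <= F -> 0 < tau ->
  exists A b : R, [/\ 0 <= A, 0 < b & forall e r g phi u,
   0 < e -> e <= 8^-1 -> 0 < r -> r <= 8^-1 ->
   (forall x y, eball 0 r x -> `|y| <= M -> `|g x y| <= F) ->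
   (forall x : X, `|phi x| <= M) ->
   (forall x y : X, `|phi x - phi y| <= L * enorm (x - y)) ->
   eps_solution s C e r M g phi u ->
   forall x, eball 0 r x -> u x <= phi x + (tau + A * (r - enorm x + e) `^ b)].
Proof.
move=> C0 M0 F0 tau0.
have [b [c [/andP[b0 b1] bs c0 JP]]] := nu_integral_barrier_majorant s01 d0.
have [K2 K20 K2P] := @nu_integral_near_sqr R d s s01.
(* The smallest [k] with L a <= tau + k a^2 for all a, so that [W] dominates [phi] outside the
   ball. *)
pose k := L ^+ 2 / (4 * tau).
have k0 : 0 <= k by rewrite divr_ge0 ?sqr_ge0// mulr_ge0// ltW.
pose nu1 := Jnu s 1 (fun=> 1).
have nu10 : 0 <= nu1 by exact: nu_integral_ge0.
(* The loss A c of the barrier pays for the quadratic term on |z| < 1, for the jumps of length at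
   least 1 and for the nonlinearity, and C A c leaves 1 over. *)
pose A := (k * K2 + 2 * M * nu1 + (F + 1) / C) / c.
have A0 : 0 <= A.
  have h1 : 0 <= k * K2 by rewrite mulr_ge0// ltW.
  have h2 : 0 <= 2 * M * nu1 by rewrite !mulr_ge0.
  have h3 : 0 <= (F + 1) / C by rewrite divr_ge0 ?addr_ge0// ltW.
  by rewrite divr_ge0 ?(ltW c0)// !addr_ge0.
exists A, b; split=> // e r g phi u e0 e8 r0 r8 gF phiM phiL usol x0 Bx0.
have [uM uphi usub _ _] := usol.
pose W y := phi x0 + tau + k * enorm (y - x0) ^+ 2 + A * barrier r e b y.
have barrier0 (y : X) : 0 <= barrier r e b y.
  by rewrite /barrier; case: ifP => // _; exact: powR_ge0.
have W_out y : ~ eball 0 r y -> u y <= W y.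
  move=> nBy; rewrite uphi// /W.
  have h1 := phiL y x0; have := ler_norm (phi y - phi x0).
  have h2 : 0 <= A * barrier r e b y by rewrite mulr_ge0.
  have : L * enorm (y - x0) <= tau + k * enorm (y - x0) ^+ 2.
    rewrite -subr_ge0 /k; set a := enorm _.
    rewrite (_ : _ - _ = (2 * tau - L * a) ^+ 2 / (4 * tau)).
      by rewrite divr_ge0 ?sqr_ge0// mulr_ge0// ltW.
    by field; rewrite gt_eqF.
  by move: h1; lra.
suff main x : eball 0 r x -> u x <= W x.
  have := main x0 Bx0; rewrite /W subrr enorm0 expr0n mulr0 addr0 /barrier.
  by move: Bx0; rewrite /eball/= subr0 => ->; rewrite addrA.
pose D := [set u x - W x | x in eball 0 r].
have hsD : has_sup D.
  split; first by exists (u x0 - W x0), x0.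
  exists (2 * M) => _ [y By <-].
  have := uM y; have := phiM x0; rewrite !ler_norml => /andP[p1 _] /andP[_ u2].
  have := mulr_ge0 k0 (sqr_ge0 (enorm (y - x0))).
  by have := mulr_ge0 A0 (barrier0 y); rewrite /W; lra.
pose m := sup D.
have le_m y : eball 0 r y -> u y - W y <= m.
  by move=> By; apply: ub_le_sup; [exact: hsD.2|exists y].
move=> Bx; rewrite -subr_le0 (le_trans (le_m _ Bx))// leNgt; apply/negP => m0 {x Bx}.
pose lam := Jnu s e (fun=> 1).
have lam0 : 0 <= lam by exact: nu_integral_ge0.
have Cl0 : 0 < C * lam + 1 by rewrite ltr_wpDl// mulr_ge0// ltW.
(* A uniform gap below the supremum [m] is absurd. The assumption m > 0 makes [m] dominate u - W
   also outside the ball. *)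
suff gap x : eball 0 r x -> u x - W x <= m - (C * lam + 1)^-1.
  have : m <= m - (C * lam + 1)^-1.
    by apply: ge_sup; [exact: hsD.1|move=> _ [x Bx <-]; exact: gap].
  by rewrite -subr_ge0 addrAC subrr sub0r oppr_ge0 leNgt invr_gt0 Cl0.
move=> Bx; have xr : enorm x < r by move: Bx; rewrite /eball/= subr0.
have [n [n1 nP]] := exists_direction x.
pose v := u x - W x; pose t := r - enorm x + e.
have vm : v <= m by exact: le_m.
have et : e <= t by rewrite /t; lra.
(* The bounds 1/8 on [r] and [e] serve here: the cone estimate requires 3t < 1. *)
have t4 : t <= 4^-1 by rewrite /t; have := enorm_ge0 x; lra.
have t3 : 3 * t < 1 by lra.
have [aB JB] := JP e t n e0 et t3 n1.
have [aQ JQ] := K2P e 1 e0 ltr01.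
have [aD JDt] := @nu_integral_near_dot R d s s01 e 1 (2 * k *: (x - x0)) e0.
have mo1 := measurable_out_eball (d := d) (1 : R).
have e1 : e <= 1 by move: e8; clear - s01 d0; lra.
have aO : nu_integrable s e (fun z : T => \1_(out_eball 1) z * 1).
  by apply: nu_integrable_indicM => //; exact: nu_integrable1.
have aC : nu_integrable s e (fun _ : T => m - v) by exact: nu_integrable_cst.
pose h (z : T) := \1_[set z | N z < 1] z * dot (2 * k *: (x - x0)) (rowt z)
  + k * (\1_[set z | N z < 1] z * N z ^+ 2) + A * barrier_majorant s b t n z
  + 2 * M * (\1_(out_eball 1) z * 1) + (m - v).
have ah1 := nu_integrableD aD (nu_integrableZ k aQ).
have ah2 := nu_integrableD ah1 (nu_integrableZ A aB).
have ah3 := nu_integrableD ah2 (nu_integrableZ (2 * M) aO).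
have ah : nu_integrable s e h by exact: nu_integrableD.
have Jh : Jnu s e h <= k * K2 - A * c + 2 * M * nu1 + (m - v) * lam.
  rewrite /h (nu_integralD ah3 aC) (nu_integralD ah2 (nu_integrableZ (2 * M) aO))
    (nu_integralD ah1 (nu_integrableZ A aB)).
  rewrite (nu_integralD aD (nu_integrableZ k aQ)) JDt add0r !nu_integralZ//
    nu_integral_far// (nu_integral_cst s01 _ e0) -/lam -/nu1.
  have := ler_wpM2l k0 JQ; rewrite powR1 mulr1.
  by have := ler_wpM2l A0 JB; rewrite mulrN; clear - s01 d0; lra.
have uh z : e <= N z -> u (x + rowt z) - u x <= h z.
  move=> ez; rewrite /h !indicE; have [z1|z1] := ltP (N z) 1.
    rewrite mem_set// memNset ?out_eballE/=; last by rewrite leNgt z1.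
    rewrite mulr1n !mul1r mulr0n mul0r mulr0 addr0.
    have BP := barrier_majorantP s01 e0 b0 b1 bs xr n1 nP z1.
    have {BP} : A * (barrier r e b (x + rowt z) - barrier r e b x)
      <= A * barrier_majorant s b t n z by rewrite ler_wpM2l.
    have : u (x + rowt z) - W (x + rowt z) <= m.
      have [Bxz|nB] := pselect (eball 0 r (x + rowt z)); first exact: le_m.
      by have := W_out _ nB; move: m0; clear - s01 d0; lra.
    rewrite dotC dotZr dotC.
    have := sqr_enormD (x - x0) (rowt z); rewrite addrAC => E.
    rewrite /v /W E; clear - s01 d0; lra.
  rewrite memNset/= ?ltNge ?z1// mem_set ?out_eballE//=.
  rewrite mulr1n mulr0n !mul0r mulr0 !add0r !mulr1.
  have : 0 <= barrier_majorant s b t n z.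
    rewrite /barrier_majorant !indicE memNset/=; last first.
      by apply/negP; rewrite -leNgt; move: t4 z1; clear - s01 d0; lra.
    have -> : (z \in cone t n) = false by apply: memNset => -[_]; rewrite ltNge z1.
    rewrite mulr0n mul0r mulr0 addr0 add0r.
    have s0 : 0 < s by case/andP: s01.
    by rewrite !mulr_ge0 ?powR_ge0 ?invr_ge0 ?(ltW b0) ?(ltW s0).
  move=> /(mulr_ge0 A0).
  have := uM x; have := uM (x + rowt z); rewrite !ler_norml; move: vm;
    clear - s01 d0; lra.
have := usub x h Bx ah uh.
have : g x (u x) <= F by rewrite (le_trans (ler_norm _))// gF.
have := ler_wpM2l (ltW C0) Jh.
have Ac : A * c = k * K2 + 2 * M * nu1 + (F + 1) / C.
  by rewrite /A divfK// gt_eqF.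
rewrite Ac.
have -> : C * (k * K2 - (k * K2 + 2 * M * nu1 + (F + 1) / C) + 2 * M * nu1
  + (m - v) * lam)
  = C * lam * (m - v) - (F + 1) by field; rewrite gt_eqF.
move=> h1 h2 h3.
have : 1 <= (m - v) * (C * lam + 1).
  by rewrite mulrDr mulr1; move: h1 h2 h3 vm; clear - s01 d0; lra.
by rewrite -ler_pdivrMr// div1r -/v; clear - s01 d0; lra.
Qed.

Lemma boundary_estimate (C M F L tau : R) : 0 < C -> 0 <= M -> 0 <= F -> 0 < tau ->
  exists A b : R, [/\ 0 <= A, 0 < b & forall e r g phi u,
   0 < e -> e <= 8^-1 -> 0 < r -> r <= 8^-1 ->
   (forall x y, eball 0 r x -> `|y| <= M -> `|g x y| <= F) ->
   (forall x : X, `|phi x| <= M) ->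
   (forall x y : X, `|phi x - phi y| <= L * enorm (x - y)) ->
   eps_solution s C e r M g phi u ->
   forall x, eball 0 r x -> `|u x - phi x| <= tau + A * (r - enorm x + e) `^ b].
Proof.
move=> C0 M0 F0 tau0; have [A [b [A0 b0 AP]]] := boundary_upper L C0 M0 F0 tau0.
exists A, b; split=> // e r g phi u e0 e8 r0 r8 gF phiM phiL usol x Bx.
have := AP e r g phi u e0 e8 r0 r8 gF phiM phiL usol x Bx.
have := AP e r (opp_nonlin g) (fun x => - phi x) (fun x => - u x) e0 e8 r0 r8.
move=> /(_ _ _ _ (eps_solutionN usol) x Bx) H; rewrite ler_norml => h.
suff : - u x <= - phi x + (tau + A * (r - enorm x + e) `^ b).
  by move=> h'; apply/andP; split; lra.
apply: H.
- by move=> y z By zM; rewrite /opp_nonlin normrN gF// normrN.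
- by move=> y; rewrite normrN.
- by move=> y z; rewrite -opprD normrN phiL.
Qed.

(** Let [S] be the supremum of |u x - u y| over all pairs at distance at most [delta]. A jump of
    length at least 2r takes both points out of the ball, where the difference is at most [b]
    instead of [S]: the gain C kappa (S - b) outweighs the Lipschitz term K S, with at least S - C
    kappa b left. *)
Lemma translation_estimate (C K w b delta M e r : R) (g : X -> R -> R) (phi u : X -> R) :
  0 < C -> 0 < e -> e <= 2 * r -> 0 <= K -> 0 <= w -> 0 <= b ->
  K + 1 <= C * Jnu s (2 * r) (fun=> 1) ->
  (forall x y y', eball 0 r x -> `|y| <= M -> `|y'| <= M ->
    `|g x y - g x y'| <= K * `|y - y'|) ->
  (forall x x' y, eball 0 r x -> eball 0 r x' -> enorm (x - x') <= delta ->
    `|y| <= M -> `|g x y - g x' y| <= w) ->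
  eps_solution s C e r M g phi u ->
  (forall x y, ~ (eball 0 r x /\ eball 0 r y) -> enorm (x - y) <= delta ->
    `|u x - u y| <= b) ->
  forall x y, enorm (x - y) <= delta ->
    `|u x - u y| <= w + C * Jnu s (2 * r) (fun=> 1) * b.
Proof.
move=> C0 e0 er K0 w0 b0 CK gK gw usol bP.
have [uM _ _ _ utwo] := usol.
set kappa := Jnu s (2 * r) _ in CK *.
pose D := [set `|u p.1 - u p.2| | p in [set p : X * X | enorm (p.1 - p.2) <= delta]].
have hub : has_ubound D.
  exists (2 * M) => _ [[x y] _ <-] /=; rewrite (le_trans (ler_normB _ _))//.
  by have := uM x; have := uM y; lra.
move=> x0 y0 xy0.
pose S := sup D.
have le_S x y : enorm (x - y) <= delta -> `|u x - u y| <= S.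
  by move=> xy; apply: ub_le_sup => //; exists (x, y).
rewrite (le_trans (le_S _ _ xy0))// leNgt; apply/negP => SP.
pose lam := Jnu s e (fun=> 1).
have lam0 : 0 <= lam by exact: nu_integral_ge0.
have Cl0 : 0 < C * lam + 1 by rewrite ltr_wpDl// mulr_ge0// ltW.
(* The excess to be refuted; it lowers every difference below [S] by q / (C lam + 1). *)
pose q := S - C * kappa * b - w.
have q0 : 0 < q by rewrite /q; lra.
have Ck1 : 1 <= C * kappa by lra.
have bk : b <= C * kappa * b by rewrite ler_peMl.
have S0 : 0 <= S by lra.
have qC : q / (C * lam + 1) <= q.
  by rewrite ler_pdivrMr// ler_peMr ?(ltW q0)// lerDr mulr_ge0// ltW.
suff gap x y : enorm (x - y) <= delta -> u y - u x <= S - q / (C * lam + 1).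
  have : S <= S - q / (C * lam + 1).
    apply: ge_sup; first by exists `|u x0 - u y0|, (x0, y0).
    move=> _ [[x y] /= xy <-]; rewrite ler_norml; apply/andP; split.
      by have := gap x y xy; lra.
    by rewrite gap// enormBC.
  have : 0 < q / (C * lam + 1) by rewrite divr_gt0.
  lra.
move=> xy.
have [[Bx By]|nB] := pselect (eball 0 r x /\ eball 0 r y); last first.
  have := bP x y nB xy; rewrite ler_norml => /andP[]; rewrite /q in qC *; lra.
pose v := u y - u x.
have afar : nu_integrable s e (fun z : T => \1_(out_eball (2 * r)) z * 1).
  apply: nu_integrable_indicM => //; first exact: measurable_out_eball.
  exact: nu_integrable1.
have ac : nu_integrable s e (fun _ : T => S - v) by exact: nu_integrable_cst.
pose h (z : T) := (S - v) + (b - S) * (\1_(out_eball (2 * r)) z * 1).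
have ah : nu_integrable s e h by apply: nu_integrableD => //; exact: nu_integrableZ.
have Jh : Jnu s e h = (S - v) * lam + (b - S) * kappa.
  rewrite /h nu_integralD//; last exact: nu_integrableZ.
  by rewrite nu_integral_cst// nu_integralZ// nu_integral_far.
have xyz z : enorm ((y + rowt z) - (x + rowt z)) <= delta.
  by rewrite opprD addrACA subrr addr0 enormBC.
have uh z : e <= N z -> u (y + rowt z) - u y <= u (x + rowt z) - u x + h z.
  move=> ez; rewrite /h indicE mulr1.
  case: (boolP (z \in _)) => [|_]; rewrite ?mulr1n ?mulr0n.
    rewrite inE out_eballE => /= rz.
    have := bP (y + rowt z) (x + rowt z) _ (xyz z).
    have nB : ~ (eball 0 r (y + rowt z) /\ eball 0 r (x + rowt z)).
      by move=> [h1 _]; exact: eball_far By rz h1.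
    by move=> /(_ nB); rewrite ler_norml /v; clear - s01 d0; lra.
  have := le_S (y + rowt z) (x + rowt z) (xyz z).
  by rewrite ler_norml /v; clear - s01 d0; lra.
have := utwo x y h Bx By ah uh; rewrite Jh.
have g1 := gK y (u x) (u y) By (uM x) (uM y).
have g2 := gw x y (u x) Bx By xy (uM x).
have uS : K * `|u x - u y| <= K * S by rewrite ler_wpM2l// le_S.
move: g1 g2; rewrite !ler_norml => /andP[g11 g12] /andP[g21 g22] H.
have KS : (K + 1) * S <= C * kappa * S by rewrite ler_wpM2r.
have : q <= (S - v) * (C * lam + 1).
  have : 0 <= S - v by have := le_S x y xy; rewrite ler_norml /v; clear - s01 d0; lra.
  by rewrite /q; move: H KS uS g11 g21; clear - s01 d0; lra.
by rewrite -ler_pdivrMr// -/v; clear - s01 d0; lra.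
Qed.

Lemma equicontinuity (C M F L K r : R) (g : X -> R -> R) (phi : X -> R) :
  0 < C -> 0 <= M -> 0 <= F -> 0 <= L -> 0 <= K -> 0 < r -> r <= 8^-1 ->
  K + 1 <= C * Jnu s (2 * r) (fun=> 1) ->
  (forall x y, eball 0 r x -> `|y| <= M -> `|g x y| <= F) ->
  (forall x y y', eball 0 r x -> `|y| <= M -> `|y'| <= M ->
    `|g x y - g x y'| <= K * `|y - y'|) ->
  (forall w, 0 < w -> exists2 delta, 0 < delta & forall x x' y,
    eball 0 r x -> eball 0 r x' -> enorm (x - x') <= delta ->
    `|y| <= M -> `|g x y - g x' y| <= w) ->
  (forall x : X, `|phi x| <= M) ->
  (forall x y : X, `|phi x - phi y| <= L * enorm (x - y)) ->
  forall tau, 0 < tau -> exists2 delta, 0 < delta & forall e u,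
    0 < e -> e <= delta -> eps_solution s C e r M g phi u ->
    forall x y, enorm (x - y) <= delta -> `|u x - u y| <= tau.
Proof.
move=> C0 M0 F0 L0 K0 r0 r8 CK gF gK gw phiM phiL tau tau0.
set kappa := Jnu s (2 * r) _ in CK *.
have Ck0 : 0 < C * kappa by lra.
(* The boundary error 3 sg is multiplied by C kappa, which gives 3/4 tau; the modulus of [g] takes
   the remaining tau/4. *)
pose sg := tau / (4 * (C * kappa)).
have sg0 : 0 < sg by rewrite divr_gt0// mulr_gt0.
have [A [b [A0 b0 AP]]] := boundary_estimate L C0 M0 F0 sg0.
have t40 : 0 < tau / 4 by rewrite divr_gt0.
have [d1 d10 d1P] := gw _ t40.
have A10 : 0 < A + 1 by rewrite ltr_wpDl.
have L10 : 0 < L + 1 by rewrite ltr_wpDl.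
(* Within shifted distance [rho] of the sphere the barrier term A rho^b is at most [sg]. Both
   [delta] and [e] will be at most rho/2. *)
pose rho := (sg / (A + 1)) `^ b^-1.
have sA : 0 < sg / (A + 1) by rewrite divr_gt0.
have rho0 : 0 < rho by rewrite powR_gt0.
pose d2 := Num.min (rho / 2) (Num.min (sg / (L + 1)) 8^-1).
pose delta := Num.min (Num.min d1 (2 * r)) d2.
have delta0 : 0 < delta.
  have h1 : 0 < 2 * r by lra.
  have h2 : 0 < rho / 2 by lra.
  have h3 : 0 < sg / (L + 1) by rewrite divr_gt0.
  have h4 : 0 < 8^-1 :> R by rewrite invr_gt0 ltr0n.
  by rewrite !lt_min d10 h1 h2 h3 h4.
have delta1 : delta <= d1 by rewrite !ge_min lexx.
have delta2 : delta <= 2 * r by rewrite !ge_min lexx orbT.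
have delta3 : delta <= rho / 2 by rewrite !ge_min lexx !orbT.
have delta4 : delta <= sg / (L + 1) by rewrite !ge_min lexx !orbT.
have delta5 : delta <= 8^-1 by rewrite !ge_min lexx !orbT.
exists delta => // e u e0 ed usol x y xy.
have Ldelta : L * delta <= sg.
  apply: (@le_trans _ _ ((L + 1) * delta));
    first by rewrite ler_wpM2r ?(ltW delta0)// lerDl.
  by rewrite mulrC -ler_pdivlMr.
have phid p q : enorm (p - q) <= delta -> `|phi p - phi q| <= sg.
  move=> pq; rewrite (le_trans (phiL _ _))// (le_trans _ Ldelta)//.
  by rewrite ler_wpM2l.
have uphid p q : eball 0 r p -> ~ eball 0 r q -> enorm (p - q) <= delta ->
    `|u p - phi p| <= 2 * sg.
  move=> Bp nBq pq; rewrite (le_trans (AP e r g phi u e0 _ r0 r8 gF phiM phiL usol p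
    Bp))//.
    exact: le_trans delta5.
  have pr : enorm p < r by move: Bp; rewrite /eball/= subr0.
  have qr : r <= enorm q by move/negP: nBq; rewrite /eball/= subr0 -leNgt.
  have : r - enorm p <= delta.
    by have := ler_enormB q p 0; rewrite !subr0 (enormBC q p); move: qr pq;
      clear - s01 d0; lra.
  move=> rp.
  have : (r - enorm p + e) `^ b <= sg / (A + 1).
    apply: (@le_trans _ _ (rho `^ b)).
      apply: ge0_ler_powR; rewrite ?nnegrE ?(ltW b0)//;
        by move: rp ed delta3 pr e0 rho0; clear - s01 d0; lra.
    by rewrite /rho -powRrM mulVf ?gt_eqF// powRr1// ltW.
  move=> /(ler_wpM2l A0).
  have : A * (sg / (A + 1)) <= sg.
    by rewrite mulrA ler_pdivrMr// mulrC ler_wpM2l ?(ltW sg0)// lerDl.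
  by clear - s01 d0; lra.
(* If one point is outside, 2 sg bounds |u - phi| at the other and sg the oscillation of [phi]. *)
have bP p q : ~ (eball 0 r p /\ eball 0 r q) -> enorm (p - q) <= delta ->
    `|u p - u q| <= 3 * sg.
  move=> nB pq; have := phid p q pq.
  have [Bp|nBp] := pselect (eball 0 r p); have [Bq|nBq] := pselect (eball 0 r q).
  - by case: nB.
  - rewrite (eps_exterior usol nBq) => h; have := uphid p q Bp nBq pq => h'.
    rewrite -(subrK (phi p) (u p)) -addrA (le_trans (ler_normD _ _))//.
    by move: h h'; clear - s01 d0; lra.
  - rewrite (eps_exterior usol nBp) => h; rewrite enormBC in pq.
    have := uphid q p Bq nBp pq => h'.
    rewrite (_ : phi p - u q = (phi p - phi q) - (u q - phi q)); last by ring.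
    by rewrite (le_trans (ler_normB _ _))//; move: h h'; clear - s01 d0; lra.
  - rewrite (eps_exterior usol nBp) (eps_exterior usol nBq).
    by move: sg0; clear - s01 d0; lra.
have er : e <= 2 * r by exact: le_trans delta2.
have sg30 : 0 <= 3 * sg by rewrite mulr_ge0// ltW.
have gw' : forall x x' y, eball 0 r x -> eball 0 r x' -> enorm (x - x') <= delta ->
    `|y| <= M -> `|g x y - g x' y| <= tau / 4.
  by move=> p p' z Bp Bp' pp' zM; apply: d1P => //; exact: le_trans pp' delta1.
have := @translation_estimate C K (tau / 4) (3 * sg) delta M e r g phi u C0 e0 er
  K0 (ltW t40) sg30 CK gK gw' usol bP x y xy.
rewrite -/kappa.
have -> : C * kappa * (3 * sg) = 3 / 4 * tau 
  by rewrite /sg; move: (C * kappa) Ck0 => z z0; field; rewrite gt_eqF.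
by clear - s01 d0; lra.
Qed.

End uniform_estimates.

(** * Stability *)

Section near_integrals.
Context {R : realType} {d : nat}.
Variable s : R.
Hypothesis s01 : 0 < s < 1.
Local Notation T := (d.-tuple (measurableTypeR R)).
Local Notation N := (fun t : T => enorm (rowt t)).
Local Notation X := 'rV[R]_d.
Local Notation Jnu := (@nu_integral R d).

Lemma indic_near_far r (h : T -> R) t :
  h t = \1_[set t | N t < r] t * h t + \1_(out_eball r) t * h t.
Proof.
rewrite !indicE out_eballE; have [tr|rt] := ltP (N t) r.
  rewrite mem_set// memNset/=; last by rewrite leNgt tr.
  by rewrite mulr1n mul1r mulr0n mul0r addr0.
rewrite memNset/= ?ltNge ?rt// mem_set//.
by rewrite mulr1n mul1r mulr0n mul0r add0r.
Qed.

Lemma nu_integral_split e r (h : T -> R) : 0 < e -> e <= r ->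
  measurable_fun setT h -> nu_integrable s e h ->
  Jnu s e h = Jnu s e (fun t => \1_[set t | N t < r] t * h t) + Jnu s r h.
Proof.
move=> e0 er mh ah.
have m1 : measurable [set t : T | N t < r] by exact: (measurable_cmp_enorm r).1.
have m2 : measurable (@out_eball R d r) by exact: measurable_out_eball.
rewrite -(nu_integral_far s h er) -nu_integralD;
  [|exact: nu_integrable_indicM|exact: nu_integrable_indicM].
by apply: eq_nu_integral => t _; exact: indic_near_far.
Qed.

(** The linear part [p] is odd, so only the quadratic remainder is seen; the bound involves neither
    [e] nor [p]. *)
Lemma nu_integral_near_le (K2 : R) (p : X) (M e r : R) (h : T -> R) :
  (forall e r, 0 < e -> 0 < r ->
    nu_integrable s e (fun t : T => \1_[set t | N t < r] t * N t ^+ 2) /\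
    Jnu s e (fun t => \1_[set t | N t < r] t * N t ^+ 2) <= K2 * r `^ (2 - 2 * s)) ->
  0 <= M -> 0 < e -> 0 < r -> measurable_fun setT h -> nu_integrable s e h ->
  (forall t, N t < r -> `|h t - dot p (rowt t)| <= M * N t ^+ 2) ->
  `|Jnu s e (fun t => \1_[set t | N t < r] t * h t)| <= M * (K2 * r `^ (2 - 2 * s)).
Proof.
move=> KP M0 e0 r0 mh ah hP.
have m1 : measurable [set t : T | N t < r] by exact: (measurable_cmp_enorm r).1.
have a1 := nu_integrable_indicM m1 mh ah.
have [a2 J2] := KP e r e0 r0.
have [a3 J3] := @nu_integral_near_dot R d s s01 e r p e0.
have MJ := ler_wpM2l M0 J2.
rewrite ler_norml; apply/andP; split.
  have : Jnu s e (fun t => \1_[set t | N t < r] t * dot p (rowt t)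
      + - M * (\1_[set t | N t < r] t * N t ^+ 2)) <=
    Jnu s e (fun t => \1_[set t | N t < r] t * h t).
    apply: le_nu_integral => //; first by apply: nu_integrableD => //;
      exact: nu_integrableZ.
    move=> t _; rewrite !indicE; case: (boolP (t \in _)) => [|_].
      rewrite inE/= => /hP; rewrite mulr1n !mul1r ler_norml => /andP[+ _]; lra.
    by rewrite mulr0n !mul0r mulr0 addr0.
  rewrite nu_integralD//; last exact: nu_integrableZ.
  rewrite J3 nu_integralZ//; lra.
have : Jnu s e (fun t => \1_[set t | N t < r] t * h t) <=
  Jnu s e (fun t => \1_[set t | N t < r] t * dot p (rowt t)
      + M * (\1_[set t | N t < r] t * N t ^+ 2)).
  apply: le_nu_integral => //; first by apply: nu_integrableD => //;
    exact: nu_integrableZ.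
  move=> t _; rewrite !indicE; case: (boolP (t \in _)) => [|_].
    rewrite inE/= => /hP; rewrite mulr1n !mul1r ler_norml => /andP[_]; lra.
  by rewrite mulr0n !mul0r mulr0 addr0.
rewrite nu_integralD//; last exact: nu_integrableZ.
rewrite J3 nu_integralZ//; lra.
Qed.

Lemma powR_small (a A tau : R) : 0 < a -> 0 <= A -> 0 < tau ->
  exists2 r, 0 < r & forall r', 0 < r' -> r' <= r -> A * r' `^ a <= tau.
Proof.
move=> a0 A0 tau0; have A1 : 0 < A + 1 by rewrite ltr_wpDl.
have tA : 0 < tau / (A + 1) by rewrite divr_gt0.
exists ((tau / (A + 1)) `^ a^-1); first by rewrite powR_gt0.
move=> r' r'0 rr'.
have : r' `^ a <= tau / (A + 1).
  apply: (@le_trans _ _ (((tau / (A + 1)) `^ a^-1) `^ a)).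
    by apply: ge0_ler_powR; rewrite ?nnegrE ?powR_ge0 ?(ltW a0) ?(ltW r'0).
  by rewrite -powRrM mulVf ?gt_eqF// powRr1// ltW.
move=> /(ler_wpM2l A0)/le_trans; apply.
by rewrite mulrA ler_pdivrMr// mulrC ler_wpM2l ?(ltW tau0)// lerDl.
Qed.

(** Cauchy criterion: two truncated integrals differ by the integral over an annulus, which is
    O(r^(2-2s)) by Taylor's formula and symmetry. *)
Lemma frac_laplacian_exists_taylor (w : X -> R) (x p : X) (M B rho : R) :
  measurable_fun setT (fun t : T => w (x + rowt t)) ->
  (forall y, `|w y| <= B) -> 0 <= M -> 0 < rho ->
  (forall z, enorm z < rho -> `|w (x + z) - w x - dot p z| <= M * enorm z ^+ 2) ->
  frac_laplacian_exists s w x.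
Proof.
move=> mw wB M0 rho0 wP.
pose h (t : T) := w (x + rowt t) - w x.
have mh : measurable_fun setT h by apply: measurable_funB.
have ah r : 0 < r -> nu_integrable s r h.
  move=> r0; apply: (@nu_integrable_bounded _ _ _ s01 r _ (2 * B)) => // t _.
  rewrite (le_trans (ler_normB _ _))//.
  by have := wB (x + rowt t); have := wB x; lra.
split; first by move=> r r0; exact: ah.
have [K2 K20 KP] := @nu_integral_near_sqr R d s s01.
have a0 : 0 < 2 - 2 * s by case/andP: s01; lra.
have diff r r' : 0 < r' -> r' <= r -> r <= rho ->
    `|Jnu s r' h - Jnu s r h| <= M * K2 * r `^ (2 - 2 * s).
  move=> r'0 r'r rrho; rewrite (nu_integral_split r'0 r'r mh (ah _ r'0)) addrK -mulrA.
  apply: (@nu_integral_near_le K2 p) => //; first exact: lt_le_trans r'r.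
    exact: ah.
  by move=> t tr; apply: wP; exact: lt_le_trans rrho.
apply: (@cauchy_cvg _ (frac_truncated s w x r @[r --> 0^'+])).
apply: cauchy_exP => e e0.
have e20 : 0 < e / 2 by rewrite divr_gt0.
have MK : 0 <= M * K2 by rewrite mulr_ge0// ltW.
have [r1 r10 r1P] := powR_small a0 MK e20.
pose r := Num.min r1 rho.
have r0 : 0 < r by rewrite lt_min r10 rho0.
have rr1 : r <= r1 by rewrite ge_min lexx.
have rrho : r <= rho by rewrite ge_min lexx orbT.
exists (Jnu s r h).
suff : \forall r' \near 0^'+, ball (Jnu s r h) e (frac_truncated s w x r') by [].
near=> r'.
have r'0 : 0 < r' by near: r'; exact: nbhs_right_gt.
have r'r : r' <= r by near: r'; exact: nbhs_right_le.
rewrite -ball_normE/= distrC.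
have := diff r r' r'0 r'r rrho; have := r1P r r0 rr1;
  rewrite /frac_truncated /h /nu_integral /frac_integrand /weight.
lra.
Unshelve. all: by end_near. Qed.

End near_integrals.

Section stability.
Context {R : realType} {d : nat}.
Variable s : R.
Hypothesis s01 : 0 < s < 1.
Local Notation T := (d.-tuple (measurableTypeR R)).
Local Notation N := (fun t : T => enorm (rowt t)).
Local Notation X := 'rV[R]_d.
Local Notation Jnu := (@nu_integral R d).

(* Besides the integral over the ball of radius rho', everything passes to the
   limit; the former is kept as the error term in rho'. *)
Lemma limit_subsolution (C r M K K2 : R) (g : X -> R -> R) (phi u : X -> R)
   (F : set_system R) (u_ : R -> X -> R) (U : set X) (xi : X -> R) (x0 : X)
   (rho M2 : R) (D : X -> X) :
  0 < C -> 0 <= K ->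
  (forall e r, 0 < e -> 0 < r ->
    nu_integrable s e (fun t : T => \1_[set t | N t < r] t * N t ^+ 2) /\
    Jnu s e (fun t => \1_[set t | N t < r] t * N t ^+ 2) <= K2 * r `^ (2 - 2 * s)) ->
  (forall x y y', eball 0 r x -> `|y| <= M -> `|y'| <= M ->
    `|g x y - g x y'| <= K * `|y - y'|) ->
  (forall w, 0 < w -> exists2 delta, 0 < delta & forall x x' y,
    eball 0 r x -> eball 0 r x' -> enorm (x - x') <= delta ->
    `|y| <= M -> `|g x y - g x' y| <= w) ->
  ProperFilter F -> (forall delta, 0 < delta -> F [set e | 0 < e <= delta]) ->
  (\forall e \near F, eps_solution s C e r M g phi (u_ e)) ->
  (forall tau, 0 < tau -> \forall e \near F, forall x, `|u_ e x - u x| <= tau) ->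
  continuous u ->
  (forall tau, 0 < tau -> exists2 delta, 0 < delta & forall x y,
     enorm (x - y) <= delta -> `|u x - u y| <= tau) ->
  (forall x, `|u x| <= M) ->
  U `<=` eball 0 r -> 0 < rho -> 0 <= M2 -> eball x0 (rho + rho) `<=` U ->
  (forall x z, enorm (x - x0) < rho -> enorm z < rho ->
    `|xi (x + z) - xi x - dot (D x) z| <= M2 * enorm z ^+ 2) ->
  xi x0 = u x0 -> (forall x, U x -> u x <= xi x) ->
  forall rho', 0 < rho' -> rho' < rho ->
    0 <= C * ((M2 + 1) * (K2 * rho' `^ (2 - 2 * s)) +
              Jnu s rho' (fun t => u (x0 + rowt t) - u x0)) + g x0 (u x0).
Proof.
move=> C0 K0 KP gK gw PF F0 usol ucvg ucont uunif uM Ur rho0 M20 rhoU xiP xi0 uxi rho'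
  rho'0 rho'rho.
set base := (X in 0 <= X).
pose lam' := Jnu s rho' (fun=> 1).
have lam'0 : 0 <= lam' by exact: nu_integral_ge0.
have x0B : eball x0 (rho + rho) x0 by rewrite /eball/= subrr enorm0 addr_gt0.
have Bx0 : eball 0 r x0 by apply/Ur/rhoU.
(* Total coefficient of the errors: C (4 lam' + 1) from the integral, 1 + 2K from [g]. It involves
   [rho'] but not [e], so one [e] per [tau] is enough. *)
pose Q := C * (1 + 4 * lam') + 1 + 2 * K.
have Q0 : 0 <= Q by rewrite !addr_ge0// ?mulr_ge0 ?(ltW C0)// addr_ge0// mulr_ge0.
suff key tau : 0 < tau -> 0 <= base + Q * tau.
  rewrite leNgt; apply/negP => base0.
  have Q1 : 0 < Q + 1 by rewrite ltr_wpDl.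
  have t0 : 0 < - base / (Q + 1) by rewrite divr_gt0// oppr_gt0.
  have := key _ t0; rewrite leNgt => /negP; apply.
  have : - base / (Q + 1) * (Q + 1) = - base by rewrite divfK// gt_eqF.
  by move: t0; set z := _ / _ => t0; lra.
move=> tau0.
have [d1 d10 d1P] := uunif _ tau0.
have [d2 d20 d2P] := gw _ tau0.
pose eta := Num.min (Num.min d1 d2) rho.
have eta0 : 0 < eta by rewrite !lt_min d10 d20 rho0.
have eta1 : eta <= d1 by rewrite !ge_min lexx.
have eta2 : eta <= d2 by rewrite !ge_min lexx orbT.
have eta3 : eta <= rho by rewrite !ge_min lexx orbT.
(* Near-maximality at [xe] gives |xe - x0|^2 < 2 sg + al <= 3/4 eta^2. *)
pose sg := Num.min (eta ^+ 2 / 4) tau.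
have sg0 : 0 < sg by rewrite lt_min tau0 divr_gt0// exprn_gt0.
have sg1 : sg <= eta ^+ 2 / 4 by rewrite ge_min lexx.
have sg2 : sg <= tau by rewrite ge_min lexx orbT.
have [e [[/andP[e0 er] esol] ecvg]] : exists e, ([set e | 0 < e <= rho'] `&`
    [set e | eps_solution s C e r M g phi (u_ e)] `&`
    [set e | forall x, `|u_ e x - u x| <= sg]) e.
  apply: (@filter_ex _ F); apply: filterI; last exact: (ucvg _ sg0).
  by apply: filterI; [exact: (F0 _ rho'0)|exact: usol].
have [uM' _ usub _ _] := esol.
pose lam := Jnu s e (fun=> 1).
have lam0 : 0 <= lam by exact: nu_integral_ge0.
have lam10 : 0 < lam + 1 by rewrite ltr_wpDl.
(* The slack is spread over all jumps and costs al * lam. As [lam] may blow up when [e] tends to 0,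
   [al] is chosen after [e]. *)
pose al := Num.min (eta ^+ 2 / 4) (tau / (lam + 1)).
have al0 : 0 < al by rewrite lt_min !divr_gt0// exprn_gt0.
have al1 : al <= eta ^+ 2 / 4 by rewrite ge_min lexx.
have al2 : al * lam <= tau.
  apply: (@le_trans _ _ (tau / (lam + 1) * lam)).
    by rewrite ler_wpM2r// ge_min lexx orbT.
  by rewrite mulrAC ler_pdivrMr// ler_wpM2l ?(ltW tau0)// lerDl.
pose xi1 x := xi x + enorm (x - x0) ^+ 2.
pose E := [set u_ e x - xi1 x | x in eball x0 (rho + rho)].
have hsE : has_sup E.
  split; first by exists (u_ e x0 - xi1 x0), x0.
  exists (2 * M) => _ [x Bx <-]; rewrite /xi1.
  have := uxi x (rhoU x Bx); have := uM x; have := uM' x.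
  have := sqr_ge0 (enorm (x - x0)).
  by rewrite !ler_norml; clear - s01; lra.
pose m := sup E.
have le_m x : eball x0 (rho + rho) x -> u_ e x - xi1 x <= m.
  by move=> Bx; apply: ub_le_sup; [exact: hsE.2|exists x].
have [_ [xe Bxe <-] xem] := sup_adherent al0 hsE.
rewrite -/m in xem.
have m_ge : - sg <= m.
  apply: le_trans (le_m x0 x0B).
  rewrite /xi1 subrr enorm0 expr0n addr0 xi0.
  by have := ecvg x0; rewrite ler_norml; clear - s01; lra.
have xe_lt : enorm (xe - x0) < eta.
  rewrite -(@ltr_pXn2r _ 2)// ?nnegrE ?enorm_ge0 ?(ltW eta0)//.
  have := ecvg xe; rewrite ler_norml => /andP[_].
  have := uxi xe (rhoU xe Bxe).
  have : 0 < eta ^+ 2 by rewrite exprn_gt0.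
  by move: xem sg1 al1 m_ge; rewrite /xi1; clear - s01; lra.
have Bre : eball 0 r xe by apply/Ur/rhoU.
(* The gradient of [xi1] at [xe]. The added square also contributes exactly |z|^2, whence M2 + 1. *)
pose p := D xe + 2 *: (xe - x0).
have [a1 J1] := @nu_integral_near_dot R d s s01 e rho' p e0.
have [a2 J2] := KP e rho' e0 rho'0.
have mo := measurable_out_eball (d := d) rho'.
have mu : measurable_fun setT (fun t : T => u (x0 + rowt t) - u x0).
  by apply: measurable_funB => //; exact: measurable_fun_rowt_shift.
(* Four errors of size [tau]: replacing [u_ e] by [u] and [xe] by [x0], at both ends of the jump. *)
pose hf (t : T) := (u (x0 + rowt t) - u x0) + 4 * tau.
have mhf : measurable_fun setT hf by exact: measurable_funD.
have adu r' : 0 < r' -> nu_integrable s r' (fun t : T => u (x0 + rowt t) - u x0).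
  move=> r'0; apply: (@nu_integrable_bounded _ _ _ s01 r' _ (2 * M)) => // t _.
  rewrite (le_trans (ler_normB _ _))//.
  by have := uM (x0 + rowt t); have := uM x0; clear - s01; lra.
have adhf r' : 0 < r' -> nu_integrable s r' hf by move=> r'0; apply: nu_integrableD;
  [exact: adu|exact: nu_integrable_cst].
have a3 := nu_integrable_indicM mo mhf (adhf e e0).
have ac : nu_integrable s e (fun _ : T => al) by exact: nu_integrable_cst.
pose h (t : T) := \1_[set t | N t < rho'] t * dot p (rowt t)
  + (M2 + 1) * (\1_[set t | N t < rho'] t * N t ^+ 2)
  + \1_(out_eball rho') t * hf t + al.
have ah1 := nu_integrableD a1 (nu_integrableZ (M2 + 1) a2).
have ah2 := nu_integrableD ah1 a3.
have ah : nu_integrable s e h := nu_integrableD ah2 ac.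
have Jh : Jnu s e h <= (M2 + 1) * (K2 * rho' `^ (2 - 2 * s))
    + Jnu s rho' (fun t => u (x0 + rowt t) - u x0) + 4 * tau * lam' + tau.
  rewrite /h (nu_integralD ah2 ac) (nu_integralD ah1 a3) (nu_integralD a1
    (nu_integrableZ (M2 + 1) a2)) J1 add0r nu_integralZ//.
  rewrite nu_integral_far// (nu_integralD (adu _ rho'0) (nu_integrable_cst s01 _ rho'0)).
  rewrite (nu_integral_cst s01 (4 * tau) rho'0) (nu_integral_cst s01 al e0) -/lam -/lam'.
  have M21 : 0 <= M2 + 1 by rewrite addr_ge0.
  by have := ler_wpM2l M21 J2; move: al2; clear - s01; lra.
have uh t : e <= N t -> u_ e (xe + rowt t) - u_ e xe <= h t.
  move=> et; rewrite /h !indicE out_eballE; have [t_lt|t_ge] := ltP (N t) rho'.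
    rewrite mem_set// memNset/=; last by rewrite leNgt t_lt.
    rewrite mulr1n !mul1r mulr0n mul0r addr0.
    have Bxt : eball x0 (rho + rho) (xe + rowt t).
      rewrite /eball/= addrAC (le_lt_trans (ler_enormD _ _))//.
      by rewrite ltrD// ?(lt_le_trans xe_lt)// (lt_trans t_lt).
    have := le_m _ Bxt.
    have := xiP xe (rowt t) (lt_le_trans xe_lt eta3) (lt_trans t_lt rho'rho).
    rewrite ler_norml => /andP[_].
    rewrite /p dotDl dotZl.
    move: xem; rewrite /xi1 [xe + rowt t - x0]addrAC (sqr_enormD (xe - x0));
      clear - s01; lra.
  rewrite memNset/= ?ltNge ?t_ge// mem_set//.
  rewrite mulr1n !mul1r mulr0n !mul0r mulr0 !add0r /hf.
  have xt : enorm (xe + rowt t - (x0 + rowt t)) <= d1.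
    by rewrite opprD addrACA subrr addr0 (le_trans (ltW xe_lt)).
  have := d1P _ _ xt; have := d1P _ _ (le_trans (ltW xe_lt) eta1).
  have := ecvg (xe + rowt t); have := ecvg xe.
  by move: sg2 al0; rewrite !ler_norml; clear - s01; lra.
have H := usub xe h Bre ah uh.
have gg : g xe (u_ e xe) <= g x0 (u x0) + tau + 2 * K * tau.
  have := gK xe (u_ e xe) (u x0) Bre (uM' xe) (uM x0).
  have := d2P xe x0 (u x0) Bre Bx0 (le_trans (ltW xe_lt) eta2) (uM x0).
  have ux : `|u_ e xe - u x0| <= 2 * tau.
    have := d1P _ _ (le_trans (ltW xe_lt) eta1); have := ecvg xe.
    by move: sg2; rewrite !ler_norml; clear - s01; lra.
  have := ler_wpM2l K0 ux.
  by rewrite !ler_norml; clear - s01; lra.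
have CJ := ler_wpM2l (ltW C0) Jh.
apply: le_trans H _; rewrite /base /Q; move: CJ gg; clear - s01; lra.
Qed.

End stability.

(** * Passage to the limit *)

Section compactness.
Context {R : realType}.

(** A cluster point along an ultrafilter is a limit, since a set or its complement belongs to the
    filter. Compactness of [-M, M] thus gives limits at all points at once, without subsequences. *)
Lemma ultrafilter_limit (X : Type) (F : set_system R) (u_ : R -> X -> R) (M : R) :
  UltraFilter F -> (\forall e \near F, forall x, `|u_ e x| <= M) ->
  exists u : X -> R, forall x tau, 0 < tau -> \forall e \near F, `|u_ e x - u x| <= tau.
Proof.
move=> UF uM.
suff H x : exists p : R, forall tau, 0 < tau -> \forall e \near F, `|u_ e x - p| <= tau.
  by exists (fun x => projT1 (cid (H x))) => x; exact: projT2 (cid (H x)).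
have GM : (u_ ^~ x @ F) `[- M, M]%classic.
  by apply: filterS uM => e /(_ x); rewrite /= in_itv/= ler_norml.
have [p [_ pP]] := @segment_compact R (- M) M _ (fmap_proper_filter _ _) GM.
exists p => tau tau0.
have [//|FC] := in_ultra_setVsetC [set e | `|u_ e x - p| <= tau] UF.
have pb : nbhs p [set y | `|y - p| <= tau].
  apply/nbhs_ballP; exists tau => //= y; rewrite -ball_normE/= distrC.
  exact: ltW.
by have [y [ny yp]] := pP (~` [set y | `|y - p| <= tau]) _ FC pb.
Qed.

End compactness.

Section compactness_euclidean.
Context {R : realType} {d : nat}.
Local Notation X := 'rV[R]_d.

(** The covering half of Ascoli's theorem: near each point equicontinuity spreads pointwise
    convergence, and the closed ball is compact; outside the ball there is nothing to estimate. *)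
Lemma uniform_limit (F : set_system R) (u_ : R -> X -> R) (u : X -> R) (r : R) :
  Filter F ->
  (forall x tau, 0 < tau -> \forall e \near F, `|u_ e x - u x| <= tau) ->
  (\forall e \near F, forall x, ~ eball 0 r x -> u_ e x = u x) ->
  (forall tau, 0 < tau -> exists2 delta, 0 < delta &
    (\forall e \near F, forall x y, enorm (x - y) <= delta ->
      `|u_ e x - u_ e y| <= tau) /\
    forall x y, enorm (x - y) <= delta -> `|u x - u y| <= tau) ->
  forall tau, 0 < tau -> \forall e \near F, forall x, `|u_ e x - u x| <= tau.
Proof.
move=> FF uP uout equi tau tau0.
have t30 : 0 < tau / 3 by rewrite divr_gt0.
have [delta delta0 [equi1 equi2]] := equi _ t30.
have cK := @compact_cball R d r.
have /compact_near_coveringP/(_ _ F (fun e x => `|u_ e x - u x| <= tau) FF) := cK.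
have H x : [set x : X | enorm x <= r] x ->
    \forall x' \near x & e \near F, `|u_ e x' - u x'| <= tau.
  move=> _.
  exists ([set x' | enorm (x' - x) < delta],
    [set e | forall x y, enorm (x - y) <= delta -> `|u_ e x - u_ e y| <= tau / 3] `&`
    [set e | `|u_ e x - u x| <= tau / 3]) => /=.
    split; last by apply: filterI => //; exact: uP.
    exact: near_eball delta0 _.
  move=> [x' e] /= [xx' [h1 h2]].
  have := h1 x' x (ltW xx'); have := equi2 x' x (ltW xx').
  by move: h2; rewrite !ler_norml => /andP[? ?] /andP[? ?] /andP[? ?]; apply/andP;
    split; lra.
move=> /(_ H); apply: filterS2 uout => e eout eK x.
have [xr|xr] := pselect (eball 0 r x); last by rewrite eout// subrr normr0 ltW.
by apply: eK; move: xr; rewrite /eball/= subr0 => /ltW.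
Qed.

(** Continuity holds on the open ball only, so the modulus is taken on the smaller closed ball; this
    is why the final radius stays strictly below [R1]. *)
Lemma uniform_modulus (c : X -> R) (R1 r : R) : r < R1 ->
  {within eball 0 R1, continuous c} -> forall w, 0 < w ->
  exists2 delta, 0 < delta & forall x x', eball 0 r x -> eball 0 r x' ->
    enorm (x - x') <= delta -> `|c x - c x'| <= w.
Proof.
move=> rR1 cc w w0.
have cB : {in eball 0 R1, continuous c}.
  by rewrite -continuous_open_subspace//; exact: open_eball.
have w20 : 0 < w / 2 by rewrite divr_gt0.
have cK := @compact_cball R d r.
have /compact_near_coveringP/(_ _ (0^'+ : set_system R)
  (fun delta x => forall x', enorm (x' - x) <= delta -> `|c x - c x'| <= w) _) := cK.
have H x : [set x : X | enorm x <= r] x ->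
    \forall x' \near x & delta \near (0^'+ : set_system R),
      forall x'', enorm (x'' - x') <= delta -> `|c x' - c x''| <= w.
  move=> /= xr.
  have cx : {for x, continuous c}.
    by apply: cB; rewrite inE /eball/= subr0; exact: le_lt_trans rR1.
  have /nbhs_eball[rho rho0 rhoP] : nbhs x [set y | `|c x - c y| < w / 2].
    by move/(@cvgrPdist_lt _ _ _ (nbhs x) (nbhs_filter x)) : cx; apply.
  have rho20 : 0 < rho / 2 by rewrite divr_gt0.
  exists ([set x' | enorm (x' - x) < rho / 2], [set delta | delta < rho / 2]) => /=.
    split; last exact: nbhs_right_lt.
    exact: near_eball rho20 _.
  move=> [x' delta] /= [xx' dr] x'' x'x''.
  have b1 : `|c x - c x'| < w / 2 by apply: rhoP; rewrite /eball/=; lra.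
  have b2 : `|c x - c x''| < w / 2.
    by apply: rhoP; rewrite /eball/=; have := ler_enormB x'' x' x; lra.
  by move: b1 b2; rewrite !ltr_norml ler_norml => /andP[? ?] /andP[? ?]; apply/andP;
    split; lra.
move=> /(_ H) H'.
have [delta [delta0 dP]] : exists delta : R, ([set delta | 0 < delta] `&`
    [set delta | forall x, enorm x <= r ->
      forall x', enorm (x' - x) <= delta -> `|c x - c x'| <= w]) delta.
  apply: (@filter_ex _ (0^'+ : set_system R)); apply: filterI; first exact: nbhs_right_gt.
  exact: H'.
exists delta => // x x' + _ xx'; rewrite /eball/= subr0 => /ltW xr.
by apply: dP => //; rewrite enormBC.
Qed.

End compactness_euclidean.

Section limit_viscosity.
Context {R : realType} {d : nat}.
Variable s : R.
Hypothesis s01 : 0 < s < 1.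
Local Notation T := (d.-tuple (measurableTypeR R)).
Local Notation N := (fun t : T => enorm (rowt t)).
Local Notation X := 'rV[R]_d.
Local Notation Jnu := (@nu_integral R d).

Lemma limit_inequality (C A a G l rho : R) (I : R -> R) :
  0 < C -> 0 <= A -> 0 < a -> 0 < rho -> I r @[r --> 0^'+] --> l ->
  (forall r, 0 < r -> r < rho -> 0 <= C * (A * r `^ a + I r) + G) ->
  0 <= C * l + G.
Proof.
move=> C0 A0 a0 rho0 Il H; rewrite leNgt; apply/negP => neg.
(* The two errors, A r^a and |l - I r|, then use up at most two thirds of the supposed deficit. *)
pose tau := - (C * l + G) / (3 * C).
have tau0 : 0 < tau by rewrite divr_gt0 ?oppr_gt0// mulr_gt0.
have tauE : C * tau = - (C * l + G) / 3 by rewrite /tau; field; rewrite gt_eqF.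
have [r1 r10 r1P] := powR_small a0 A0 tau0.
have [r [[r0 rr1] [rrho rl]]] : exists r : R, (([set r | 0 < r] `&` [set r | r <= r1]) `&`
    ([set r | r < rho] `&` [set r | `|l - I r| < tau])) r.
  apply: (@filter_ex _ (0^'+ : set_system R)); apply: filterI; apply: filterI.
  - exact: nbhs_right_gt.
  - exact: nbhs_right_le.
  - exact: nbhs_right_lt.
  - by move/(@cvgrPdist_lt _ _ _ (0^'+ : set_system R)) : Il; apply.
have h1 := ler_wpM2l (ltW C0) (r1P r r0 rr1).
have h2 : C * I r <= C * (l + tau).
  by rewrite ler_wpM2l ?(ltW C0)//; move: rl => /=; rewrite ltr_norml => /andP[]; lra.
have /= := H r r0 rrho.
move: h1 h2; rewrite !mulrDr tauE; lra.
Qed.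

Lemma viscosity_of_limit (f : X -> R -> R) (r M K : R) (phi u : X -> R)
    (F : set_system R) (u_ : R -> X -> R) :
  let C := frac_laplacian_const d s in
  let g x y := f x y - y in
  0 <= K ->
  (forall x y y', eball 0 r x -> `|y| <= M -> `|y'| <= M ->
    `|g x y - g x y'| <= K * `|y - y'|) ->
  (forall w, 0 < w -> exists2 delta, 0 < delta & forall x x' y,
    eball 0 r x -> eball 0 r x' -> enorm (x - x') <= delta ->
    `|y| <= M -> `|g x y - g x' y| <= w) ->
  ProperFilter F -> (forall delta, 0 < delta -> F [set e | 0 < e <= delta]) ->
  (\forall e \near F, eps_solution s C e r M g phi (u_ e)) ->
  (forall tau, 0 < tau -> \forall e \near F, forall x, `|u_ e x - u x| <= tau) ->
  continuous u ->
  (forall tau, 0 < tau -> exists2 delta, 0 < delta & forall x y,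
     enorm (x - y) <= delta -> `|u x - u y| <= tau) ->
  (forall x, `|u x| <= M) ->
  viscosity_subsolution s f r u /\ viscosity_supersolution s f r u.
Proof.
move=> C g K0 gK gw PF F0 usol ucvg ucont uunif uM.
have C0 : 0 < C by exact: frac_laplacian_const_gt0.
have [K2 K20 KP] := @nu_integral_near_sqr R d s s01.
have a0 : 0 < 2 - 2 * s by case/andP: s01; lra.
have common x0 U xi : test_neighborhood r x0 U -> C2_closure U xi -> xi x0 = u x0 ->
  let w := patch u U xi in
  [/\ frac_laplacian_exists s w x0, w x0 = u x0,
    forall r', 0 < r' -> nu_integrable s r' (fun t : T => w (x0 + rowt t) - w x0),
    forall r', 0 < r' -> nu_integrable s r' (fun t : T => u (x0 + rowt t) - u x0) &
  exists rho M2 : R, exists D : X -> X, [/\ 0 < rho, 0 <= M2,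
    eball x0 (rho + rho) `<=` U &
    forall x z, enorm (x - x0) < rho -> enorm z < rho ->
      `|xi (x + z) - xi x - dot (D x) z| <= M2 * enorm z ^+ 2]].
  move=> [oU Ux0 Ur] C2 xi0 w.
  have [rho [M2 [D [rho0 M20 rhoU xiP]]]] := C2_taylor oU Ux0 C2.
  have [cxi _] := C2.
  have wU x : U x -> w x = xi x by move=> Ux; rewrite /w /patch mem_set.
  have wx0 : w x0 = u x0 by rewrite wU.
  (* The closure of [U] is compact in the ball, so [xi], and with it the patched function, is
     bounded; the far integrals then exist. *)
  have [B B0 xiB] : exists2 B, 0 <= B & forall x, closure U x -> `|xi x| <= B.
    have cU : compact (closure U).
      apply: (subclosed_compact _ (@compact_cball R d r)); first exact: closed_closure.
      by move=> x /Ur; rewrite /eball/= subr0 => /ltW.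
    have /compact_bounded[B [_ BP]] := continuous_compact cxi cU.
    exists (`|B| + 1); first by rewrite addr_ge0.
    move=> x Ux; apply: (BP (`|B| + 1)); last by exists x.
    by rewrite ltr_pwDr// ler_norm.
  have wB y : `|w y| <= M + B.
    rewrite /w /patch; case: ifPn => [|_].
      rewrite inE => Uy; rewrite (le_trans (xiB y _))//; first exact: subset_closure.
      by rewrite lerDr (le_trans (normr_ge0 (u y))).
    by rewrite (le_trans (uM y))// lerDl.
  have mw : measurable_fun setT (fun t : T => w (x0 + rowt t)).
    exact: measurable_fun_rowt_patch.
  split.
  - apply: (@frac_laplacian_exists_taylor _ _ s s01 w x0 (D x0) M2 (M + B) rho) => //.
    move=> z zr; rewrite !wU//; last first.
      by apply: rhoU; rewrite /eball/= addrAC subrr add0r; lra.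
    by apply: xiP => //; rewrite subrr enorm0.
  - exact: wx0.
  - move=> r' r'0; apply: (@nu_integrable_bounded _ _ _ s01 r' _ (2 * (M + B))) => //.
      by apply: measurable_funB.
    move=> t _; rewrite (le_trans (ler_normB _ _))//.
    by have := wB (x0 + rowt t); have := wB x0; lra.
  - move=> r' r'0; apply: (@nu_integrable_bounded _ _ _ s01 r' _ (2 * M)) => //.
      by apply: measurable_funB => //; exact: measurable_fun_rowt_shift.
    move=> t _; rewrite (le_trans (ler_normB _ _))//.
    by have := uM (x0 + rowt t); have := uM x0; lra.
  - by exists rho, M2, D.
split.
- move=> x0 U xi Bx0 tU C2 xi0 uxi w.
  have [wex wx0 aw au [rho [M2 [D [rho0 M20 rhoU xiP]]]]] := common _ _ _ tU C2 xi0.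
  split=> //; have [_ wcvg] := wex.
  have [oU Ux0 Ur] := tU.
  have Ur' : U `<=` eball 0 r by move=> x Ux; apply: Ur; exact: subset_closure.
  have H := limit_subsolution s01 C0 K0 KP gK gw PF F0 usol ucvg ucont uunif uM
    Ur' rho0 M20 rhoU xiP xi0 uxi.
  rewrite -addrA; apply: (@limit_inequality _ ((M2
    + 1) * K2) _ _ _ rho _ C0 _ a0 rho0 wcvg).
    by rewrite mulr_ge0 ?addr_ge0// ltW.
  (* The integrals so far are those of [u]; since [w] lies above [u] and equals it at [x0], passing
     to [w] only increases them. *)
  move=> r' r'0 r'rho; apply: le_trans (H r' r'0 r'rho) _.
  rewrite lerD2r ler_pM2l// mulrA lerD2l.
  apply: le_nu_integral; [exact: au|exact: aw|].
  move=> t _; rewrite wx0 lerD2r /w /patch; case: ifPn => // .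
  by rewrite inE; exact: uxi.
- move=> x0 U xi Bx0 tU C2 xi0 uxi w.
  have [wex wx0 aw au [rho [M2 [D [rho0 M20 rhoU xiP]]]]] := common _ _ _ tU C2 xi0.
  split=> //; have [_ wcvg] := wex.
  have [oU Ux0 Ur] := tU.
  have Ur' : U `<=` eball 0 r by move=> x Ux; apply: Ur; exact: subset_closure.
  (* The supersolution case is the subsolution case for [- u], tested by [- xi], with the
     nonlinearity [opp_nonlin g]. *)
  have H : forall rho', 0 < rho' -> rho' < rho ->
    0 <= C * ((M2 + 1) * (K2 * rho' `^ (2 - 2 * s)) +
              Jnu s rho' (fun t => - u (x0 + rowt t) - - u x0)) +
         opp_nonlin g x0 (- u x0).
    apply: (@limit_subsolution _ _ s s01 C r M K K2 (opp_nonlin g) (fun x => - phi x)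
      (fun x => - u x) F (fun e x => - u_ e x) U (fun x => - xi x) x0 rho M2
      (fun x => - D x)) => //.
    - move=> x y y' Bx yM y'M; rewrite /opp_nonlin -opprD normrN.
      have := gK x (- y) (- y') Bx; rewrite !normrN => /(_ yM y'M).
      by rewrite -opprD normrN.
    - move=> z z0; have [de de0 deP] := gw z z0; exists de => // x x' y Bx Bx' xx' yM.
      by rewrite /opp_nonlin -opprD normrN; apply: deP => //; rewrite normrN.
    - by apply: filterS usol => e; exact: eps_solutionN.
    - move=> tau tau0; have := ucvg tau tau0; apply: filterS => e + x => /(_ x).
      by rewrite -opprD normrN.
    - by move=> x; apply: continuousN; exact: ucont.
    - move=> tau tau0; have [de de0 deP] := uunif tau tau0; exists de => // x y xy.
      by rewrite -opprD normrN; exact: deP.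
    - by move=> x; rewrite normrN.
    - move=> x z xr zr; have := xiP x z xr zr.
      rewrite -normrN dotNl => h; rewrite [X in `|X|](_ : _ =
        - (xi (x + z) - xi x - dot (D x) z)) //; ring.
    - by rewrite xi0.
    - by move=> x Ux; rewrite lerN2 uxi.
  rewrite -oppr_ge0 -addrA opprD -mulrN.
  have wcvg' : (- frac_truncated s w x0 r) @[r --> 0^'+] --> - lim (frac_truncated s w
    x0 r @[r --> 0^'+]).
    by apply: cvgN; exact: wcvg.
  apply: (@limit_inequality _ ((M2 + 1) * K2) _ _ _ rho _ C0 _ a0 rho0 wcvg').
    by rewrite mulr_ge0 ?addr_ge0// ltW.
  move=> r' r'0 r'rho; apply: le_trans (H r' r'0 r'rho) _.
  rewrite /opp_nonlin opprK lerD2r ler_pM2l// mulrA lerD2l.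
  rewrite (@eq_nu_integral _ _ _ _ _ (fun t => -1 * (u (x0 + rowt t) - u x0)));
    last first.
    by move=> t _; ring.
  rewrite nu_integralZ ?mulN1r ?lerN2; last exact: au.
  apply: le_nu_integral; [exact: aw|exact: au|].
  move=> t _; rewrite -[u x0]wx0 lerD2r /w /patch; case: ifPn => // .
  by rewrite inE; exact: uxi.
Qed.

End limit_viscosity.

(** * Polynomial nonlinearities *)

Section polynomial_nonlinearity.
Context {R : realType} {d : nat}.
Local Notation X := 'rV[R]_d.

(** M^l replaces the sharp M^(l-1), which avoids a predecessor at l = 0; this is affordable because
    1 <= M. *)
Lemma expr_lipschitz (M y z : R) (l : nat) : 1 <= M -> `|y| <= M -> `|z| <= M ->
  `|y ^+ l - z ^+ l| <= l%:R * M ^+ l * `|y - z|.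
Proof.
move=> M1 yM zM; elim: l => [|l IH]; first by rewrite !expr0 subrr normr0 !mul0r.
have M0 : 0 <= M by exact: le_trans M1.
have -> : y ^+ l.+1 - z ^+ l.+1 = y * (y ^+ l - z ^+ l) + (y - z) * z ^+ l.
  by rewrite !exprS; ring.
rewrite (le_trans (ler_normD _ _))// !normrM normrX -natr1.
apply: (@le_trans _ _ (M * (l%:R * M ^+ l * `|y - z|) + `|y - z| * M ^+ l.+1)).
  apply: lerD; first exact: ler_pM.
  rewrite ler_wpM2l// exprS -[leLHS]mul1r.
  by apply: ler_pM; rewrite ?exprn_ge0// lerXn2r ?nnegrE.
by rewrite exprS le_eqVlt; apply/orP; left; apply/eqP; ring.
Qed.

Lemma common_delta (L : seq nat) (P : nat -> R -> Prop) :
  (forall l delta delta', 0 < delta' -> delta' <= delta -> P l delta -> P l delta') ->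
  (forall l, l \in L -> exists2 delta, 0 < delta & P l delta) ->
  exists2 delta, 0 < delta & forall l, l \in L -> P l delta.
Proof.
move=> Pmono; elim: L => [_|l L IH H]; first by exists 1.
have [l' l'L|d1 d10 d1P] := IH; first by apply: H; rewrite inE l'L orbT.
have [|d2 d20 d2P] := H l; first by rewrite inE eqxx.
have d30 : 0 < Num.min d1 d2 by rewrite lt_min d10.
exists (Num.min d1 d2) => // l'; rewrite inE => /orP[/eqP ->|l'L].
  by apply: (Pmono _ d2) => //; rewrite ge_min lexx orbT.
by apply: (Pmono _ d1); [exact: d30|rewrite ge_min lexx|exact: d1P].
Qed.

Variables (L : {fset nat}) (c : nat -> X -> R) (R1 M : R).
Hypothesis M1 : 1 <= M.
Hypothesis hc : forall l, l \in L -> bounded_continuous_on (eball 0 R1) (c l).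

Let M0 : 0 <= M. Proof. exact: le_trans M1. Qed.

Let cbound : exists mc : nat -> R, forall l x, l \in L -> eball 0 R1 x ->
  `|c l x| <= `|mc l|.
Proof.
have H l : exists m : R, forall x, l \in L -> eball 0 R1 x -> `|c l x| <= `|m|.
  have [/hc[[m mP] _]|nl] := boolP (l \in L); last by exists 0.
  by exists m => x _ Bx; rewrite (le_trans (mP x Bx))// ler_norm.
by exists (fun l => projT1 (cid (H l))) => l; exact: (projT2 (cid (H l))).
Qed.

Lemma poly_nonlinearity_bounded : exists2 F : R, 0 <= F & forall x y,
  eball 0 R1 x -> `|y| <= M -> `|poly_nonlinearity L c x y - y| <= F.
Proof.
have [mc mcP] := cbound.
exists (\sum_(l <- L) `|mc l| * M ^+ l + M).
  by rewrite addr_ge0// sumr_ge0// => l _; rewrite mulr_ge0// exprn_ge0.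
move=> x y Bx yM; rewrite (le_trans (ler_normB _ _))// lerD//.
rewrite /poly_nonlinearity (le_trans (ler_norm_sum _ _ _))//.
rewrite big_seq_cond [leRHS]big_seq_cond; apply: ler_sum => l /andP[lL _].
rewrite normrM normrX; apply: ler_pM; rewrite ?exprn_ge0//; first exact: mcP.
by rewrite lerXn2r ?nnegrE.
Qed.

Lemma poly_nonlinearity_lipschitz : exists2 K : R, 0 < K & forall x y y',
  eball 0 R1 x -> `|y| <= M -> `|y'| <= M ->
  `|(poly_nonlinearity L c x y - y) - (poly_nonlinearity L c x y' - y')|
    <= K * `|y - y'|.
Proof.
have [mc mcP] := cbound.
exists (\sum_(l <- L) `|mc l| * (l%:R * M ^+ l) + 1).
  by rewrite ltr_wpDl// sumr_ge0// => l _; rewrite !mulr_ge0// exprn_ge0.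
move=> x y y' Bx yM y'M.
rewrite (_ : _ - _ = poly_nonlinearity L c x y - poly_nonlinearity L c x y' - (y - y'));
  last by ring.
rewrite (le_trans (ler_normB _ _))// mulrDl mul1r lerD2r.
rewrite /poly_nonlinearity -sumrB mulr_suml (le_trans (ler_norm_sum _ _ _))//.
rewrite big_seq_cond [leRHS]big_seq_cond; apply: ler_sum => l /andP[lL _].
rewrite -mulrBr normrM -mulrA; apply: ler_pM => //; first exact: mcP.
exact: expr_lipschitz.
Qed.

Lemma poly_nonlinearity_modulus (r : R) : r < R1 -> forall w, 0 < w ->
  exists2 delta, 0 < delta & forall x x' y,
    eball 0 r x -> eball 0 r x' -> enorm (x - x') <= delta -> `|y| <= M ->
    `|(poly_nonlinearity L c x y - y) - (poly_nonlinearity L c x' y - y)| <= w.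
Proof.
move=> rR1 w w0.
pose S := \sum_(l <- L) M ^+ l.
have S0 : 0 <= S by rewrite sumr_ge0// => l _; rewrite exprn_ge0.
have S1 : 0 < S + 1 by rewrite ltr_wpDl.
have w'0 : 0 < w / (S + 1) by rewrite divr_gt0.
have [|l lL|delta delta0 dP] := @common_delta L (fun l delta =>
    forall x x' : X, eball 0 r x -> eball 0 r x' -> enorm (x - x') <= delta ->
    `|c l x - c l x'| <= w / (S + 1)).
- move=> l delta delta' _ dd' H x x' Bx Bx' xx'.
  by apply: H => //; exact: le_trans dd'.
- exact: (uniform_modulus rR1 (hc lL).2).
exists delta => // x x' y Bx Bx' xx' yM.
rewrite (_ : _ - _ = poly_nonlinearity L c x y - poly_nonlinearity L c x' y);
  last by ring.
rewrite /poly_nonlinearity -sumrB (le_trans (ler_norm_sum _ _ _))//.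
apply: (@le_trans _ _ (\sum_(l <- L) (w / (S + 1)) * M ^+ l)).
  rewrite big_seq_cond [leRHS]big_seq_cond; apply: ler_sum => l /andP[lL _].
  rewrite -mulrBl normrM normrX; apply: ler_pM; rewrite ?exprn_ge0//.
    exact: dP.
  by rewrite lerXn2r ?nnegrE.
by rewrite -mulr_sumr -/S mulrAC ler_pdivrMr// ler_wpM2l ?(ltW w0)// lerDl.
Qed.

End polynomial_nonlinearity.

(** The jumps of length at least 2r include a cone at scale 2r in any direction, of mass at least c
    (2r)^(-2s), which tends to infinity as r tends to 0. *)
Lemma killing_rate_large (R : realType) (d : nat) (s C H : R) :
  0 < s < 1 -> (0 < d)%N -> 0 < C -> 0 <= H ->
  exists2 r0, 0 < r0 & forall r, 0 < r -> r <= r0 ->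
    H <= C * @nu_integral R d s (2 * r) (fun=> 1).
Proof.
move=> s01 d0 C0 H0.
have [c c0 cP] := @nu_integral_cone R d s s01 d0.
have s2 : 0 < 2 * s by case/andP: s01 => ? _; rewrite mulr_gt0.
have [r1 r10 r1P] := powR_small s2 H0 (mulr_gt0 C0 c0).
(* The bound 1/8 gives 3 (2r) < 1 for the cone estimate. *)
pose r0 := Num.min (r1 / 2) 8^-1.
exists r0; first by rewrite lt_min invr_gt0 ltr0n divr_gt0.
move=> r r_gt0 rr0.
have rr1 : r <= r1 / 2 by rewrite (le_trans rr0)// ge_min lexx.
have rr8 : r <= 8^-1 by rewrite (le_trans rr0)// ge_min lexx orbT.
have r20 : 0 < 2 * r by rewrite mulr_gt0.
have r23 : 3 * (2 * r) < 1 by lra.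
have [n [n1 _]] := exists_direction d0 (0 : 'rV[R]_d).
have [mE JE] := cP (2 * r) (2 * r) n r20 (lexx _) r23 n1.
set E := [set t | _] in mE JE.
have aE : nu_integrable s (2 * r) (\1_E : _ -> R).
  apply: (@nu_integrable_bounded _ _ _ s01 _ _ 1) => //.
  by move=> t _; rewrite indicE; case: (_ \in _); rewrite ?normr1 ?normr0.
have : @nu_integral R d s (2 * r) (\1_E) <= @nu_integral R d s (2 * r) (fun=> 1).
  by apply: le_nu_integral => //; exact: nu_integrable1.
move=> /(le_trans JE)/(ler_wpM2l (ltW C0)) JC; apply: le_trans JC.
have h : 2 * r <= r1 by lra.
have := r1P (2 * r) r20 h.
by rewrite mulrA powRN ler_pdivlMr// powR_gt0.
Qed.

(** * Choice of the radius and passage to the limit *)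

Unset Implicit Arguments.

Theorem theorem1p2 (R : realType) (d : nat) (s : R) (L : {fset nat}) (R1 : R)
    (phi : 'rV[R]_d -> R) (c : nat -> 'rV[R]_d -> R)
    (hd : (1 <= d)%N) (hs : 0 < s < 1) (hR1 : 0 < R1)
    (hphi : bounded_Lipschitz phi)
    (hc : forall l, l \in L -> bounded_continuous_on (eball 0 R1) (c l)) :
  exists2 R0 : R, 0 < R0 <= R1 &
    forall r : R, 0 < r <= R0 ->
      exists u : 'rV[R]_d -> R,
        continuous_viscosity_solution s (poly_nonlinearity L c) phi r u.
Proof.
have [[Mphi MphiP] [Lip LipP]] := hphi.
(* The 1 is the margin lost at each jump out of the ball; it also gives 1 <= M for the polynomial
   bounds. *)
pose M := `|Mphi| + 1.
have M1 : 1 <= M by rewrite lerDr.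
have M0 : 0 <= M by exact: le_trans M1.
have phiM1 x : `|phi x| <= M - 1 by rewrite addrK (le_trans (MphiP x))// ler_norm.
have phiM x : `|phi x| <= M by rewrite (le_trans (phiM1 x))// gerBl.
have phiL x y : `|phi x - phi y| <= `|Lip| * enorm (x - y).
  by rewrite (le_trans (LipP x y))// ler_wpM2r ?enorm_ge0// ler_norm.
have [F F0 FP] := poly_nonlinearity_bounded M1 hc.
have [K K0 KP] := poly_nonlinearity_lipschitz M1 hc.
pose C := frac_laplacian_const d s.
have C0 : 0 < C by exact: frac_laplacian_const_gt0.
(* [F] is for the existence of the truncated solutions below [M], [K + 1] for their
   equicontinuity. *)
pose H := Num.max F (K + 1).
have H0 : 0 <= H by rewrite le_max F0.
have [r0 r00 r0P] := @killing_rate_large R d s C H hs hd C0 H0.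
(* In turn: the killing rate, a closed ball inside the domain of the coefficients, and the scale of
   the barrier. *)
exists (Num.min r0 (Num.min (R1 / 2) 8^-1)).
  rewrite !lt_min r00 divr_gt0// invr_gt0 ltr0n/=.
  by rewrite !ge_min (_ : R1 / 2 <= R1) ?orbT//; lra.
move=> r /andP[r_gt0]; rewrite !le_min => /and3P[rr0 rR1 r8].
have {}rR1 : r < R1 by lra.
pose g x y := poly_nonlinearity L c x y - y.
have BR1 (x : 'rV[R]_d) : eball 0 r x -> eball 0 R1 x.
  by rewrite /eball/= subr0 => /lt_trans; apply.
have gF x y : eball 0 r x -> `|y| <= M -> `|g x y| <= F by move=> /BR1; exact: FP.
have gK x y y' : eball 0 r x -> `|y| <= M -> `|y'| <= M ->
    `|g x y - g x y'| <= K * `|y - y'| by move=> /BR1; exact: KP.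
have gw := poly_nonlinearity_modulus M1 hc rR1.
have HP := r0P r r_gt0 rr0.
have kF : F <= C * @nu_integral R d s (2 * r) (fun=> 1) by rewrite (le_trans _ HP)//
  le_max lexx.
have kK : K + 1 <= C * @nu_integral R d s (2 * r) (fun=> 1).
  by rewrite (le_trans _ HP)// le_max lexx orbT.
have r20 : 0 < 2 * r by rewrite mulr_gt0.
have ex e : 0 < e -> e <= 2 * r -> exists u, eps_solution s C e r M g phi u.
  move=> e0 er; apply: (eps_solution_exists hs C0 e0 er K0 phiM1 gK).
  by move=> x y Bx yM; rewrite (le_trans _ kF)// gF.
(* [phi] is a default value: along the filter e <= 2r eventually, and then a solution exists. *)
pose u_ e : 'rV[R]_d -> R :=
  if pselect (exists u, eps_solution s C e r M g phi u) is left h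
  then projT1 (cid h) else phi.
have u_P e : 0 < e -> e <= 2 * r -> eps_solution s C e r M g phi (u_ e).
  move=> e0 er; rewrite /u_; case: pselect => [h|]; first exact: projT2 (cid h).
  by case; exact: ex.
have equi := equicontinuity hs hd C0 M0 F0 (normr_ge0 Lip) (ltW K0) r_gt0 r8 kK
  gF gK gw phiM phiL.
have [G [UG rG]] := @ultraFilterLemma R (0^'+) (at_right_proper_filter 0).
have G0 delta : 0 < delta -> G [set e | 0 < e <= delta].
  move=> delta0; apply: rG.
  have : (0 : R)^'+ ([set e | 0 < e] `&` [set e | e <= delta]).
    by apply: filterI; [exact: nbhs_right_gt|exact: nbhs_right_le].
  by apply: filterS => e [/= -> ->].
have usol : \forall e \near G, eps_solution s C e r M g phi (u_ e).
  by apply: filterS (G0 _ r20) => e /andP[e0 er]; exact: u_P.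
have [u uP] : exists u : 'rV[R]_d -> R, forall x tau, 0 < tau ->
    \forall e \near G, `|u_ e x - u x| <= tau.
  apply: (ultrafilter_limit (M := M)).
  by apply: filterS usol => e eu x; exact: eps_bounded eu x.
have approx (P : R -> Prop) x y tau : 0 < tau -> (\forall e \near G, P e) ->
    exists e, [/\ P e, `|u_ e x - u x| <= tau & `|u_ e y - u y| <= tau].
  move=> tau0 GP.
  have [e [? [? ?]]] : exists e, ([set e | P e] `&` ([set e | `|u_ e x - u x| <= tau]
     `&` [set e | `|u_ e y - u y| <= tau])) e.
    apply: (@filter_ex _ G); apply: filterI => //.
    by apply: filterI; exact: uP.
  by exists e.
have uphi x : ~ eball 0 r x -> u x = phi x.
  move=> nBx; apply/eqP; rewrite -subr_eq0 -normr_le0; apply/ler_addgt0Pl => tau tau0.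
  have [e [eu + _]] := approx _ x x tau tau0 usol.
  by rewrite (eps_exterior eu nBx) distrC addr0.
have uM x : `|u x| <= M.
  apply/ler_addgt0Pl => tau tau0.
  have [e [eu h _]] := approx _ x x tau tau0 usol.
  have := eps_bounded eu x; move: h.
  by rewrite !ler_norml; clear; lra.
have equi_near tau : 0 < tau -> exists2 delta, 0 < delta &
    (\forall e \near G, forall x y, enorm (x - y) <= delta -> `|u_ e x - u_ e y| <= tau).
  move=> tau0; have [delta delta0 dP] := equi tau tau0.
  exists delta => //; apply: (filterS _ (filterI usol (G0 _ delta0))) =>
    e [eu /andP[e0 ed]].
  exact: (dP e (u_ e) e0 ed eu).
have uunif tau : 0 < tau -> exists2 delta, 0 < delta &
    forall x y, enorm (x - y) <= delta -> `|u x - u y| <= tau.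
  move=> tau0; have [delta delta0 dP] := equi_near tau tau0.
  exists delta => // x y xy; apply/ler_addgt0Pl => z z0.
  have z20 : 0 < z / 2 by rewrite divr_gt0.
  have [e [/(_ x y xy) h1 h2 h3]] := approx _ x y (z / 2) z20 dP.
  by move: h1 h2 h3; rewrite !ler_norml; clear; lra.
have ucont : continuous u.
  move=> x; apply/(@cvgrPdist_le _ _ _ (nbhs x) (nbhs_filter x)) => tau tau0.
  have [delta delta0 dP] := uunif tau tau0.
  by apply: (near_eball delta0) => y yx; apply: dP; rewrite enormBC ltW.
have ucvg : forall tau, 0 < tau -> \forall e \near G, forall x, `|u_ e x - u x| <= tau.
  apply: (@uniform_limit _ _ _ _ _ r) => //.
    by apply: filterS usol => e eu x nBx; rewrite (eps_exterior eu nBx) uphi.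
  move=> tau tau0; have [d1 d10 d1P] := equi_near tau tau0.
  have [d2 d20 d2P] := uunif tau tau0.
  exists (Num.min d1 d2); first by rewrite lt_min d10.
  split; last by move=> x y; rewrite le_min => /andP[_]; exact: d2P.
  by apply: filterS d1P => e + x y; rewrite le_min => /(_ x y) + /andP[+ _].
have [sub super] := viscosity_of_limit hs (ltW K0) gK gw _ G0 usol ucvg ucont uunif uM.
exists u; split => //.
exact: continuous_subspaceT.
Qed.
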